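(* Let $n,N\ge1$ and let $\Theta^N_{2n}\in C^{2n}(\mathfrak{gl}_N(\mathcal A^{\mathrm{pol}}_{2n});\mathfrak{gl}_N(\mathcal A^{\mathrm{pol}}_{2n})^* )$ be the Lie algebra cocycle $$\Theta^N_{2n}(M_1\otimes a_1,\dots,M_{2n}\otimes a_{2n})(M_0\otimes a_0)=\sum_{\sigma\in S_{2n}}\mathrm{sign}(\sigma)\,\tau_{2n}(a_0\otimes a_{\sigma(1)}\otimes\cdots\otimes a_{\sigma(2n)})\,\mathrm{tr}(M_0M_{\sigma(1)}\cdots M_{\sigma(2n)}).$$ Then $\Theta^N_{2n}$ belongs to the relative complex of the pair $(\mathfrak{gl}_N(\mathcal A^{\mathrm{pol}}_{2n}),\mathfrak{gl}_N\oplus\mathfrak{sp}_{2n})$ and defines a non-trivial class $$[\Theta^N_{2n}]\in H^{2n}\big(\mathfrak{gl}_N(\mathcal A^{\mathrm{pol}}_{2n}),\mathfrak{gl}_N\oplus\mathfrak{sp}_{2n};\mathfrak{gl}_N(\mathcal A^{\mathrm{pol}}_{2n})^*\big),$$ compatible with the inclusions $i_{N'N}:\mathfrak{gl}_N(\mathcal A^{\mathrm{pol}}_{2n})\to\mathfrak{gl}_{N'}(\mathcal A^{\mathrm{pol}}_{2n})$, $N<N'$. It obeys $$\Theta^N_{2n}(p_1\wedge q_1\wedge\cdots\wedge p_n\wedge q_n)(1)=N .$$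
   Context: $K=\mathbb C[\epsilon,\epsilon^{-1}]$. $\mathcal A=\mathcal A^{\mathrm{pol}}_{2n}$ is $K[p_1,\dots,p_n,q_1,\dots,q_n]$ with Moyal product $f\star g=m(\exp(\epsilon\alpha)(f\otimes g))$, $m(f\otimes g)=fg$, $\alpha=\frac12\sum_i(\partial_{p_i}\otimes\partial_{q_i}-\partial_{q_i}\otimes\partial_{p_i})$; $y_{2i-1}=p_i$, $y_{2i}=q_i$. $\mathfrak{gl}_N(\mathcal A)=M_N(\mathbb C)\otimes\mathcal A$ is a Lie algebra over $K$ with bracket $[x,y]_\epsilon=\frac1\epsilon(xy-yx)$; $\mathfrak{gl}_N$ is the $K$-span of $M_N(\mathbb C)\otimes1$ and $\mathfrak{sp}_{2n}$ the $K$-span of $1\otimes a$ with $a$ a homogeneous quadratic polynomial in $y$. In the last formula $p_i$, $q_i$, $1$ stand for $1\otimes p_i$, $1\otimes q_i$, $1\otimes 1$. The map $i_{N'N}$ puts an $N\times N$ matrix in the first rows and columns of an $N'\times N'$ matrix, completed with zeros; it induces a restriction map $i_{N'N}^*$ on cochains (restriction in all arguments), and compatibility with inclusions refers to this restriction, which takes the object for $N'$ to the object for $N$. For a Lie algebra pair $\mathfrak h\subset\mathfrak g$ over $K$ and a $\mathfrak g$-module $V$, $C^\bullet(\mathfrak g,\mathfrak h;V)=\mathrm{Hom}_K(\wedge^\bullet(\mathfrak g/\mathfrak h),V)^{\mathfrak h}$ is the subcomplex of the Chevalley--Eilenberg complex $C^\bullet(\mathfrak g;V)$ of $\mathfrak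 h$-invariant cochains vanishing if any argument is in $\mathfrak h$, and $H^\bullet(\mathfrak g,\mathfrak h;V)$ is its cohomology; $\mathfrak g^*=\mathrm{Hom}_K(\mathfrak g,K)$ is the coadjoint module. $\tau_{2n}:\mathcal A^{\otimes(2n+1)}\to K$ is the Hochschild cocycle $\tau_{2n}(a)=\mu_{2n}\int_{\Delta_{2n}}\prod_{0\le i<j\le2n}e^{\epsilon(2u_i-2u_j+1)\alpha_{ij}}\pi_{2n}(a)\,du_1\cdots du_{2n}$ with $u_0=0$, $\Delta_{2n}=\{0\le u_1\le\cdots\le u_{2n}\le1\}$; $\alpha_{ij}=\frac12\sum_r(\partial^{(i)}_{p_r}\partial^{(j)}_{q_r}-\partial^{(i)}_{q_r}\partial^{(j)}_{p_r})$ acts on tensor factors $i,j$ (numbered $0,\dots,2n$); $\pi_{2n}(a_0\otimes\cdots\otimes a_{2n})=\sum_{\sigma\in S_{2n}}\mathrm{sign}(\sigma)a_0\otimes\partial_{y_{\sigma(1)}}a_1\otimes\cdots\otimes\partial_{y_{\sigma(2n)}}a_{2n}$; $\mu_{2n}(a_0\otimes\cdots\otimes a_{2n})=\prod_ia_i|_{y=0}$; exponentials are expanded in Taylor series and integrated term by term. *)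

(* Defs.v *)
From HB Require Import structures.
From mathcomp Require Import all_boot all_order all_fingroup all_algebra fraction complex.
(* Imported after mathcomp-analysis, mpoly fails with a clash of notation
   levels. *)
From mathcomp Require Import mpoly.
From mathcomp Require Import all_classical all_reals all_analysis.

Set Implicit Arguments.
Unset Strict Implicit.
Unset Printing Implicit Defensive.

Import GRing.Theory.

Local Open Scope classical_set_scope.
Local Open Scope ring_scope.

(* C[eps, eps^-1], as the subring of the p / eps^k in the field of fractions
   of C[eps]; eps is the variable 'X. *)
Section Laurent.
Variable C : fieldType.

Definition is_laurent : {pred {fraction {poly C}}} := fun x =>
  `[< exists (p : {poly C}) (k : nat), x = tofrac p / tofrac 'X ^+ k >].

Lemma is_laurentP x : reflect
  (exists (p : {poly C}) (k : nat), x = tofrac p / tofrac 'X ^+ k)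
  (x \in is_laurent).
Proof. exact: asboolP. Qed.

Lemma is_laurent_subring : subring_closed is_laurent.
Proof.
have X0 k : tofrac 'X ^+ k != 0 :> {fraction {poly C}}.
  by rewrite expf_neq0 // tofrac_eq0 polyX_eq0.
split.
- by apply/is_laurentP; exists 1, 0%N; rewrite expr0 divr1 tofrac1.
- move=> _ _ /is_laurentP[p [k ->]] /is_laurentP[q [l ->]]; apply/is_laurentP.
  exists (p * 'X ^+ l - q * 'X ^+ k), (k + l)%N.
  by rewrite tofracB !tofracM !tofracXn -mulNr addf_div // mulNr exprD.
- move=> _ _ /is_laurentP[p [k ->]] /is_laurentP[q [l ->]]; apply/is_laurentP.
  by exists (p * q), (k + l)%N; rewrite tofracM exprD mulf_div.
Qed.

HB.instance Definition _ :=
  GRing.isSubringClosed.Build _ is_laurent is_laurent_subring.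

Record laurent := Laurent {
  laurent_val : {fraction {poly C}};
  laurent_valP : laurent_val \in is_laurent }.

HB.instance Definition _ := [isSub of laurent for laurent_val].
HB.instance Definition _ := [Choice of laurent by <:].
HB.instance Definition _ := [SubChoice_isSubComNzRing of laurent by <:].

Lemma laurentC_subproof (c : C) : tofrac c%:P \in is_laurent.
Proof. by apply/is_laurentP; exists c%:P, 0%N; rewrite expr0 divr1. Qed.

Definition laurentC (c : C) : laurent := Laurent (laurentC_subproof c).

Lemma eps_subproof : tofrac 'X \in is_laurent.
Proof. by apply/is_laurentP; exists 'X, 0%N; rewrite expr0 divr1. Qed.

Definition eps : laurent := Laurent eps_subproof.

Lemma epsV_subproof : (tofrac 'X)^-1 \in is_laurent.
Proof. by apply/is_laurentP; exists 1, 1%N; rewrite tofrac1 mul1r. Qed.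

Definition epsV : laurent := Laurent epsV_subproof.

Lemma mul_eps_epsV : eps * epsV = 1.
Proof. by apply: val_inj => /=; rewrite divff // tofrac_eq0 polyX_eq0. Qed.

End Laurent.

Definition fcons (T : Type) k (v : T) (x : 'I_k -> T) : 'I_k.+1 -> T :=
  fun i => if unlift ord0 i is Some j then x j else v.

Definition upd (T : Type) k (x : 'I_k -> T) (i : 'I_k) (v : T) : 'I_k -> T :=
  fun j => if j == i then v else x j.

(* An element of C^k(g; g^* ) = Hom_K(wedge^k g, Hom_K(g, K)) is represented by
   a function c with c x y = c(x_0, ..., x_(k-1))(y). *)

Section ChevalleyEilenberg.
Variables (K : comNzRingType) (g : lmodType K) (br : g -> g -> g).
Implicit Types (h : set g).

Definition coad (z : g) (phi : g -> K) : g -> K := fun y => - phi (br z y).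

Definition is_cochain k (c : ('I_k -> g) -> g -> K) : Prop :=
  [/\ forall x (a : K) y z, c x (a *: y + z) = a * c x y + c x z,
      forall x (i : 'I_k) (a : K) u v y,
        c (upd x i (a *: u + v)) y = a * c (upd x i u) y + c (upd x i v) y
    & forall x (i j : 'I_k) y, i != j -> x i = x j -> c x y = 0].

(* Indices start from 0. In the double sum the pair i < j' of arguments that
   are removed is (i, lift i j), where lift i j = j + 1 since i <= j; whence
   the sign (-1)^(i + j') = (-1)^(i + j + 1). *)
Definition CEd k : (('I_k -> g) -> g -> K) -> ('I_k.+1 -> g) -> g -> K :=
  match k with
  | 0 => fun c x => coad (x ord0) (c (x \o lift ord0))
  | k'.+1 => fun c x y =>
      \sum_(i < k'.+2) (-1) ^+ i * coad (x i) (c (x \o lift i)) y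
      + \sum_(i < k'.+2) \sum_(j < k'.+1 | (i <= j)%N)
          (-1) ^+ (i + j.+1) *
          c (fcons (br (x i) (x (lift i j))) (x \o lift i \o lift j)) y
  end.

Definition rel_cochain h k (c : ('I_k -> g) -> g -> K) : Prop :=
  [/\ is_cochain c,
      forall x (i : 'I_k) y, h (x i) -> c x y = 0
    & forall z x y, h z ->
        coad z (c x) y = \sum_(i < k) c (upd x i (br z (x i))) y].

Definition rel_cocycle h k (c : ('I_k -> g) -> g -> K) : Prop :=
  rel_cochain h c /\ forall x y, CEd c x y = 0.

Definition rel_coboundary h k : (('I_k -> g) -> g -> K) -> Prop :=
  match k with
  | 0 => fun c => forall x y, c x y = 0
  | k'.+1 => fun c => exists b : ('I_k' -> g) -> g -> K,
      rel_cochain h b /\ forall x y, c x y = CEd b x y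
  end.

(* The class of a relative cocycle in H^k(g, h; g^* ), the quotient of
   relative cocycles by relative coboundaries, is not zero. *)
Definition nontrivial_class h k (c : ('I_k -> g) -> g -> K) : Prop :=
  rel_cocycle h c /\ ~ rel_coboundary h c.

End ChevalleyEilenberg.

Definition Kspan (K : comNzRingType) (V : lmodType K) (S : set V) : set V :=
  [set v | exists m (a : 'I_m -> K) (s : 'I_m -> V),
     (forall i, S (s i)) /\ v = \sum_(i < m) a i *: s i].

Section Weyl.
Variables (R : realType) (n : nat).

Definition K : comNzRingType := laurent R[i].

(* The variable 'X_s is y_(s+1): p_(r+1) = 'X_(2r) and q_(r+1) = 'X_(2r+1). *)
Definition weyl : comNzRingType := {mpoly K[n.*2]}.

Lemma pvar_subproof (r : 'I_n) : (r.*2 < n.*2)%N.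
Proof. by rewrite ltn_double. Qed.
Lemma qvar_subproof (r : 'I_n) : (r.*2.+1 < n.*2)%N.
Proof. by rewrite ltn_Sdouble. Qed.

Definition pvar (r : 'I_n) : 'I_n.*2 := Ordinal (pvar_subproof r).
Definition qvar (r : 'I_n) : 'I_n.*2 := Ordinal (qvar_subproof r).

(* The k-fold tensor power of the space weyl over K, as the polynomials in k
   disjoint sets of variables: y_(s+1) in the tensor factor i is
   'X_(mxvec_index i s). *)
Definition wtensor k : comNzRingType := {mpoly K[k * n.*2]}.

Definition tensor k (a : 'I_k -> weyl) : wtensor k :=
  \prod_(i < k) (a i \mPo [tuple 'X_(mxvec_index i s) | s < n.*2]).

Definition tderiv k (i : 'I_k) (s : 'I_n.*2) (F : wtensor k) : wtensor k :=
  F^`M(mxvec_index i s).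

Definition alpha k (i j : 'I_k) (F : wtensor k) : wtensor k :=
  laurentC 2%:R^-1 *: \sum_(r < n)
    (tderiv i (pvar r) (tderiv j (qvar r) F)
     - tderiv i (qvar r) (tderiv j (pvar r) F)).

(* alpha lowers the total degree by 2, so that the terms with
   m >= msize F = deg F + 1 of the exponential series vanish. *)
Definition exp_alpha k (c : K) (i j : 'I_k) (F : wtensor k) : wtensor k :=
  \sum_(m < msize F) (laurentC m`!%:R^-1 * c ^+ m) *: iter m (alpha i j) F.

(* Multiplication: y_(s+1) in every tensor factor is replaced by y_(s+1). *)
Definition tmul k (F : wtensor k) : weyl :=
  F \mPo [tuple mxvec (\matrix_(i < k, s < n.*2) 'X_s) 0 t | t < k * n.*2].

Definition moyal (f g : weyl) : weyl :=
  tmul (exp_alpha (eps _) ord0 ord_max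
          (tensor (fun i : 'I_2 => if i == ord0 then f else g))).

Definition mu k (F : wtensor k) : K := F.@[fun _ => 0].

Definition pi_tau (a : 'I_n.*2.+1 -> weyl) : wtensor n.*2.+1 :=
  \sum_(sg : 'S_n.*2) (-1) ^+ sg *:
    tensor (fcons (a ord0) (fun i => (a (lift ord0 i))^`M(sg i))).

(* The integral of f [:: u_1; ...; u_k] over 0 <= u_1 <= ... <= u_k <= t. *)
Fixpoint simplex_integral k (f : seq R -> R) (t : R) : R :=
  if k is k'.+1 then
    \int[lebesgue_measure]_(u in `[0, t])
      simplex_integral k' (fun s => f (rcons s u)) u
  else f [::].

Definition opair k : finType := {e : 'I_k * 'I_k | (e.1 < e.2)%N}.

(* The integral of the coefficient of
   eps ^ (sum_e m e) prod_(e = (i, j)) alpha_ij ^ (m e)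
   in the expansion of prod_(i < j) exp(eps (2 u_i - 2 u_j + 1) alpha_ij). *)
Definition tau_coef (m : opair n.*2.+1 -> nat) : R :=
  simplex_integral n.*2
    (fun s => let u := nth 0 (0 :: s) in
       \prod_(e : opair n.*2.+1)
          ((2 * u (val e).1 - 2 * u (val e).2 + 1) ^+ m e / (m e)`!%:R)) 1.

(* As in exp_alpha, the terms with m e >= msize F for some e vanish. *)
Definition tau (a : 'I_n.*2.+1 -> weyl) : K :=
  let F := pi_tau a in
  \sum_(m : {ffun opair n.*2.+1 -> 'I_(msize F)})
    laurentC (tau_coef (fun e => m e))%:C%C * eps _ ^+ (\sum_e m e)%N *
    mu ((\big[comp/id]_(e : opair n.*2.+1)
           iter (m e) (alpha (val e).1 (val e).2)) F).

(* M_N(C) tensor weyl, identified with the N x N matrices over weyl. *)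
Definition gl (N : nat) : Type := 'M[weyl]_N.

Section GL.
Variable N : nat.

HB.instance Definition _ := GRing.Zmodule.on (gl N).

Definition gl_scale (a : K) (x : gl N) : gl N := \matrix_(i, j) (a *: x i j).

Lemma gl_scaleA a b x : gl_scale a (gl_scale b x) = gl_scale (a * b) x.
Proof. by apply/matrixP => i j; rewrite !mxE scalerA. Qed.
Lemma gl_scale1 : left_id 1 gl_scale.
Proof. by move=> x; apply/matrixP => i j; rewrite !mxE scale1r. Qed.
Lemma gl_scaleDr : right_distributive gl_scale +%R.
Proof. by move=> a x y; apply/matrixP => i j; rewrite !mxE scalerDr. Qed.
Lemma gl_scaleDl x : {morph gl_scale^~ x : a b / a + b}.
Proof. by move=> a b; apply/matrixP => i j; rewrite !mxE scalerDl. Qed.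

HB.instance Definition _ := GRing.Zmodule_isLmodule.Build K (gl N)
  gl_scaleA gl_scale1 gl_scaleDr gl_scaleDl.

Definition pure (M : 'M[R[i]]_N) (a : weyl) : gl N :=
  \matrix_(i, j) (laurentC (M i j) *: a).

Definition gl_mul (x y : gl N) : gl N :=
  \matrix_(i, j) \sum_(k < N) moyal (x i k) (y k j).

Definition gl_br (x y : gl N) : gl N := epsV _ *: (gl_mul x y - gl_mul y x).

Definition gl_const : set (gl N) :=
  Kspan [set x | exists M : 'M[R[i]]_N, x = pure M 1].

Definition sp : set (gl N) :=
  Kspan [set x | exists2 a : weyl, a \is 2.-homog & x = pure 1%:M a].

Definition gl_sp : set (gl N) :=
  [set x | exists y z, [/\ gl_const y, sp z & x = y + z]].

Definition Theta_pure (M : 'I_n.*2 -> 'M[R[i]]_N) (a : 'I_n.*2 -> weyl)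
    (M0 : 'M[R[i]]_N) (a0 : weyl) : K :=
  \sum_(sg : 'S_n.*2) (-1) ^+ sg * tau (fcons a0 (a \o sg)) *
    laurentC (\tr (M0 *m \prod_(i < n.*2) M (sg i))).

(* The multilinear extension of Theta_pure, obtained by writing x as the sum
   of the pure (delta_mx i j) (x i j). *)
Definition Theta (x : 'I_n.*2 -> gl N) (x0 : gl N) : K :=
  \sum_(e : {ffun 'I_n.*2 -> 'I_N * 'I_N}) \sum_(e0 : 'I_N * 'I_N)
    Theta_pure (fun k => delta_mx (e k).1 (e k).2)
               (fun k => x k (e k).1 (e k).2)
               (delta_mx e0.1 e0.2) (x0 e0.1 e0.2).

End GL.

(* i_(N'N): the matrix x in the first N rows and columns, and zeros. *)
Definition gl_incl (N' N : nat) (x : gl N) : gl N' :=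
  \matrix_(i, j)
    if (insub (val i), insub (val j)) is (Some i', Some j') then x i' j' else 0.

End Weyl.

(* Main.v *)
(* The cocycle tau is turned into a symbol calculus: tau(a) is the value at 0 of
   a constant coefficient differential operator, with symbol
     sum_e eps^e det(xi_1, ..., xi_2n) I(Q^e / e!),
   applied to the tensor a_0 (x) ... (x) a_2n.  Here xi_i stands for the
   derivatives of the factor i, Q is the quadratic form
   sum_(i<j) alpha_ij(xi) (2 u_i - 2 u_j + 1), which is affine in u, and I is the
   integral over the simplex, a purely algebraic functional on polynomials in u.
   - Hochschild cocycle: on the face u_j = u_(j+1) of the simplex, Q becomes the
     form for a_j a_(j+1) plus alpha_(j,j+1), i.e. the exponent of the Moyal
     product of a_j and a_(j+1).  Stokes' theorem reduces the claim to
     sum_i (-1)^i det(.., xi_i omitted, ..) dQ/du_i = 0, a relation among minors.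
   - Vanishing on sp: inserting a quadratic a with symbol eta changes Q by a term
     linear in eta, and the alternating sum over the positions of the insertion of
     the part of degree 2 in eta is the integral of a derivative in u, with
     boundary terms that telescope to 0.
   Antisymmetrization, tensored with the trace, gives the Lie algebra cocycle; it
   vanishes on gl_N + sp_2n, and Cartan's formula then gives the invariance.
   If b is any relative cochain, d b (y_1, ..., y_2n)(1) = 0, because [y_i, 1] = 0
   and [y_i, y_j] is in gl_N, whereas Theta(y_1, ..., y_2n)(1) = N. *)
Require Import Defs.
From HB Require Import structures.
From mathcomp Require Import all_boot all_order all_fingroup all_algebra fraction complex.
From mathcomp Require Import ssrcomplements mpoly.
From mathcomp Require Import all_classical all_reals all_analysis.
From mathcomp Require Import ring zify.
Import Order.TTheory GRing.Theory Num.Theory numFieldNormedType.Exports.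
Local Open Scope ring_scope.

Set Implicit Arguments.
Unset Strict Implicit.
Unset Printing Implicit Defensive.

(** * Polynomial integration over the simplex *)

(** The definitions of [tau] and [moyal] cut their exponentials at the degree of the argument, so
    values at different arguments are not sums over a common range. The general part therefore
    assumes of [tau] and of the product only that they equal their series cut at any bound past some
    [bnd]; comparing cuts rests on the fact that a symbol of high order annihilates a polynomial of
    smaller degree. Symbols commute, so identities between operators are proved for arbitrary
    elements of a commutative ring S, with a field F mapping to S to provide inverses of integers,
    and are then specialised to polynomials in the xi_i. The link with tensors is a duality:
    multiplying tensor factors adds their symbols. These identities concern an antisymmetric matrix
    J whose size d is the number of arguments besides a_0; the standard symplectic form and d = 2n
    enter at the end. Matrices are handled by multiadditivity, which reduces every claim to pure
    tensors, where the trace is a common factor. *)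

Section LinearExtension.
Variables (S : comNzRingType) (n : nat) (V : lmodType S) (w : 'X_{1..n} -> V).

(** Serves twice: for the simplex integral, known on monomials, and for the action of a symbol on a
    polynomial, where [w m] is the derivative of multi-index m. *)
Definition mlin (p : {mpoly S[n]}) : V := \sum_(m <- msupp p) p@_m *: w m.

Lemma mlinwE k p : (msize p <= k)%N ->
  mlin p = \sum_(m : 'X_{1..n < k}) p@_m *: w m.
Proof.
move=> le_pk; rewrite /mlin (big_mksub 'X_{1..n < k}) ?msupp_uniq //=; last first.
  by move=> x /msize_mdeg_lt /leq_trans; apply.
by rewrite big_rmcond //= => j /memN_msupp_eq0 ->; rewrite scale0r.
Qed.

Lemma mlin_is_linear : linear mlin.
Proof.
move=> c p q.
pose k := maxn (msize (c *: p + q)) (maxn (msize p) (msize q)).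
rewrite !(@mlinwE k) ?leq_max ?leqnn ?orbT // scaler_sumr -big_split /=.
by apply: eq_bigr => m _; rewrite mcoeffD mcoeffZ scalerDl scalerA.
Qed.

HB.instance Definition _ := GRing.isLinear.Build S {mpoly S[n]} V _ mlin mlin_is_linear.

Lemma mlinX m : mlin 'X_[m] = w m.
Proof. by rewrite /mlin msuppX big_seq1 mcoeffX eqxx scale1r. Qed.

Lemma linear_mpoly_eq (f g : {linear {mpoly S[n]} -> V}) :
  (forall m, f 'X_[m] = g 'X_[m]) -> f =1 g.
Proof.
move=> fg p; rewrite [p]mpolyE !linear_sum; apply: eq_bigr => m _.
by rewrite !linearZ /= fg.
Qed.

End LinearExtension.

(** Substitutions and derivations are controlled by multiplication with a single variable; hence the
    step ['X_i * p] instead of whole monomials. *)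
Lemma mpolyind_var (S : comNzRingType) n (P : {mpoly S[n]} -> Prop) :
    P 1 -> (forall i p, P p -> P ('X_i * p)) ->
    (forall c p q, P p -> P q -> P (c *: p + q)) ->
  forall p, P p.
Proof.
move=> P1 PX PD.
have P0 : P 0 by rewrite -(subrr 1) -scaleN1r addrC; apply: PD.
have PXm m : P 'X_[m].
  elim: {m}(mdeg m) {-2}m (erefl (mdeg m)) => [|k IH] m Em.
    by move/eqP: Em; rewrite mdeg_eq0 => /eqP ->; rewrite mpolyX0.
  have [i mi] : exists i, m i != 0%N.
    apply/existsP; rewrite -negb_forall; apply/negP => /forallP m0.
    move: Em; rewrite mdegE big1 // => i _; exact/eqP/m0.
  have le_m : (U_(i) <= m)%MM by rewrite lep1mP.
  rewrite -(submK le_m) addmC mpolyXD; apply/PX/IH.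
  by move: Em; rewrite -{1}(submK le_m) mdegD mdeg1 addn1 => -[].
move=> p; rewrite [p]mpolyE; elim: (msupp p) => [|m s IH].
  by rewrite big_nil.
by rewrite big_cons; apply: PD.
Qed.

Section PartialSums.
Variable k : nat.
Implicit Types (m : 'X_{1..k}).

Definition psum m (s : nat) : nat := \sum_(i < k | (i <= s)%N) m i.

Lemma psum0 s : psum 0%MM s = 0%N.
Proof. by rewrite /psum big1 // => i _; rewrite mnm0E. Qed.

Lemma psumD m1 m2 s : psum (m1 + m2)%MM s = (psum m1 s + psum m2 s)%N.
Proof. by rewrite /psum -big_split /=; apply: eq_bigr => i _; rewrite mnmDE. Qed.

Lemma psum_sum (I : Type) (r : seq I) (F : I -> 'X_{1..k}) s :
  psum (\sum_(i <- r) F i)%MM s = (\sum_(i <- r) psum (F i) s)%N.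
Proof.
by apply: (big_morph (psum^~ s)) => [m1 m2|]; [exact: psumD|exact: psum0].
Qed.

Lemma psumUn (i : 'I_k) c s : psum (U_(i) *+ c)%MM s = ((i <= s) * c)%N.
Proof.
have E (j : 'I_k) : (U_(i) *+ c)%MM j = ((j == i) * c)%N.
  by rewrite mulmnE mnm1E eq_sym.
rewrite /psum; case: (leqP i s) => [les|gts].
  rewrite (bigD1 i) //= E eqxx big1 ?addn0 // => j /andP[_ /negbTE ji].
  by rewrite E ji.
rewrite big1 // => j js; rewrite E; case: eqP => // ji.
by move: js; rewrite ji leqNgt gts.
Qed.

Lemma psumS m (i : 'I_k) : psum m i = ((if val i is j.+1 then psum m j else 0) + m i)%N.
Proof.
rewrite {1}/psum (bigD1 i) //= addnC; congr addn.
case: i => -[|i] lti /=; first by rewrite big1 // => j; rewrite -val_eqE /=; lia.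
by rewrite /psum; apply: eq_bigl => j; rewrite -val_eqE /=; lia.
Qed.

End PartialSums.

Section SimplexFunctional.
Variables (F : numFieldType) (S : comNzRingType) (rho : {rmorphism F -> S}).

(** In the iterated integral, once the variables of index at most s are integrated, the exponent is
    [psum m s + s.+1], and the last of these integrations has divided by it. *)
Definition simplex_weight k (m : 'X_{1..k}) : F :=
  \prod_(s < k) ((psum m s + s.+1)%:R)^-1.

(* The integral over 0 <= u_1 <= ... <= u_k <= 1, on monomials. *)
Definition simplexI k : {mpoly S[k]} -> S^o :=
  mlin (fun m => rho (simplex_weight m) : S^o).

HB.instance Definition _ k :=
  GRing.isLinear.Build S {mpoly S[k]} S^o _ (@simplexI k) (@mlin_is_linear _ _ _ _).

Lemma simplexIX k (m : 'X_{1..k}) : simplexI 'X_[m] = rho (simplex_weight m).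
Proof. exact: mlinX. Qed.

(* The cuts 0 = u_0 <= u_1 <= ... <= u_k <= u_(k+1) = 1. *)
Definition vertex k (j : nat) : {mpoly S[k]} :=
  if j is i.+1 then if insub i is Some i' then 'X_i' else 1 else 0.

(* Substitution u_j = u_(j+1), with the conventions u_0 = 0, u_(k+2) = 1. *)
Definition face k j : (k.+1).-tuple {mpoly S[k]} :=
  [tuple vertex k (unbump j i.+1) | i < k.+1].

(** Exponents after ['X_h] and the next variable have been identified. For h = k, ['X_k] becomes 1
    and its exponent is dropped. *)
Definition merge_mnm k h (m : 'X_{1..k.+1}) : 'X_{1..k} :=
  (\sum_(i < k.+1) if insub (unbump h i) is Some t then U_(t) *+ m i else 0)%MM.

(** Adding two adjacent exponents deletes the partial sum of index h from the list and keeps the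
    others. *)
Lemma psum_merge k h (m : 'X_{1..k.+1}) (s : 'I_k) :
  psum (merge_mnm h m) s = if (s < h)%N then psum m s else psum m s.+1.
Proof.
rewrite psum_sum.
transitivity (\sum_(i < k.+1) (unbump h i <= s) * m i)%N.
  apply: eq_bigr => i _; case: insubP => [t _ /= <-|ge].
    by rewrite psumUn.
  by rewrite psum0 leqNgt (leq_trans (ltn_ord s)) // leqNgt.
rewrite -fun_if /psum [RHS]big_mkcond /=; apply: eq_bigr => i _.
rewrite (_ : (unbump h i <= s)%N = (i <= (if (s < h)%N then s : nat else s.+1))%N).
  by case: (i <= _)%N; rewrite ?mul1n.
by rewrite /unbump; case: ifP => /=; lia.
Qed.

Lemma vertexS k i : vertex k i.+1 =
  if insub i is Some i' then 'X_(i' : 'I_k) else 1.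
Proof. by []. Qed.

Lemma faceS_X k h (m : 'X_{1..k.+1}) : 'X_[m] \mPo face k h.+1 = 'X_[merge_mnm h m].
Proof.
rewrite /face comp_mpolyX -mprodXE; apply: eq_bigr => i _.
rewrite tnth_mktuple; have -> : unbump h.+1 i.+1 = (unbump h i).+1.
  by rewrite /unbump; lia.
by rewrite vertexS; case: insubP => [t _ _|_]; rewrite ?mpolyXn ?mpolyX0 ?expr1n.
Qed.

Lemma face0_X k (m : 'X_{1..k.+1}) :
  'X_[m] \mPo face k 0 = (m ord0 == 0%N)%:R *: 'X_[merge_mnm 0 m].
Proof.
rewrite /face comp_mpolyX -mprodXE !big_ord_recl tnth_mktuple.
have -> : vertex k (unbump 0 (ord0 : 'I_k.+1).+1) = 0 by [].
rewrite expr0n; case: eqP => [m0|_]; last by rewrite scale0r mul0r.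
rewrite scale1r m0; congr (_ * _).
  by case: insubP => *; rewrite ?mulm0n mpolyX0.
apply: eq_bigr => i _; rewrite tnth_mktuple.
have -> : unbump 0 (lift ord0 i).+1 = i.+1 by rewrite /unbump /= /bump; lia.
have -> : unbump 0 (lift ord0 i) = i by rewrite /unbump /= /bump; lia.
by rewrite vertexS; case: insubP => [t _ _|_]; rewrite ?mpolyXn ?mpolyX0 ?expr1n.
Qed.

Lemma simplex_weight_merge k (i : 'I_k.+1) (m : 'X_{1..k.+1}) :
  simplex_weight (merge_mnm i m) =
  (\prod_(0 <= s < i) (psum m s + s.+1)%:R^-1) *
  \prod_(i.+1 <= s < k.+1) (psum m s + s)%:R^-1.
Proof.
rewrite /simplex_weight.
have le_ik : (i <= k)%N by rewrite -ltnS.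
rewrite -(big_mkord xpredT (fun s => (psum (merge_mnm i m) s + s.+1)%:R^-1)) /=.
rewrite (big_cat_nat (n := i)) //= big_add1 /=; congr (_ * _).
  rewrite !big_nat; apply: eq_bigr => s /andP[_ si].
  have lt_sk : (s < k)%N by apply: leq_trans le_ik.
  by rewrite (psum_merge _ _ (Ordinal lt_sk)) si.
rewrite !big_nat; apply: eq_bigr => s /andP[si lt_sk].
by rewrite (psum_merge _ _ (Ordinal lt_sk)) ltnNge si.
Qed.

Lemma psum_subU k (i : 'I_k) (m : 'X_{1..k}) s : (0 < m i)%N ->
  (psum (m - U_(i))%MM s + (i <= s))%N = psum m s.
Proof.
move=> mi; have le_m : (U_(i) <= m)%MM by rewrite lep1mP -lt0n.
by rewrite -{2}(submK le_m) psumD -{3}[U_(i)%MM]mulm1n psumUn muln1.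
Qed.

Lemma simplex_weight_deriv k (i : 'I_k.+1) (m : 'X_{1..k.+1}) : (0 < m i)%N ->
  simplex_weight (m - U_(i))%MM =
  (\prod_(0 <= s < i) (psum m s + s.+1)%:R^-1) *
  ((psum m i + i)%:R^-1 * \prod_(i.+1 <= s < k.+1) (psum m s + s)%:R^-1).
Proof.
move=> mi; rewrite /simplex_weight.
have le_ik : (i <= k)%N by rewrite -ltnS.
rewrite -(big_mkord xpredT (fun s => (psum (m - U_(i))%MM s + s.+1)%:R^-1)) /=.
have le_ik1 : (i <= k.+1)%N by exact: ltnW.
rewrite (big_cat_nat (n := i)) //=; congr (_ * _).
  rewrite !big_nat; apply: eq_bigr => s /andP[_ si].
  by rewrite -(psum_subU s mi) leqNgt si addn0.
rewrite (big_nat_recl _ _ _ le_ik) big_add1 /=; congr (_ * _).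
  by rewrite -(psum_subU i mi) leqnn addn1 addSnnS.
rewrite !big_nat; apply: eq_bigr => s /andP[si lt_sk].
by rewrite -(psum_subU _ mi) (leq_trans si) // addn1 addSnnS.
Qed.

Lemma scale_rho_nat n (x : F) : n%:R *: (rho x : S^o) = rho (n%:R * x) :> S.
Proof. by rewrite rmorphM rmorph_nat. Qed.

(** Fundamental theorem of calculus for ['X_i], that is u_(i+1), whose range begins at u_i (face i)
    and ends at u_(i+2) (face i+1). By linearity it is a statement about the weights of
    monomials. *)
Lemma simplex_stokes k (i : 'I_k.+1) (p : {mpoly S[k.+1]}) :
  simplexI p^`M(i) = simplexI (p \mPo face k i.+1) - simplexI (p \mPo face k i).
Proof.
pose f : {mpoly S[k.+1]} -> S^o := fun p => simplexI p^`M(i).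
pose g : {mpoly S[k.+1]} -> S^o := fun p => simplexI (p \mPo face k i.+1) - simplexI (p \mPo face k i).
have fl : linear f by move=> a q r; rewrite /f !linearP.
have gl : linear g.
  by move=> a q r; rewrite /g !linearP /= scalerBr scalerN addrACA.
pose f' : {linear {mpoly S[k.+1]} -> S^o} :=
  HB.pack f (GRing.isLinear.Build _ _ _ _ f fl).
pose g' : {linear {mpoly S[k.+1]} -> S^o} :=
  HB.pack g (GRing.isLinear.Build _ _ _ _ g gl).
apply: (linear_mpoly_eq (f := f') (g := g')) => m; rewrite /f' /g' /= /f /g {f g fl gl f' g'}.
rewrite mderivX linearZ /= faceS_X !simplexIX simplex_weight_merge.
set P := \prod_(0 <= s < i) _; set Q := \prod_(i.+1 <= s < k.+1) _.
have -> : (m i)%:R *: (rho (simplex_weight (m - U_(i))%MM) : S^o) =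
    rho ((m i)%:R * (P * ((psum m i + i)%:R^-1 * Q))).
  have [m0|m0] := posnP (m i); first by rewrite m0 !mul0r scale0r rmorph0.
  by rewrite simplex_weight_deriv // scale_rho_nat.
rewrite {}/P {}/Q; case: i => -[|j] ltj /=;
  set P := \prod_(0 <= s < _) _; set Q := \prod_(_ <= s < k.+1) _.
  (* The range of u_1 begins at 0, so the lower face keeps only the monomials free of this variable.
     For these the derivative is 0 and the two faces agree; for the others only the upper face
     contributes. *)
  have E0 : Ordinal ltj = ord0 by exact: val_inj.
  rewrite E0 face0_X linearZ /= simplexIX scale_rho_nat.
  rewrite (simplex_weight_merge ord0) /= -/Q -/P.
  rewrite -rmorphB addn0.
  rewrite (psumS m ord0) /= add0n.
  congr (rho _); have [->|m0] := eqVneq (m ord0) 0%N; first by rewrite mul0r /= mul1r subrr.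
  have mF0 : (m ord0)%:R != 0 :> F by rewrite pnatr_eq0.
  by rewrite /= mul0r subr0 mulrCA mulVKf.
have ltj' : (j < k.+1)%N by exact: ltnW.
rewrite faceS_X simplexIX (simplex_weight_merge (Ordinal ltj')) /=.
rewrite -rmorphB; congr (rho _).
(* With a = psum m j + j + 1 and b the exponent of the variable, the claim is 1/a - 1/(a + b) = b /
   (a (a + b)). *)
rewrite /P big_nat_recr //= (big_ltn ltj) /= -/Q (psumS m (Ordinal ltj)) /=.
have -> : (psum m j + m (Ordinal ltj) + j.+1)%N = (psum m j + j.+1 + m (Ordinal ltj))%N.
  by rewrite addnAC.
have a0 : (psum m j + j.+1)%:R != 0 :> F by rewrite pnatr_eq0 addnS.
have ab0 : (psum m j + j.+1 + m (Ordinal ltj))%:R != 0 :> F.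
  by rewrite pnatr_eq0 addnS addSn.
rewrite natrD in ab0 *; move: ((psum m j + j.+1)%:R : F) ((m (Ordinal ltj))%:R : F) a0 ab0.
move: (\prod_(0 <= i < j) _) Q => /= A B a b a0 ab0.
by field; rewrite a0 ab0.
Qed.

End SimplexFunctional.

(** * The phase and the Hochschild identity for symbols *)

Section Phase.
Variables (S : comNzRingType) (d : nat) (J : 'M[S]_d).
Hypothesis Jdiag : forall s, J s s = 0.
Hypothesis Jskew : forall s t, J t s = - J s t.
Implicit Types (v w : 'I_d -> S).

Definition bil v w : S := \sum_s \sum_t J s t * (v s * w t).

Lemma bilC v w : bil w v = - bil v w.
Proof.
rewrite /bil exchange_big /= -sumrN; apply: eq_bigr => s _.
by rewrite -sumrN; apply: eq_bigr => t _; rewrite Jskew mulNr [w t * _]mulrC.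
Qed.

Lemma bil_sumr (I : Type) (r : seq I) (P : pred I) v (w : I -> 'I_d -> S) :
  bil v (fun t => \sum_(i <- r | P i) w i t) = \sum_(i <- r | P i) bil v (w i).
Proof.
rewrite /bil [RHS]exchange_big; apply: eq_bigr => s _.
rewrite [RHS]exchange_big; apply: eq_bigr => t _.
by rewrite !mulr_sumr.
Qed.

Lemma bil_suml (I : Type) (r : seq I) (P : pred I) (v : I -> 'I_d -> S) w :
  bil (fun t => \sum_(i <- r | P i) v i t) w = \sum_(i <- r | P i) bil (v i) w.
Proof. by rewrite bilC bil_sumr -sumrN; apply: eq_bigr => i _; rewrite -bilC. Qed.

(** [bilC] only gives 2 * bil v v = 0, and 2 may be a zero divisor in S: the diagonal terms vanish
    by [Jdiag] and the others cancel in pairs. *)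
Lemma bilvv v : bil v v = 0.
Proof.
rewrite /bil.
have split_sum (f : 'I_d -> 'I_d -> S) : (forall s, f s s = 0) ->
   \sum_s \sum_t f s t = \sum_(s < d) \sum_(t < d | (s < t)%N) (f s t + f t s).
  move=> f0; transitivity (\sum_(s < d) (\sum_(t < d | (s < t)%N) f s t + \sum_(t < d | (t < s)%N) f s t)).
    apply: eq_bigr => s _; rewrite (bigID (fun t : 'I_d => (s < t)%N)) /=; congr (_ + _).
    rewrite (bigD1 s) ?ltnn //= f0 add0r; apply: eq_bigl => t.
    by rewrite -leqNgt ltn_neqAle andbC.
  rewrite big_split /= [X in _ + X](exchange_big_dep xpredT) //= -big_split /=.
  by apply: eq_bigr => s _; rewrite big_split.
rewrite split_sum => [|s]; last by rewrite Jdiag mul0r.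
rewrite big1 // => s _; rewrite big1 // => t _.
by rewrite (Jskew s t); ring.
Qed.

Definition quad k (xi : 'I_k -> 'I_d -> S) : S :=
  \sum_(a < k) \sum_(b < k | (a < b)%N) bil (xi a) (xi b).

Definition vtotal k (xi : 'I_k -> 'I_d -> S) : 'I_d -> S := fun s => \sum_a xi a s.

(* The quadratic form Q in the form used for derivatives in u; see phaseE. *)
Definition phase k (xi : 'I_k.+1 -> 'I_d -> S) : {mpoly S[k]} :=
  (quad xi)%:MP + \sum_(a < k.+1) (2 * bil (xi a) (vtotal xi)) *: vertex S k a.

(** Antisymmetry collects all terms in u_a into the one coefficient 2 * bil (xi a) (vtotal xi). In
    this form each u_a sees the other symbols only through their total, which does not change when
    factors are multiplied. *)
Lemma phaseE k (xi : 'I_k.+1 -> 'I_d -> S) :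
  phase xi = \sum_(a < k.+1) \sum_(b < k.+1 | (a < b)%N)
    bil (xi a) (xi b) *: (2 * vertex S k a - 2 * vertex S k b + 1).
Proof.
have E2 (a : S) (p : {mpoly S[k]}) : (2 * a) *: p = a *: (2 * p).
  by rewrite !mulr_natl -scalerMnl scalerMnr.
rewrite /phase /quad raddf_sum /=.
transitivity (\sum_(a < k.+1) (\sum_(b < k.+1 | (a < b)%N) (bil (xi a) (xi b) *: (2 * vertex S k a + 1))
      + \sum_(b < k.+1 | (b < a)%N) (bil (xi a) (xi b) *: (2 * vertex S k a)))).
  rewrite -big_split; apply: eq_bigr => a _ /=.
  rewrite E2 bil_sumr scaler_suml [X in _ + X](bigID (fun b : 'I_k.+1 => (a < b)%N)) /=.
  rewrite addrA raddf_sum -big_split /=; congr (_ + _).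
    apply: eq_bigr => b _.
    by rewrite scalerDr addrC alg_mpolyC.
  rewrite (bigD1 a) ?ltnn //= bilvv scale0r add0r; apply: eq_bigl => b.
  by rewrite -leqNgt ltn_neqAle andbC.
rewrite big_split /= [X in _ + X](exchange_big_dep xpredT) //= -big_split /=.
apply: eq_bigr => a _; rewrite -big_split /=; apply: eq_bigr => b _.
by rewrite (bilC (xi a) (xi b)) scaleNr -scalerBr addrAC.
Qed.

(** Leibniz rule: a derivative of the product of the factors in a fibre of f is the sum of the
    derivatives of these factors. *)
Definition push m k (f : 'I_m -> 'I_k) (xi : 'I_m -> 'I_d -> S) : 'I_k -> 'I_d -> S :=
  fun u s => \sum_(a | f a == u) xi a s.

Lemma vtotal_push m k (f : 'I_m -> 'I_k) xi : vtotal (push f xi) =1 vtotal xi.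
Proof.
by move=> s; rewrite /vtotal /push [RHS](partition_big f xpredT).
Qed.

Lemma eq_bilr v w w' : w =1 w' -> bil v w = bil v w'.
Proof. by move=> E; rewrite /bil; do 2!apply: eq_bigr => ? _; rewrite E. Qed.

Lemma eq_bil v v' w w' : v =1 v' -> w =1 w' -> bil v w = bil v' w'.
Proof. by move=> E1 E2; rewrite /bil; do 2!apply: eq_bigr => ? _; rewrite E1 E2. Qed.

Lemma eq_phase k (xi xi' : 'I_k.+1 -> 'I_d -> S) :
  (forall a, xi a =1 xi' a) -> phase xi = phase xi'.
Proof.
move=> E; congr (_%:MP + _).
  by apply: eq_bigr => a _; apply: eq_bigr => b _; exact: eq_bil.
apply: eq_bigr => a _; congr ((_ * _) *: _); apply: eq_bil => // s.
by apply: eq_bigr => b _; rewrite E.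
Qed.

Lemma quad_push m k (f : 'I_m -> 'I_k) xi :
  quad (push f xi) = \sum_(a < m) \sum_(b < m | (f a < f b)%N) bil (xi a) (xi b).
Proof.
rewrite [RHS](partition_big f xpredT) //=; apply: eq_bigr => u _.
transitivity (\sum_(v < k | (u < v)%N) \sum_(a | f a == u) \sum_(b | f b == v) bil (xi a) (xi b)).
  apply: eq_bigr => v _; rewrite bil_suml; apply: eq_bigr => a _.
  by rewrite bil_sumr.
rewrite exchange_big /=; apply: eq_bigr => a /eqP fa.
rewrite [RHS](partition_big f (fun v : 'I_k => (u < v)%N)) => [|b]; last by rewrite fa.
apply: eq_bigr => v uv; apply: eq_bigl => b.
by rewrite fa; case: eqP => [->|]; rewrite ?uv ?andbF ?andbT.
Qed.

(* The maps of tensor factors underlying the products a_j a_(j+1) and a_last a_0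
   of the Hochschild coboundary. *)
Definition merge_ord k j : 'I_k.+2 -> 'I_k.+1 := fun a => inord (unbump j a).
Definition wrap_ord k : 'I_k.+2 -> 'I_k.+1 :=
  fun a => if a == ord_max then ord0 else inord a.

Lemma merge_ordE k j a : (j <= k)%N -> @merge_ord k j a = unbump j a :> nat.
Proof. by move=> jk; rewrite inordK // /unbump; case: a => a /=; lia. Qed.

Lemma vertex_face k j (a : 'I_k.+2) :
  vertex S k.+1 a \mPo face S k j = vertex S k (unbump j a).
Proof.
case: a => -[|a] lta /=; first by rewrite comp_mpoly0.
case: insubP => [i _ iE|]; last by rewrite -ltnS lta.
by rewrite comp_mpolyXU -tnth_nth tnth_mktuple iE.
Qed.

Lemma phase_face k j (xi : 'I_k.+2 -> 'I_d -> S) :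
  phase xi \mPo face S k j = (quad xi)%:MP +
    \sum_(a < k.+2) (2 * bil (xi a) (vtotal xi)) *: vertex S k (unbump j a).
Proof.
rewrite /phase comp_mpolyD comp_mpolyC (raddf_sum (comp_mpoly (face S k j))) /=; congr (_ + _).
by apply: eq_bigr => a _; rewrite comp_mpolyZ vertex_face.
Qed.

Lemma phase_push m k (f : 'I_m -> 'I_k.+1) xi :
  phase (push f xi) = (quad (push f xi))%:MP +
     \sum_a (2 * bil (xi a) (vtotal xi)) *: vertex S k (f a).
Proof.
congr (_ + _); rewrite [RHS](partition_big f xpredT) //=; apply: eq_bigr => u _.
rewrite (eq_bilr _ (vtotal_push f xi)) bil_suml mulr_sumr scaler_suml.
by apply: eq_bigr => a /eqP ->.
Qed.

(** The parts linear in u agree because [push] keeps the total. In [quad], the pair (j, j+1) is the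
    only one that counts before the factors are merged and not after. *)
Lemma phase_merge k j (xi : 'I_k.+2 -> 'I_d -> S) (a b : 'I_k.+2) :
    (j <= k)%N -> a = j :> nat -> b = j.+1 :> nat ->
  phase xi \mPo face S k j =
  phase (push (merge_ord j) xi) + (bil (xi a) (xi b))%:MP.
Proof.
move=> jk aj bj; rewrite phase_face phase_push addrAC; congr (_ + _); last first.
  by apply: eq_bigr => c _; rewrite merge_ordE.
rewrite -rmorphD; congr (_%:MP); rewrite quad_push /quad.
rewrite (bigD1 a) //= [in RHS](bigD1 a) //= [RHS]addrAC; congr (_ + _).
  rewrite (bigD1 b) ?aj ?bj //= addrC; congr (_ + _); apply: eq_bigl => c.
  by rewrite !merge_ordE // aj -val_eqE /= bj /unbump; lia.
apply: eq_bigr => c; rewrite -val_eqE /= aj => cj; apply: eq_bigl => e.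
by rewrite !merge_ordE // /unbump; lia.
Qed.

(** The last factor contributes to [quad] minus the sum of the bil (xi ord_max) (xi a); as a first
    factor it would contribute plus this sum. The last u becomes 1, so its linear term becomes the
    constant 2 * bil (xi ord_max) (vtotal xi), which is exactly the difference. The summand a = 0 is
    left over, since these two factors now share one position. *)
Lemma phase_wrap k (xi : 'I_k.+2 -> 'I_d -> S) :
  phase xi \mPo face S k k.+1 =
  phase (push (@wrap_ord k) xi) + (bil (xi ord_max) (xi ord0))%:MP.
Proof.
have wE (a : 'I_k.+1) : wrap_ord (widen_ord (leqnSn _) a) = a.
  apply: val_inj; rewrite /wrap_ord -val_eqE /= ltn_eqF ?ltn_ord //=.
  by rewrite inordK.
have wM : @wrap_ord k ord_max = ord0 by rewrite /wrap_ord eqxx.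
rewrite phase_face phase_push addrAC [in LHS]big_ord_recr [in RHS]big_ord_recr /= wM /= scaler0 addr0.
have -> : vertex S k (unbump k.+1 k.+1) = 1.
  have -> : unbump k.+1 k.+1 = k.+1 by rewrite /unbump ltnn subn0.
  by rewrite vertexS insubN // -leqNgt.
rewrite addrA addrAC; congr (_ + _); last first.
  apply: eq_bigr => a _; rewrite wE /unbump ltnNge ltnW //= subn0 //.
rewrite alg_mpolyC -!rmorphD; congr (_%:MP); rewrite quad_push /quad.
rewrite [in LHS]big_ord_recr /= [X in _ + X + _]big1 ?addr0; last first.
  by move=> b; rewrite ltnNge -ltnS ltn_ord.
rewrite [in RHS]big_ord_recr /= wM /=.
have -> : \sum_(a < k.+1) \sum_(b < k.+2 | (a < b)%N)
      bil (xi (widen_ord (leqnSn k.+1) a)) (xi b) =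
   \sum_(a < k.+1) \sum_(b < k.+1 | (a < b)%N)
      bil (xi (widen_ord (leqnSn k.+1) a)) (xi (widen_ord (leqnSn k.+1) b))
   - \sum_(a < k.+1) bil (xi ord_max) (xi (widen_ord (leqnSn k.+1) a)).
  rewrite -sumrB; apply: eq_bigr => a _.
  rewrite big_mkcond big_ord_recr /= ltn_ord -big_mkcond /=; congr (_ + _).
  by rewrite bilC.
have -> : bil (xi ord_max) (vtotal xi) =
    \sum_(a < k.+1) bil (xi ord_max) (xi (widen_ord (leqnSn k.+1) a)).
  by rewrite bil_sumr big_ord_recr /= bilvv addr0.
have -> : \sum_(a < k.+1) \sum_(b | (wrap_ord (widen_ord (leqnSn k.+1) a) < wrap_ord b)%N)
     bil (xi (widen_ord (leqnSn k.+1) a)) (xi b) =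
   \sum_(a < k.+1) \sum_(b < k.+1 | (a < b)%N)
      bil (xi (widen_ord (leqnSn k.+1) a)) (xi (widen_ord (leqnSn k.+1) b)).
  apply: eq_bigr => a _; rewrite big_mkcond big_ord_recr /= wM ltn0 addr0.
  by rewrite -big_mkcond; apply: eq_bigl => b; rewrite !wE.
rewrite -[RHS]addrA -[LHS]addrA; congr (_ + _).
rewrite [X in _ = X + _]big_mkcond [X in _ = X + _]big_ord_recr /= wM ltnn addr0.
rewrite !big_ord_recl /= wE ltnn add0r.
have -> : widen_ord (leqnSn k.+1) ord0 = ord0 by exact: val_inj.
under [X in _ = X + _]eq_bigr do rewrite wE /=.
by ring.
Qed.

End Phase.

(** * Determinants with symbols as rows, and their minors *)

Section RowDeterminant.
Variables (S : comNzRingType) (d : nat).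

Definition rowdet (v : 'I_d -> 'I_d -> S) : S := \det (\matrix_(i, s) v i s).

Lemma eq_rowdet v w : (forall i, v i =1 w i) -> rowdet v = rowdet w.
Proof. by move=> E; congr (\det _); apply/matrixP => i s; rewrite !mxE E. Qed.

Lemma rowdet_add v w1 w2 (i0 : 'I_d) :
    (forall s, v i0 s = w1 i0 s + w2 i0 s) ->
    (forall i, i != i0 -> v i =1 w1 i) -> (forall i, i != i0 -> v i =1 w2 i) ->
  rowdet v = rowdet w1 + rowdet w2.
Proof.
move=> E0 E1 E2; rewrite -[rowdet w1]mul1r -[rowdet w2]mul1r.
apply: determinant_multilinear.
- by rewrite !scale1r; apply/rowP => s; rewrite !mxE.
- by apply/matrixP => i s; rewrite !mxE -E1 // eq_sym neq_lift.
- by apply/matrixP => i s; rewrite !mxE -E2 // eq_sym neq_lift.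
Qed.

Variable xi : 'I_d.+1 -> 'I_d -> S.

Definition minor_det (i : 'I_d.+1) : S := rowdet (fun r => xi (lift i r)).

(** Laplace expansion along the first column of the square matrix with rows xi_i in which column s
    is repeated in front. *)
Lemma sum_minor_det (s : 'I_d) : \sum_(i < d.+1) (-1) ^+ i * minor_det i * xi i s = 0.
Proof.
pose M : 'M[S]_d.+1 := \matrix_(i, t) if unlift ord0 t is Some t' then xi i t' else xi i s.
have M0 : \det M = 0.
  rewrite -det_tr; apply: (@determinant_alternate _ _ _ ord0 (lift ord0 s)).
    by rewrite neq_lift.
  by move=> i; rewrite !mxE unlift_none liftK.
rewrite -[RHS]M0 (expand_det_col M ord0); apply: eq_bigr => i _.
rewrite mxE unlift_none mulrC /cofactor addn0; congr (_ * (_ * \det _)).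
by apply/matrixP => r t; rewrite !mxE liftK.
Qed.

End RowDeterminant.

Section DerivationPower.
Variables (S : comNzRingType) (k : nat) (a : 'I_k -> S) (p : {mpoly S[k]}).

Lemma derivation_exp e : \sum_i a i *: p^`M(i) = 0 ->
  \sum_i a i *: (p ^+ e)^`M(i) = 0.
Proof.
move=> p0; elim: e => [|e IH].
  by rewrite big1 // => i _; rewrite expr0 -mpolyC1 mderivC scaler0.
rewrite exprS; transitivity ((\sum_i a i *: p^`M(i)) * p ^+ e +
    p * \sum_i a i *: (p ^+ e)^`M(i)); last by rewrite p0 IH mul0r mulr0 addr0.
rewrite mulr_suml mulr_sumr -big_split; apply: eq_bigr => i _ /=.
by rewrite mderivM scalerDr scalerAl scalerAr.
Qed.

End DerivationPower.

Section Identities.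
Variables (F : numFieldType) (S : comNzRingType) (rho : {rmorphism F -> S}).
Variables (d : nat) (J : 'M[S]_d).
Hypothesis Jdiag : forall s, J s s = 0.
Hypothesis Jskew : forall s t, J t s = - J s t.
Local Notation bil := (bil J).
Local Notation phase := (phase J).

Lemma mderiv_phase k (xi : 'I_k.+1 -> 'I_d -> S) (i : 'I_k) :
  (phase xi)^`M(i) = (2 * bil (xi (lift ord0 i)) (vtotal xi))%:MP.
Proof.
rewrite mderivD mderivC add0r (raddf_sum (mderiv i)) /= big_ord_recl /=.
rewrite scaler0 mderiv0 add0r (bigD1 i) //= [X in _ + X]big1 => [|j ji].
  rewrite addr0 mderivZ valK mderivX mnm1E eqxx -(alg_mpolyC k); congr (_ *: _).
  by rewrite scale1r (_ : (U_(i) - U_(i))%MM = 0%MM) ?mpolyX0 //; apply/mnmP => t; rewrite mnmBE mnm0E subnn.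
by rewrite mderivZ valK mderivX mnm1E (negbTE ji) scale0r scaler0.
Qed.

Lemma bilE v w : bil v w = \sum_s v s * bil (fun t => (t == s)%:R) w.
Proof.
rewrite /bil; apply: eq_bigr => s _.
rewrite [X in _ = _ * X](bigD1 s) //= [X in _ = _ * (_ + X)]big1 => [|t ts].
  rewrite addr0 mulr_sumr; apply: eq_bigr => t _.
  by rewrite eqxx mul1r mulrCA.
by rewrite big1 // => u _; rewrite (negbTE ts) mul0r mulr0.
Qed.

Lemma push_merge k j (xi : 'I_k.+2 -> 'I_d -> S) (u : 'I_k.+1) : (j <= k)%N ->
  push (merge_ord j) xi u =1 fun s =>
    if (u < j)%N then xi (inord u) s
    else if u == j :> nat then xi (inord j) s + xi (inord j.+1) s
    else xi (inord u.+1) s.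
Proof.
move=> jk s; rewrite /push.
have E (a : 'I_k.+2) : (merge_ord j a == u) = (unbump j a == u).
  by rewrite -val_eqE /= merge_ordE.
rewrite (eq_bigl _ _ E); case: (ltngtP u j) => uj.
- rewrite (big_pred1 (inord u)) // => a /=; rewrite -[RHS]val_eqE /= inordK 1?ltnW // /unbump; lia.
- rewrite (big_pred1 (inord u.+1)) // => a /=.
  have lu : (u <= k)%N by rewrite -ltnS.
  by rewrite -[RHS]val_eqE /= inordK ?ltnS // /unbump; lia.
have j1 : (inord j : 'I_k.+2) = j :> nat by rewrite inordK // ltnS ltnW.
have j2 : (inord j.+1 : 'I_k.+2) = j.+1 :> nat by rewrite inordK.
rewrite (bigD1 (inord j)) ?j1 /=; last by rewrite /unbump; lia.
congr (_ + _); rewrite (big_pred1 (inord j.+1)) // => a /=.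
by rewrite -(val_eqE a (inord j)) -[RHS]val_eqE /= j1 j2 /unbump; lia.
Qed.

Lemma push_wrap k (xi : 'I_k.+2 -> 'I_d -> S) (u : 'I_k.+1) : u != ord0 ->
  push (@wrap_ord k) xi u =1 xi (inord u).
Proof.
move=> u0 s; rewrite /push (big_pred1 (inord u)) // => a.
have ule : (u < k.+2)%N by apply: ltn_trans (ltn_ord u) _.
rewrite /= /wrap_ord -[RHS]val_eqE /= inordK //.
case: (eqVneq a ord_max) => [->|am].
  by rewrite eq_sym (negbTE u0) gtn_eqF.
have la : (a < k.+1)%N.
  by move: am; rewrite -val_eqE /=; case: a => a /=; lia.
by rewrite -val_eqE /= inordK.
Qed.

Variable xi : 'I_d.+2 -> 'I_d -> S.
(** [D j] omits xi_(j+1); xi_0 never occurs, because the determinant does not differentiate the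
    factor 0. *)
Let D := minor_det (fun i : 'I_d.+1 => xi (lift ord0 i)).

Lemma sum_minor_bil w : \sum_(i < d.+1) (-1) ^+ i * D i * bil (xi (lift ord0 i)) w = 0.
Proof.
under eq_bigr do rewrite bilE mulr_sumr.
rewrite exchange_big big1 //= => s _.
under eq_bigr do rewrite mulrA.
by rewrite -mulr_suml sum_minor_det mul0r.
Qed.

Lemma minor_detE (j : 'I_d.+1) : D j = rowdet (fun r => xi (inord (bump j r).+1)).
Proof.
apply: eq_rowdet => r s; congr (xi _ s); apply: val_inj.
by rewrite /= /bump inordK; case: j => j /=; case: r => r /=; lia.
Qed.

(** For j > 0 one row is xi_j + xi_(j+1), and keeping one summand gives the minor that omits the
    other. For j = 0 the sum sits in the factor 0, outside the determinant, and only xi_1 is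
    omitted. *)
Lemma rowdet_merge (j : 'I_d.+1) :
  rowdet (fun r => push (merge_ord j) xi (lift ord0 r)) =
  (if val j is i.+1 then D (inord i) else 0) + D j.
Proof.
have jd : (j <= d)%N by rewrite -ltnS.
rewrite [D j]minor_detE; case: j jd => -[|j] ltj /= jd.
  by rewrite add0r; apply: eq_rowdet => r s; rewrite push_merge.
have -> : D (inord j) = rowdet (fun r => xi (inord (bump j r).+1)).
  by rewrite minor_detE inordK // ltnW.
rewrite addrC; apply: (@rowdet_add _ _ _ _ _ (Ordinal jd)) => [s|r rj s|r rj s].
- rewrite push_merge //= (_ : bump 0 j = j.+1) // ltnn eqxx; congr (xi (inord _) s + xi (inord _) s).
  + by rewrite /bump; lia.
  + by rewrite /bump; lia.
- have {}rj : (r : nat) <> j by move=> E; move: rj; rewrite -val_eqE /= E eqxx.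
  rewrite push_merge //= (_ : bump 0 r = r.+1) //.
  case: ltngtP => rj'; [|  |by case: rj; lia].
    by congr (xi (inord _) s); rewrite /bump; lia.
  by congr (xi (inord _) s); rewrite /bump; lia.
- have {}rj : (r : nat) <> j by move=> E; move: rj; rewrite -val_eqE /= E eqxx.
  rewrite push_merge //= (_ : bump 0 r = r.+1) //.
  case: ltngtP => rj'; [|  |by case: rj; lia].
    by congr (xi (inord _) s); rewrite /bump; lia.
  by congr (xi (inord _) s); rewrite /bump; lia.
Qed.

Lemma rowdet_wrap :
  rowdet (fun r => push (@wrap_ord d) xi (lift ord0 r)) = D ord_max.
Proof.
rewrite minor_detE; apply: eq_rowdet => r s; rewrite push_wrap 1?eq_sym ?neq_lift //.
by congr (xi (inord _) s); rewrite /= /bump; case: r => r /=; lia.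
Qed.

(** By [rowdet_merge] the minor [D j] occurs on the faces j and j+1, with opposite signs. Summation
    by parts gives differences of neighbouring faces, which [simplex_stokes] turns into derivatives
    in u. *)
Lemma hochschild_identity e :
  \sum_(j < d.+1) (-1) ^+ j *
     (rowdet (fun r => push (merge_ord j) xi (lift ord0 r)) *
      simplexI rho ((phase (push (merge_ord j) xi) +
         (bil (xi (widen_ord (leqnSn _) j)) (xi (lift ord0 j)))%:MP) ^+ e))
  + (-1) ^+ d.+1 *
     (rowdet (fun r => push (@wrap_ord d) xi (lift ord0 r)) *
      simplexI rho ((phase (push (@wrap_ord d) xi) +
         (bil (xi ord_max) (xi ord0))%:MP) ^+ e)) = 0.
Proof.
pose A j : S := simplexI rho ((phase xi ^+ e) \mPo face S d j).
have Am (j : 'I_d.+1) : simplexI rho ((phase (push (merge_ord j) xi) +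
         (bil (xi (widen_ord (leqnSn _) j)) (xi (lift ord0 j)))%:MP) ^+ e) = A j.
  rewrite /A rmorphXn /= -(phase_merge Jskew) //; first by rewrite -ltnS.
have Aw : simplexI rho ((phase (push (@wrap_ord d) xi) +
         (bil (xi ord_max) (xi ord0))%:MP) ^+ e) = A d.+1.
  by rewrite /A rmorphXn /= -(phase_wrap Jdiag Jskew).
rewrite rowdet_wrap Aw; under eq_bigr do rewrite rowdet_merge Am mulrDl mulrDr.
rewrite big_split /= big_ord_recl /= mul0r mulr0 add0r addrAC.
have -> : \sum_(i < d) (-1) ^+ bump 0 i * (D (inord i) * A (bump 0 i)) +
    (-1) ^+ d.+1 * (D ord_max * A d.+1) = - \sum_(i < d.+1) (-1) ^+ i * (D i * A i.+1).
  rewrite big_ord_recr /= opprD -sumrN exprS mulN1r mulNr; congr (_ + _).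
  apply: eq_bigr => i _; rewrite /bump add1n exprS mulN1r mulNr.
  by congr (- (_ * (D _ * _))); apply: val_inj; rewrite /= inordK // ltnS ltnW.
rewrite addrC -sumrB.
have -> : \sum_(i < d.+1) ((-1) ^+ i * (D i * A i) - (-1) ^+ i * (D i * A i.+1)) =
   - simplexI rho (\sum_(i < d.+1) ((-1) ^+ i * D i) *: (phase xi ^+ e)^`M(i)).
  rewrite [simplexI _ _]raddf_sum -sumrN; apply: eq_bigr => i _ /=.
  transitivity (- (((-1) ^+ i * D i) * (A i.+1 - A i))); first by ring.
  by rewrite linearZ /= simplex_stokes.
rewrite derivation_exp ?raddf0 ?oppr0 //.
transitivity ((2 * \sum_(i < d.+1) (-1) ^+ i * D i * bil (xi (lift ord0 i)) (vtotal xi))%:MP : {mpoly S[d.+1]}).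
  rewrite mulr_sumr raddf_sum; apply: eq_bigr => i _ /=.
  by rewrite mderiv_phase -mul_mpolyC -rmorphM; congr (_%:MP); ring.
by rewrite sum_minor_bil mulr0 mpolyC0.
Qed.

End Identities.

(** * Insertion of a quadratic Hamiltonian *)

Section Naturality.
Variables (F : numFieldType) (S S' : comNzRingType).
Variables (rho : {rmorphism F -> S}) (rho' : {rmorphism F -> S'}).
Variable phi : {rmorphism S -> S'}.
Hypothesis phi_rho : forall x, phi (rho x) = rho' x.

Lemma rmorph_simplexI k (p : {mpoly S[k]}) :
  phi (simplexI rho p) = simplexI rho' (map_mpoly phi p).
Proof.
rewrite [in RHS](mpolyE p) (raddf_sum (map_mpoly phi)) (raddf_sum (@simplexI _ _ rho' k)) raddf_sum.
apply: eq_bigr => m _ /=.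
rewrite map_mpolyZ map_mpolyX linearZ /= simplexIX -phi_rho; exact: rmorphM.
Qed.

Lemma map_mpoly_vertex k j : map_mpoly phi (vertex S k j) = vertex S' k j.
Proof.
case: j => [|j] /=; first exact: rmorph0.
by case: insubP => [i _ _|_]; rewrite ?map_mpolyX ?rmorph1.
Qed.

Lemma rmorph_bil d (J : 'M[S]_d) v w :
  phi (bil J v w) = bil (map_mx phi J) (phi \o v) (phi \o w).
Proof.
rewrite /bil rmorph_sum; apply: eq_bigr => s _.
by rewrite rmorph_sum; apply: eq_bigr => t _; rewrite !rmorphM mxE.
Qed.

Lemma rmorph_quad d (J : 'M[S]_d) k (xi : 'I_k -> 'I_d -> S) :
  phi (quad J xi) = quad (map_mx phi J) (fun a => phi \o xi a).
Proof.
rewrite /quad rmorph_sum; apply: eq_bigr => a _.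
by rewrite rmorph_sum; apply: eq_bigr => b _; rewrite rmorph_bil.
Qed.

Lemma rmorph_bil_vtotal d (J : 'M[S]_d) k (xi : 'I_k -> 'I_d -> S) v :
  phi (bil J v (vtotal xi)) =
  bil (map_mx phi J) (phi \o v) (vtotal (fun a => phi \o xi a)).
Proof.
by rewrite rmorph_bil; apply: eq_bilr => s; rewrite /= /vtotal rmorph_sum.
Qed.

Lemma map_mpoly_phase d (J : 'M[S]_d) k (xi : 'I_k.+1 -> 'I_d -> S) :
  map_mpoly phi (phase J xi) = phase (map_mx phi J) (fun a => phi \o xi a).
Proof.
have E c : map_mpoly phi c%:MP_[k] = (phi c)%:MP by exact: map_mpolyC.
rewrite /phase rmorphD /= E rmorph_quad (rmorph_sum (map_mpoly phi)); congr (_ + _).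
apply: eq_bigr => a _ /=.
by rewrite map_mpolyZ map_mpoly_vertex rmorphM rmorph_nat rmorph_bil_vtotal.
Qed.

Lemma rmorph_rowdet d (v : 'I_d -> 'I_d -> S) :
  phi (rowdet v) = rowdet (fun i => phi \o v i).
Proof.
by rewrite /rowdet -det_map_mx; congr (\det _); apply/matrixP => i s; rewrite !mxE.
Qed.

(** Lets the symbol, written once in generic variables, be specialised to sums of variables. *)
Lemma rmorph_symbol d (J : 'M[S]_d) k (v : 'I_d -> 'I_d -> S) (xi : 'I_k.+1 -> 'I_d -> S)
    e c :
  phi (rowdet v * (simplexI rho (phase J xi ^+ e) * rho c)) =
  rowdet (fun i => phi \o v i) *
  (simplexI rho' (phase (map_mx phi J) (fun a => phi \o xi a) ^+ e) * rho' c).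
Proof.
by rewrite !rmorphM rmorph_simplexI phi_rho rmorphXn /= map_mpoly_phase rmorph_rowdet.
Qed.

End Naturality.

Lemma eq_symbol (F : numFieldType) (S : comNzRingType) (rho : {rmorphism F -> S}) d
    (J : 'M[S]_d) (xi xi' : 'I_d.+1 -> 'I_d -> S) e c :
  (forall a, xi a =1 xi' a) ->
  rowdet (fun r => xi (lift ord0 r)) * (simplexI rho (phase J xi ^+ e) * c) =
  rowdet (fun r => xi' (lift ord0 r)) * (simplexI rho (phase J xi' ^+ e) * c).
Proof. by move=> E; rewrite (eq_phase J E) (@eq_rowdet _ _ _ (fun r => xi' (lift ord0 r))). Qed.

Lemma sum_lift (V : nmodType) m (p : 'I_m.+1) (f : 'I_m.+1 -> V) :
  \sum_i f i = f p + \sum_(i < m) f (lift p i).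
Proof. by rewrite (bigD1_ord p). Qed.

Lemma comp_mpoly_sum (S : comNzRingType) m l (t : m.-tuple {mpoly S[l]})
    (I : Type) (r : seq I) (P : pred I) (f : I -> {mpoly S[m]}) :
  (\sum_(i <- r | P i) f i) \mPo t = \sum_(i <- r | P i) (f i \mPo t).
Proof. exact: raddf_sum. Qed.

Lemma mderiv_sum (S : comNzRingType) m (t : 'I_m)
    (I : Type) (r : seq I) (P : pred I) (f : I -> {mpoly S[m]}) :
  (\sum_(i <- r | P i) f i)^`M(t) = \sum_(i <- r | P i) (f i)^`M(t).
Proof. exact: raddf_sum. Qed.

Section Insertion.
Variables (F : numFieldType) (S : comNzRingType) (rho : {rmorphism F -> S}).
Variables (k : nat).
Local Notation d := k.+1.
Variable J : 'M[S]_d.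
Hypothesis Jdiag : forall s, J s s = 0.
Hypothesis Jskew : forall s t, J t s = - J s t.
Local Notation bil := (bil J).
Local Notation phase := (phase J).

Definition insert (T : Type) m (p : 'I_m.+1) (v : T) (x : 'I_m -> T) : 'I_m.+1 -> T :=
  fun a => if unlift p a is Some b then x b else v.

Lemma insert_lift (T : Type) m p (v : T) (x : 'I_m -> T) b : insert p v x (lift p b) = x b.
Proof. by rewrite /insert liftK. Qed.

Lemma insert_at (T : Type) m (p : 'I_m.+1) (v : T) (x : 'I_m -> T) : insert p v x p = v.
Proof. by rewrite /insert unlift_none. Qed.

(** Pullback along the map of simplices that forgets the coordinate of the inserted factor. *)
Definition degeneracy (j : 'I_k.+1) : k.-tuple {mpoly S[k.+1]} :=
  [tuple 'X_(lift j i) | i < k].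

Lemma vertex_degeneracy j (b : 'I_k.+1) :
  vertex S k b \mPo degeneracy j = vertex S k.+1 (lift (lift ord0 j) b).
Proof.
case: b => -[|b] ltb /=; first by rewrite comp_mpoly0.
have ltb' : (b < k)%N by [].
rewrite (insubT (fun i => (i < k)%N) ltb') comp_mpolyXU -tnth_nth tnth_mktuple.
have -> : bump (bump 0 j) b.+1 = (lift j (Ordinal ltb')).+1 by rewrite /= /bump; lia.
by rewrite vertexS valK.
Qed.

Section Linear.
Variables (x : 'I_k.+1 -> 'I_d -> S) (eta : 'I_d -> S).

(** The part of the phase that contains eta, inserted at position j+1, where the coordinate is
    ['X_j]. The constant is -1 for the factors to its left, since there the pair occurs in the order
    bil (x b) eta. *)
Definition lphase (j : 'I_k.+1) : {mpoly S[k.+1]} :=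
  \sum_b bil eta (x b) *: (2 * 'X_j - 2 * vertex S k.+1 (lift (lift ord0 j) b)
    + (if (b <= j)%N then -1 else 1)).

Lemma phase_insert (j : 'I_k.+1) :
  phase (insert (lift ord0 j) eta x) = phase x \mPo degeneracy j + lphase j.
Proof.
have : (lift ord0 j : 'I_k.+2) = j.+1 :> nat by [].
have : forall b : 'I_k.+1, vertex S k b \mPo degeneracy j = vertex S k.+1 (lift (lift ord0 j) b).
  exact: vertex_degeneracy.
rewrite /lphase; move: (lift ord0 j) => p Vp pj.
have Xp : vertex S k.+1 p = 'X_j by rewrite pj vertexS valK.
have lift_lt (b c : 'I_k.+1) : (lift p b < lift p c)%N = (b < c)%N.
  by rewrite /= /bump; lia.
have p_lt (b : 'I_k.+1) : (p < lift p b)%N = ~~ (b <= j)%N by rewrite /= /bump; lia.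
have lt_p (b : 'I_k.+1) : (lift p b < p)%N = (b <= j)%N by rewrite /= /bump; lia.
rewrite !(phaseE Jdiag Jskew) [LHS](sum_lift p) insert_at Xp.
rewrite [X in X + _ = _]big_mkcond [X in X + _ = _](sum_lift p) ltnn add0r.
under [X in _ + X = _]eq_bigr => b _.
  rewrite big_mkcond (sum_lift p) !insert_lift insert_at Xp lt_p.
  under [X in _ + X]eq_bigr do rewrite lift_lt insert_lift.
  over.
rewrite big_split addrA addrC; congr (_ + _).
  rewrite comp_mpoly_sum; apply: eq_bigr => b _.
  rewrite comp_mpoly_sum -big_mkcond; apply: eq_bigr => c _.
  rewrite comp_mpolyZ; congr (_ *: _).
  by rewrite rmorphD rmorphB !rmorphM !rmorph_nat rmorph1 /= !Vp.
rewrite -big_split; apply: eq_bigr => b _ /=.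
rewrite -/(lift p b) p_lt insert_lift; case: (b <= j)%N => /=.
  by rewrite add0r (bilC Jskew eta) scaleNr -scalerN; congr (_ *: _); ring.
by rewrite addr0.
Qed.

(* The primitive in u_j of lphase j whose values on the two faces adjacent to u_j
   telescope. *)
Definition primitive (j : 'I_k.+1) : {mpoly S[k.+1]} :=
  \sum_b bil eta (x b) *:
    ((fun u => u ^+ 2 + (if (b <= j)%N then - u else u))
       ('X_j - vertex S k.+1 (lift (lift ord0 j) b))).

Lemma mderiv_primitive j : (primitive j)^`M(j) = lphase j.
Proof.
rewrite mderiv_sum; apply: eq_bigr => b _.
rewrite mderivZ; congr (_ *: _).
have Xj : ('X_j : {mpoly S[k.+1]})^`M(j) = 1.
  rewrite mderivX mnm1E eqxx scale1r (_ : (U_(j) - U_(j))%MM = 0%MM) ?mpolyX0 //.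
  by apply/mnmP => t; rewrite mnmBE mnm0E subnn.
have V0 : (vertex S k.+1 (lift (lift ord0 j) b))^`M(j) = 0.
  have : bump (bump 0 j) b != j.+1 by rewrite /bump; lia.
  rewrite /=; move: (bump _ b) => [|i] /= ij; first by rewrite mderiv0.
  case: insubP => [i' _ iE|_]; last by rewrite -mpolyC1 mderivC.
  rewrite mderivX mnm1E; case: eqP => [i'j|]; last by rewrite scale0r.
  by move: ij; rewrite -iE i'j /= eqxx.
have D : ('X_j - vertex S k.+1 (lift (lift ord0 j) b))^`M(j) = 1.
  by rewrite mderivB Xj V0 subr0.
rewrite expr2 mderivD mderivM D; case: ifP => _; rewrite ?mderivN D; ring.
Qed.

Lemma mderiv_degeneracy j (g : {mpoly S[k]}) : (g \mPo degeneracy j)^`M(j) = 0.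
Proof.
elim/mpolyind_var: g => [|i p IH|c p q IHp IHq].
- by rewrite rmorph1 -mpolyC1 mderivC.
- rewrite rmorphM mderivM IH mulr0 addr0 /= comp_mpolyXU -tnth_nth tnth_mktuple.
  by rewrite mderivX mnm1E eq_sym (negbTE (neq_lift _ _)) scale0r mul0r.
- by rewrite linearP mderivD mderivZ IHp IHq scaler0 addr0.
Qed.

Lemma degeneracy_face (j : 'I_k.+1) (g : {mpoly S[k]}) h : (h == j :> nat) || (h == j.+1) ->
  (g \mPo degeneracy j) \mPo face S k h = g.
Proof.
move=> hj; elim/mpolyind_var: g => [|i p IH|c p q IHp IHq].
- by rewrite !rmorph1.
- rewrite !rmorphM /= IH comp_mpolyXU -tnth_nth tnth_mktuple comp_mpolyXU -tnth_nth tnth_mktuple.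
  congr (_ * _); have -> : unbump h (lift j i).+1 = i.+1.
    by rewrite /= /unbump /bump; move: hj; lia.
  by rewrite vertexS valK.
- by rewrite !linearP /= IHp IHq.
Qed.

(** It depends on the face h only, and not on which of the two adjacent variables was integrated;
    this is what makes the sum over the positions telescope. *)
Definition boundary (h : nat) : {mpoly S[k]} :=
  \sum_(b < k.+1) bil eta (x b) *:
    ((fun u => u ^+ 2 + (if (b < h)%N then - u else u))
       (vertex S k h - vertex S k b)).

Lemma primitive_face (j : 'I_k.+1) h : (h == j :> nat) || (h == j.+1) ->
  primitive j \mPo face S k h = boundary h.
Proof.
move=> hj; rewrite comp_mpoly_sum; apply: eq_bigr => b _.
rewrite comp_mpolyZ; congr (_ *: _); rewrite rmorphD rmorphXn /=.
have E : ('X_j - vertex S k.+1 (bump (bump 0 j) b)) \mPo face S k h =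
   vertex S k h - vertex S k b.
  rewrite rmorphB /= (@vertex_face S k h (lift (lift ord0 j) b)) comp_mpolyXU -tnth_nth tnth_mktuple.
  by congr (vertex S k _ - vertex S k _); rewrite /= /unbump /bump; move: hj; lia.
have EN (c : bool) :
    (if c then - ('X_j - vertex S k.+1 (bump (bump 0 j) b))
     else 'X_j - vertex S k.+1 (bump (bump 0 j) b)) \mPo face S k h =
    if c then - (vertex S k h - vertex S k b) else vertex S k h - vertex S k b.
  by case: c; rewrite ?rmorphN /= E.
(* The sign conditions b <= j and b < h differ only when h = j, at b = h, where the argument of the
   primitive is 0. *)
rewrite E EN; congr (_ + _); have [->|bh] := eqVneq (b : nat) h.
  by rewrite subrr oppr0 !if_same.
by congr (if _ then _ else _); move: hj; lia.
Qed.

(** With v = [vertex S k b], the left side has u^2 - u at u = 1 - v and the right side u^2 + u at u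
    = -v; both are v^2 - v. *)
Lemma boundary_closed : boundary k.+1 = boundary 0.
Proof.
apply: eq_bigr => b _; congr (_ *: _).
have -> : vertex S k k.+1 = 1 by rewrite vertexS insubN // -leqNgt.
by rewrite ltn_ord /=; ring.
Qed.

Lemma sum_simplexI_lphase (g : {mpoly S[k]}) :
  \sum_j simplexI rho ((g \mPo degeneracy j) * lphase j) = 0.
Proof.
transitivity (\sum_(j < k.+1) (simplexI rho (g * boundary j.+1) - simplexI rho (g * boundary j))).
  apply: eq_bigr => j _.
  have -> : (g \mPo degeneracy j) * lphase j = ((g \mPo degeneracy j) * primitive j)^`M(j).
    by rewrite mderivM mderiv_degeneracy mul0r add0r mderiv_primitive.
  rewrite simplex_stokes !rmorphM /=.
  by rewrite !degeneracy_face ?primitive_face ?eqxx ?orbT.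
rewrite -(big_mkord xpredT (fun j => simplexI rho (g * boundary j.+1) - simplexI rho (g * boundary j))).
by rewrite telescope_sumr // boundary_closed subrr.
Qed.

End Linear.

Lemma exprD_square (A : comNzRingType) (u v : A) e : exists r,
  (u + v) ^+ e = u ^+ e + e%:R * (u ^+ e.-1 * v) + v ^+ 2 * r.
Proof.
case: e => [|e]; first by exists 0; rewrite !expr0 mul0r mulr0 !addr0.
rewrite /=; elim: e => [|e [r IH]].
  by exists 0; rewrite !expr1 expr0 !mul1r mulr0 addr0.
exists (u * r + v * r + e.+1%:R * u ^+ e).
rewrite exprS IH (exprS u e.+1) (exprS u e) -(natr1 e.+1).
by move: (u ^+ e) (e.+1%:R : A) => w c; ring.
Qed.

(** Expansion along the inserted row j. Its sign (-1)^j cancels the sign of the position, so that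
    the sum over the positions loses its signs and can telescope. *)
Lemma rowdet_insert (j : 'I_k.+1) (eta : 'I_d -> S) (x : 'I_k.+1 -> 'I_d -> S) :
  rowdet (fun r => insert (lift ord0 j) eta x (lift ord0 r)) =
  (-1) ^+ j * \sum_(s < d) eta s * ((-1) ^+ s * rowdet (fun r t => x (lift ord0 r) (lift s t))).
Proof.
rewrite /rowdet (expand_det_row _ j) mulr_sumr; apply: eq_bigr => s _.
rewrite mxE insert_at /cofactor exprD mulrCA -!mulrA; congr (_ * _).
rewrite mulrCA; congr (_ * (_ * \det _)).
apply/matrixP => r t; rewrite !mxE.
have -> : lift ord0 (lift j r) = lift (lift ord0 j) (lift ord0 r).
  by apply: val_inj; rewrite /= /bump; lia.
by rewrite insert_lift.
Qed.

(** Sorted by degree in eta: the determinant supplies one eta, the power of the phase the rest.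
    Total degree 2 cancels by [sum_simplexI_lphase]. Degree 1 and degrees at least 3 are kept; on a
    quadratic polynomial they meet first derivatives at 0 and third derivatives, which vanish. *)
Lemma insertion_identity (x : 'I_k.+1 -> 'I_d -> S) (eta : 'I_d -> S) e :
  exists r : 'I_d -> 'I_d -> 'I_d -> S,
  \sum_(j < k.+1) (-1) ^+ j *
    (rowdet (fun r => insert (lift ord0 j) eta x (lift ord0 r)) *
     simplexI rho (phase (insert (lift ord0 j) eta x) ^+ e)) =
  \sum_(s < d) eta s * ((-1) ^+ s * rowdet (fun r t => x (lift ord0 r) (lift s t)) *
    \sum_j simplexI rho ((phase x \mPo degeneracy j) ^+ e)) +
  \sum_s \sum_t \sum_u eta s * eta t * eta u * r s t u.
Proof.
pose E (s : 'I_d) : S := (-1) ^+ s * rowdet (fun r t => x (lift ord0 r) (lift s t)).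
pose c (j : 'I_k.+1) (b : 'I_k.+1) : {mpoly S[k.+1]} := 2 * 'X_j - 2 * vertex S k.+1 (lift (lift ord0 j) b)
    + (if (b <= j)%N then -1 else 1).
pose l (j : 'I_k.+1) (s : 'I_d) : {mpoly S[k.+1]} :=
  \sum_(b < k.+1) bil (fun t => (t == s)%:R) (x b) *: c j b.
have lE (j : 'I_k.+1) : lphase x eta j = \sum_s eta s *: l j s.
  rewrite /lphase; under eq_bigr do rewrite bilE scaler_suml.
  rewrite exchange_big; apply: eq_bigr => s _ /=; rewrite scaler_sumr.
  by apply: eq_bigr => b _; rewrite scalerA.
have /fin_all_exists [r rE] (j : 'I_k.+1) : exists r, phase (insert (lift ord0 j) eta x) ^+ e =
   (phase x \mPo degeneracy j) ^+ e +
   e%:R * ((phase x \mPo degeneracy j) ^+ e.-1 * lphase x eta j) + lphase x eta j ^+ 2 * r.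
  by rewrite phase_insert; exact: exprD_square.
exists (fun s t u => E s * \sum_j simplexI rho (l j t * l j u * r j)).
transitivity ((\sum_s eta s * E s) * \sum_j simplexI rho (phase (insert (lift ord0 j) eta x) ^+ e)).
  rewrite mulr_sumr; apply: eq_bigr => j _.
  by rewrite rowdet_insert -/(E _) !mulrA -expr2 sqrr_sign mul1r.
have -> : \sum_j simplexI rho (phase (insert (lift ord0 j) eta x) ^+ e) =
   \sum_j simplexI rho ((phase x \mPo degeneracy j) ^+ e) +
   \sum_t \sum_u eta t * eta u * \sum_j simplexI rho (l j t * l j u * r j).
  transitivity (\sum_j (simplexI rho ((phase x \mPo degeneracy j) ^+ e) +
     e%:R * simplexI rho ((phase x ^+ e.-1 \mPo degeneracy j) * lphase x eta j) +
     simplexI rho (lphase x eta j ^+ 2 * r j))).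
    apply: eq_bigr => j _; rewrite rE 2!(raddfD (@simplexI _ _ rho k.+1)) /=; congr (_ + _ + _).
    by rewrite !mulr_natl raddfMn rmorphXn.
  rewrite !big_split /= -mulr_sumr sum_simplexI_lphase mulr0 addr0; congr (_ + _).
  transitivity (\sum_j \sum_t \sum_u eta t * eta u * simplexI rho (l j t * l j u * r j)).
    apply: eq_bigr => j _; rewrite lE expr2 !mulr_suml raddf_sum; apply: eq_bigr => t _ /=.
    rewrite mulr_sumr mulr_suml raddf_sum; apply: eq_bigr => u _ /=.
    by rewrite -scalerAl -scalerAr scalerA -scalerAl linearZ.
  rewrite exchange_big; apply: eq_bigr => t _ /=.
  rewrite exchange_big; apply: eq_bigr => u _ /=.
  by rewrite mulr_sumr.
rewrite mulrDr !mulr_suml; congr (_ + _); apply: eq_bigr => s _; rewrite -?mulrA //.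
rewrite !mulr_sumr; apply: eq_bigr => t _; rewrite !mulr_sumr; apply: eq_bigr => u _.
by rewrite [in RHS]/E; ring.
Qed.

End Insertion.

(** * Differential operators with constant coefficients *)

Section DividedPowers.
Variables (F : numFieldType) (A : comNzRingType) (rho : {rmorphism F -> A}).

Definition dpow (x : A) e : A := x ^+ e * rho e`!%:R^-1.

Lemma dpowD x y e :
  dpow (x + y) e = \sum_(j < e.+1) dpow x j * dpow y (e - j).
Proof.
have fact0 (m : nat) : m`!%:R != 0 :> F by rewrite pnatr_eq0 -lt0n fact_gt0.
rewrite /dpow addrC exprDn mulr_suml; apply: eq_bigr => j _.
have le_je : (j <= e)%N by rewrite -ltnS.
have E : rho e`!%:R^-1 *+ 'C(e, j) = rho j`!%:R^-1 * rho (e - j)`!%:R^-1.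
  rewrite -rmorphMn -rmorphM; congr (rho _).
  rewrite -(bin_fact le_je) !natrM -mulr_natl !invfM mulVKf //.
  by rewrite pnatr_eq0 -lt0n bin_gt0.
by rewrite mulrnAl -mulrnAr E; ring.
Qed.

Lemma dpow_zero e : dpow 0 e = (e == 0%N)%:R.
Proof.
by rewrite /dpow expr0n; case: e => [|e]; [rewrite eqxx mul1r fact0 invr1 rmorph1 | rewrite mul0r].
Qed.

(** Multinomial formula, read off as the coefficient of degree e in the product of the exponentials
    of the x i, cut below degree B; since e < B the cut does not touch it. *)
Lemma dpow_sum (I : finType) (x : I -> A) B e : (e < B)%N ->
  dpow (\sum_i x i) e =
  \sum_(m : {ffun I -> 'I_B} | (\sum_i m i == e)%N) \prod_i dpow (x i) (m i).
Proof.
move=> ltB; pose p i : {poly A} := \poly_(l < B) dpow (x i) l.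
have pE i l : (l < B)%N -> (p i)`_l = dpow (x i) l.
  by move=> ltl; rewrite coef_poly ltl.
have : forall l, (l < B)%N -> (\prod_i p i)`_l = dpow (\sum_i x i) l.
  elim/big_ind2: _ => [l _|P u Q v IHP IHQ l ltl|i _ l ltl].
  - by rewrite coef1 dpow_zero.
  - rewrite coefM dpowD; apply: eq_bigr => j _.
    by rewrite IHP ?IHQ //; have := ltn_ord j; lia.
  - exact: pE.
move=> /(_ e ltB) <-; under eq_bigr do rewrite /p poly_def.
rewrite bigA_distr_bigA coef_sum [RHS]big_mkcond.
apply: eq_bigr => m _; rewrite scaler_prod coefZ prodrXr coefXn.
by rewrite eq_sym; case: eqP => _; rewrite ?mulr1 ?mulr0.
Qed.

End DividedPowers.

Section Pairing.
Variables (K : comNzRingType).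

(* P(d/dx) G at x = 0. *)
Definition pairing D (P G : {mpoly K[D]}) : K :=
  (mlin (fun m => G^`M[m]) P).@[fun=> 0].

Lemma pairing_sumr D (I : Type) (r : seq I) (Q : pred I) P (G : I -> {mpoly K[D]}) :
  pairing P (\sum_(i <- r | Q i) G i) = \sum_(i <- r | Q i) pairing P (G i).
Proof.
rewrite /pairing -raddf_sum; congr (_.@[_]); rewrite /mlin [RHS]exchange_big /=.
by apply: eq_bigr => m _; rewrite (raddf_sum (mderivm m)) scaler_sumr.
Qed.

Lemma pairingDr D P (G H : {mpoly K[D]}) : pairing P (G + H) = pairing P G + pairing P H.
Proof.
rewrite /pairing -mevalD; congr (_.@[_]); rewrite /mlin -big_split.
by apply: eq_bigr => m _; rewrite /= mderivmD scalerDr.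
Qed.

Lemma pairingZr D P c (G : {mpoly K[D]}) : pairing P (c *: G) = c * pairing P G.
Proof.
rewrite /pairing -mevalZ; congr (_.@[_]); rewrite /mlin scaler_sumr.
by apply: eq_bigr => m _; rewrite linearZ /= !scalerA mulrC.
Qed.

Lemma pairing_suml D (I : Type) (r : seq I) (Q : pred I) (P : I -> {mpoly K[D]}) G :
  pairing (\sum_(i <- r | Q i) P i) G = \sum_(i <- r | Q i) pairing (P i) G.
Proof. by rewrite /pairing (raddf_sum (mlin _)) (raddf_sum (meval _)). Qed.

Lemma pairingZl D c (P G : {mpoly K[D]}) : pairing (c *: P) G = c * pairing P G.
Proof. by rewrite /pairing linearZ mevalZ. Qed.

Lemma pairingDl D (P Q G : {mpoly K[D]}) : pairing (P + Q) G = pairing P G + pairing Q G.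
Proof. by rewrite /pairing !raddfD. Qed.

Lemma pairing0l D (G : {mpoly K[D]}) : pairing 0 G = 0.
Proof. by rewrite -(scale0r 0) pairingZl mul0r. Qed.

Lemma pairing_sign D e (P G : {mpoly K[D]}) :
  pairing ((-1) ^+ e * P) G = (-1) ^+ e * pairing P G.
Proof.
rewrite -pairingZl; congr (pairing _ _).
by rewrite -mul_mpolyC rmorphXn rmorphN1.
Qed.

Lemma pairing_alt_sum D m e (x y : 'I_m -> {mpoly K[D]}) (z w c G : {mpoly K[D]}) (u : K) :
    (forall j, y j = x j * c) -> z = w * c ->
  \sum_(j < m) (-1) ^+ j * (u * pairing (y j) G) + (-1) ^+ e * (u * pairing z G) =
  u * pairing ((\sum_(j < m) (-1) ^+ j * x j + (-1) ^+ e * w) * c) G.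
Proof.
move=> yE ->; rewrite mulrDl pairingDl mulrDr.
congr (_ + _); last by rewrite mulrCA -pairing_sign mulrA.
rewrite [X in pairing X _]mulr_suml pairing_suml [RHS]mulr_sumr.
by apply: eq_bigr => j _; rewrite yE mulrCA -pairing_sign mulrA.
Qed.

Lemma pairing_alt_sum0 D m (x y : 'I_m -> {mpoly K[D]}) (w c G : {mpoly K[D]}) (u : K) :
    (forall j, y j = x j * c) -> \sum_(j < m) (-1) ^+ j * x j = w ->
    pairing (w * c) G = 0 ->
  \sum_(j < m) (-1) ^+ j * (u * pairing (y j) G) = 0.
Proof.
move=> yE xw w0; transitivity (u * pairing (\sum_(j < m) (-1) ^+ j * x j * c) G).
  rewrite pairing_suml [RHS]mulr_sumr.
  by apply: eq_bigr => j _; rewrite yE mulrCA -pairing_sign mulrA.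
by rewrite -mulr_suml xw w0 mulr0.
Qed.

Lemma pairing1 D (G : {mpoly K[D]}) : pairing 1 G = G.@[fun=> 0].
Proof. by rewrite /pairing -mpolyX0 mlinX mderivm0m. Qed.

Lemma pairingX D t (P G : {mpoly K[D]}) : pairing ('X_t * P) G = pairing P G^`M(t).
Proof.
pose f P : K^o := pairing ('X_t * P) G; pose g P : K^o := pairing P G^`M(t).
have fl : linear f by move=> c p q; rewrite /f mulrDr -scalerAr pairingDl pairingZl.
have gl : linear g by move=> c p q; rewrite /g pairingDl pairingZl.
pose f' : {linear {mpoly K[D]} -> K^o} := HB.pack f (GRing.isLinear.Build _ _ _ _ f fl).
pose g' : {linear {mpoly K[D]} -> K^o} := HB.pack g (GRing.isLinear.Build _ _ _ _ g gl).
apply: (linear_mpoly_eq (f := f') (g := g')) => m; rewrite /f' /g' /= /f /g.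
by rewrite -mpolyXD /pairing !mlinX mderivmDm mderivmU1m.
Qed.

(** Order of vanishing of a symbol at 0. Such an operator kills the polynomials of degree below d
    ([pairing_order]), which is what makes all sufficiently late cuts of a series equal. *)
Definition order_ge D d (P : {mpoly K[D]}) := forall m, (mdeg m < d)%N -> P@_m = 0.

Lemma order_ge0 D (P : {mpoly K[D]}) : order_ge 0 P. Proof. by []. Qed.

Lemma order_geM D d1 d2 (P Q : {mpoly K[D]}) :
  order_ge d1 P -> order_ge d2 Q -> order_ge (d1 + d2) (P * Q).
Proof.
move=> oP oQ m lt_m; rewrite mcoeffM big1 // => -[k1 k2] /= /eqP Em.
have [lt1|ge1] := ltnP (mdeg k1) d1; first by rewrite oP ?mul0r.
by rewrite oQ ?mulr0 //; have := congr1 (@mdeg D) Em; rewrite mdegD; lia.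
Qed.

Lemma order_geX D d (P : {mpoly K[D]}) e : order_ge d P -> order_ge (e * d) (P ^+ e).
Proof.
by move=> oP; elim: e => [|e IH]; rewrite ?mul0n // exprS mulSn; exact: order_geM.
Qed.

Lemma order_ge_sum D d (I : Type) (r : seq I) (Q : pred I) (P : I -> {mpoly K[D]}) :
  (forall i, Q i -> order_ge d (P i)) -> order_ge d (\sum_(i <- r | Q i) P i).
Proof. by move=> oP m lt_m; rewrite raddf_sum big1 // => i Qi; exact: oP. Qed.

Lemma order_geD D d (P Q : {mpoly K[D]}) : order_ge d P -> order_ge d Q -> order_ge d (P + Q).
Proof. by move=> oP oQ m lt_m; rewrite mcoeffD oP ?oQ ?addr0. Qed.

Lemma order_ge_var D t : order_ge 1 ('X_t : {mpoly K[D]}).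
Proof.
move=> m; rewrite ltnS leqn0 mdeg_eq0 => /eqP ->; rewrite mcoeffX.
by case: eqP => // /(congr1 (@mdeg D)); rewrite mdeg1 mdeg0.
Qed.

Lemma pairing_order D d (P G : {mpoly K[D]}) :
  order_ge d P -> (msize G <= d)%N -> pairing P G = 0.
Proof.
move=> oP leG; rewrite /pairing /mlin big1 ?meval0 // => m _.
have [lt_m|ge_m] := ltnP (mdeg m) d; first by rewrite oP // scale0r.
rewrite (_ : _^`M[m] = 0) ?scaler0 //; apply/mpolyP => m'.
rewrite mcoeff_mderivm mcoeff0 memN_msupp_eq0 ?mul0rn //.
by apply: msize_mdeg_ge; rewrite mdegD; lia.
Qed.

Lemma mderiv_comp_var D D' (g : 'I_D -> 'I_D') u (G : {mpoly K[D]}) :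
  (G \mPo [tuple 'X_(g t) | t < D])^`M(u) =
  \sum_(t | g t == u) (G^`M(t) \mPo [tuple 'X_(g t) | t < D]).
Proof.
elim/mpolyind_var: G => [|i p IH|c p q IHp IHq].
- rewrite rmorph1 -(mpolyC1 D') mderivC big1 // => t _.
  by rewrite -(mpolyC1 D) mderivC comp_mpoly0.
- rewrite rmorphM mderivM IH /= comp_mpolyXU -tnth_nth tnth_mktuple [X in _ + X]mulr_sumr.
  under [RHS]eq_bigr do rewrite mderivM rmorphD !rmorphM /= comp_mpolyXU -tnth_nth tnth_mktuple.
  rewrite big_split; congr (_ + _).
  have dX D0 (a b : 'I_D0) : ('X_a : {mpoly K[D0]})^`M(b) = (a == b)%:R.
    rewrite mderivX mnm1E; case: eqP => [->|_]; last by rewrite scale0r.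
    by rewrite scale1r (_ : (_ - _)%MM = 0%MM) ?mpolyX0 //; apply/mnmP => t; rewrite mnmBE mnm0E subnn.
  rewrite dX [RHS]big_mkcond [RHS](bigD1 i) //= dX eqxx [X in _ = _ + X]big1 ?addr0 => [|t ti].
    by case: (g i == u); rewrite ?mul0r ?rmorph1 ?rmorph1.
  by rewrite dX [i == t]eq_sym (negbTE ti) rmorph0 mul0r if_same.
- rewrite linearP mderivD mderivZ IHp IHq scaler_sumr -big_split.
  by apply: eq_bigr => t _; rewrite /= mderivD mderivZ linearP.
Qed.

(** Chain rule: identifying variables of the polynomial is dual to replacing a derivative by the sum
    of the derivatives over the fibre. *)
Lemma pairing_comp_var D D' (g : 'I_D -> 'I_D') (P : {mpoly K[D']}) (G : {mpoly K[D]}) :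
  pairing P (G \mPo [tuple 'X_(g t) | t < D]) =
  pairing (P \mPo [tuple \sum_(t | g t == u) 'X_t | u < D']) G.
Proof.
elim/mpolyind_var: P G => [|i p IH|c p q IHp IHq] G.
- rewrite rmorph1 !pairing1 comp_mpoly_meval; apply: meval_eq => t.
  by rewrite tnth_mktuple mevalXU.
- rewrite pairingX mderiv_comp_var pairing_sumr rmorphM /= comp_mpolyXU -tnth_nth tnth_mktuple.
  by rewrite mulr_suml pairing_suml; apply: eq_bigr => t _; rewrite IH pairingX.
- by rewrite linearP !pairingDl !pairingZl IHp IHq.
Qed.

Lemma order_ge_prod D (I : Type) (r : seq I) (P : I -> {mpoly K[D]}) (h : I -> nat) :
  (forall i, order_ge (h i) (P i)) -> order_ge (\sum_(i <- r) h i) (\prod_(i <- r) P i).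
Proof.
move=> oP; elim: r => [|i r IH]; first by rewrite big_nil.
by rewrite !big_cons; exact: order_geM.
Qed.

Variable d : nat.

(** The order is in fact 2, but 1 is enough: the series are cut at [msize], not at half of it. *)
Lemma order_ge_bil D (J : 'M[{mpoly K[D]}]_d) v w :
    (forall s, order_ge 1 (v s)) -> (forall s, order_ge 1 (w s)) ->
  order_ge 1 (bil J v w).
Proof.
move=> ov ow; apply: order_ge_sum => s _; apply: order_ge_sum => t _.
by rewrite mulrCA -[1%N]addn0; apply: order_geM => //; exact: order_ge0.
Qed.

Lemma order_ge_phase D (J : 'M[{mpoly K[D]}]_d) k (xi : 'I_k.+1 -> 'I_d -> {mpoly K[D]}) e m :
  (forall a s, order_ge 1 (xi a s)) -> order_ge e ((phase J xi ^+ e)@_m).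
Proof.
move=> oxi; elim: e m => [|e IH] m; first exact: order_ge0.
rewrite exprS mcoeffM; apply: order_ge_sum => -[m1 m2] _ /=.
apply: (@order_geM _ 1) => //; rewrite /phase mcoeffD mcoeffC mulrC.
apply: order_geD.
  rewrite -[1%N]add0n; apply: order_geM => //.
  by apply: order_ge_sum => a _; apply: order_ge_sum => b _; exact: order_ge_bil.
rewrite raddf_sum; apply: order_ge_sum => a _ /=; rewrite mcoeffZ mulrC mulrA -[1%N]add0n.
apply: order_geM => //; apply: order_ge_bil => // s; exact: order_ge_sum.
Qed.

Definition symvar k (i : 'I_k) (s : 'I_d) : {mpoly K[k * d]} := 'X_(mxvec_index i s).

Lemma pairing_symvar k (i : 'I_k) s (P G : {mpoly K[k * d]}) :
  pairing (symvar i s * P) G = pairing P G^`M(mxvec_index i s).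
Proof. exact: pairingX. Qed.

Lemma pairing_symvar2 k (i j : 'I_k) s t (P G : {mpoly K[k * d]}) :
  pairing (symvar i s * symvar j t * P) G =
  pairing P (G^`M(mxvec_index j t))^`M(mxvec_index i s).
Proof. by rewrite [symvar i s * _]mulrC -mulrA !pairing_symvar. Qed.

Definition slot_map m k (f : 'I_m -> 'I_k) (t : 'I_(m * d)) : 'I_(k * d) :=
  mxvec (\matrix_(i < m, s < d) mxvec_index (f i) s) 0 t.

Lemma slot_mapE m k (f : 'I_m -> 'I_k) i s :
  slot_map f (mxvec_index i s) = mxvec_index (f i) s.
Proof. by rewrite /slot_map mxvecE mxE. Qed.

Lemma mxvec_index_eq m (i j : 'I_m) (s t : 'I_d) :
  (mxvec_index i s == mxvec_index j t) = (i == j) && (s == t).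
Proof.
apply/eqP/andP => [E|[/eqP -> /eqP ->] //].
have [h hK _] := @curry_mxvec_bij m d.
have := congr1 h E; rewrite -[mxvec_index i s]/(uncurry (@mxvec_index m d) (i, s)).
by rewrite -[mxvec_index j t]/(uncurry (@mxvec_index m d) (j, t)) !hK // => -[-> ->].
Qed.

Definition slot_adj m k (f : 'I_m -> 'I_k) : (k * d).-tuple {mpoly K[m * d]} :=
  [tuple \sum_(t | slot_map f t == u) 'X_t | u < k * d].

Lemma symvar_slot_adj m k (f : 'I_m -> 'I_k) i s :
  symvar i s \mPo slot_adj f = push f (@symvar m) i s.
Proof.
rewrite comp_mpolyXU -tnth_nth tnth_mktuple big_mkcond (reindex _ (@curry_mxvec_bij m d)) -big_mkcond /=.
rewrite /push (eq_big (fun p : 'I_m * 'I_d => (f p.1 == i) && (p.2 == s))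
  (fun p => 'X_(mxvec_index p.1 p.2))) => [||[j t] _] //; last first.
  by case=> j t; rewrite /= slot_mapE mxvec_index_eq.
rewrite -(pair_big_dep (fun j => f j == i) (fun _ t => t == s)
  (fun j t => 'X_(mxvec_index j t))) /=.
by apply: eq_bigr => j _; rewrite big_pred1_eq.
Qed.

Variables (F : numFieldType) (rho : {rmorphism F -> K}) (J : 'M[K]_d).

Definition rhoC D : F -> {mpoly K[D]} := @mpolyC D K \o rho.
HB.instance Definition _ D := GRing.RMorphism.on (@rhoC D).

Definition symJ D : 'M[{mpoly K[D]}]_d := map_mx (@mpolyC D K) J.

Definition tau_symbol e : {mpoly K[d.+1 * d]} :=
  rowdet (fun r => symvar (lift ord0 r)) *
  (simplexI (@rhoC _) (phase (symJ _) (@symvar d.+1) ^+ e) * @rhoC _ e`!%:R^-1).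

Lemma order_ge_simplexI D k (p : {mpoly {mpoly K[D]}[k]}) e :
  (forall m, order_ge e (p@_m)) -> order_ge e (simplexI (@rhoC D) p).
Proof.
move=> op; rewrite /simplexI /mlin; apply: order_ge_sum => m _.
by rewrite -[e]addn0; apply: order_geM.
Qed.

Lemma order_ge_tau_symbol D k (c : {mpoly K[D]}) (xi : 'I_k.+1 -> 'I_d -> {mpoly K[D]}) x e :
  (forall a s, order_ge 1 (xi a s)) ->
  order_ge e (c * (simplexI (@rhoC D) (phase (symJ D) xi ^+ e) * @rhoC D x)).
Proof.
move=> oxi; rewrite -[e]add0n; apply: order_geM => //.
rewrite -[e]addn0; apply: order_geM => //; rewrite addn0.
by apply: order_ge_simplexI => m; exact: order_ge_phase.
Qed.

Lemma order_ge_push_symvar m k (f : 'I_m -> 'I_k) a s : order_ge 1 (push f (@symvar m) a s).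
Proof. by apply: order_ge_sum => i _; exact: order_ge_var. Qed.

(** Substituting [slot_adj] is a ring morphism that sends each symbol variable to its sum over a
    fibre, and the symbol is natural under ring morphisms. *)
Lemma tau_symbol_slot m (f : 'I_m -> 'I_d.+1) e :
  tau_symbol e \mPo slot_adj f =
  rowdet (fun r => push f (@symvar m) (lift ord0 r)) *
  (simplexI (@rhoC _) (phase (symJ _) (push f (@symvar m)) ^+ e) * @rhoC _ e`!%:R^-1).
Proof.
pose phi : {rmorphism _ -> _} := comp_mpoly (slot_adj f).
have phi_rho x : phi (@rhoC _ x) = @rhoC _ x by exact: comp_mpolyC.
have symE a s : phi (symvar a s) = push f (@symvar m) a s by exact: symvar_slot_adj.
have symJE : map_mx phi (symJ (d.+1 * d)) = symJ (m * d).
  by apply/matrixP => s t; rewrite !mxE; exact: comp_mpolyC.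
transitivity (phi (tau_symbol e)); first by [].
rewrite /tau_symbol (rmorph_symbol phi_rho) symJE.
rewrite (@eq_rowdet _ _ _ (fun r => push f (@symvar m) (lift ord0 r))) => [|i s]; last exact: symE.
rewrite (@eq_phase _ _ _ _ _ (push f (@symvar m))) => [//|a s]; exact: symE.
Qed.

End Pairing.

Section UpdateFunctions.
Variables (T : Type) (k : nat).
Implicit Types (a : 'I_k -> T) (v : T).

(** Convertible to [upd], as [insert ord0] is to [fcons], so that results stated with them apply to
    the definitions of cochains by conversion. *)
Definition fupd a (i : 'I_k) v : 'I_k -> T := fun j => if j == i then v else a j.

Lemma fupd_id a i : fupd a i (a i) =1 a.
Proof. by move=> j; rewrite /fupd; case: eqP => [->|]. Qed.

Lemma fupd_at a i v : fupd a i v i = v.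
Proof. by rewrite /fupd eqxx. Qed.

Lemma fupd_other a i v j : j != i -> fupd a i v j = a j.
Proof. by rewrite /fupd => /negbTE ->. Qed.

End UpdateFunctions.

(** * Pure tensors and the bidifferential operators of the Moyal product *)

Section Tensors.
Variables (K : comNzRingType) (d : nat).
Local Notation A := {mpoly K[d]}.

Definition slotp k (i : 'I_k) (f : A) : {mpoly K[k * d]} :=
  f \mPo [tuple 'X_(mxvec_index i s) | s < d].

Definition ptensor k (a : 'I_k -> A) : {mpoly K[k * d]} := \prod_(i < k) slotp i (a i).

Lemma mderiv_slot_other k (i j : 'I_k) s (f : A) : j != i ->
  (slotp j f)^`M(mxvec_index i s) = 0.
Proof.
move=> ji; rewrite (@mderiv_comp_var _ _ _ (mxvec_index j)) big_pred0 // => t.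
by rewrite mxvec_index_eq (negbTE ji).
Qed.

Lemma mderiv_slot k (i : 'I_k) s (f : A) :
  (slotp i f)^`M(mxvec_index i s) = slotp i f^`M(s).
Proof.
rewrite (@mderiv_comp_var _ _ _ (mxvec_index i)) (big_pred1 s) // => t.
by rewrite mxvec_index_eq eqxx.
Qed.

Lemma eq_ptensor k (a b : 'I_k -> A) : a =1 b -> ptensor a = ptensor b.
Proof. by move=> E; apply: eq_bigr => i _; rewrite E. Qed.

Lemma ptensor_upd k (a : 'I_k -> A) i v :
  ptensor (fupd a i v) = slotp i v * \prod_(j | j != i) slotp j (a j).
Proof.
rewrite /ptensor (bigD1 i) //= fupd_at; congr (_ * _).
by apply: eq_bigr => j ji; rewrite fupd_other.
Qed.

Lemma ptensor_deriv k (a : 'I_k -> A) i s :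
  (ptensor a)^`M(mxvec_index i s) = ptensor (fupd a i (a i)^`M(s)).
Proof.
rewrite -(eq_ptensor (fupd_id a i)) !ptensor_upd mderivM mderiv_slot.
rewrite (_ : (\prod_(j | j != i) slotp j (a j))^`M(_) = 0) ?mulr0 ?addr0 ?fupd_at //.
elim/big_ind: _ => [|p q p0 q0|j ji]; last exact: mderiv_slot_other.
  by rewrite -mpolyC1 mderivC.
by rewrite mderivM p0 q0 mul0r mulr0 addr0.
Qed.

Lemma ptensor_linear k (a : 'I_k -> A) i (c : K) u v :
  ptensor (fupd a i (c *: u + v)) = c *: ptensor (fupd a i u) + ptensor (fupd a i v).
Proof. by rewrite !ptensor_upd /slotp linearP mulrDl -scalerAl. Qed.

Lemma ptensor_sum k (a : 'I_k -> A) i (I : Type) (r : seq I) (P : pred I) (c : I -> K) u :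
  ptensor (fupd a i (\sum_(x <- r | P x) c x *: u x)) =
  \sum_(x <- r | P x) c x *: ptensor (fupd a i (u x)).
Proof.
rewrite ptensor_upd /slotp (raddf_sum (comp_mpoly _)) mulr_suml; apply: eq_bigr => x _ /=.
by rewrite ptensor_upd /slotp linearZ -scalerAl.
Qed.

Lemma ptensor_sum2 k (a : 'I_k -> A) i (I1 I2 : finType) (c : I1 -> I2 -> K) u :
  ptensor (fupd a i (\sum_x \sum_y c x y *: u x y)) =
  \sum_x \sum_y c x y *: ptensor (fupd a i (u x y)).
Proof.
rewrite ptensor_upd /slotp (raddf_sum (comp_mpoly _)) mulr_suml; apply: eq_bigr => x _ /=.
by rewrite -/(slotp i _) -ptensor_upd ptensor_sum.
Qed.

Lemma comp_var_comp D1 D2 D3 (g : 'I_D1 -> 'I_D2) (h : 'I_D2 -> 'I_D3)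
    (G : {mpoly K[D1]}) :
  (G \mPo [tuple 'X_(g t) | t < D1]) \mPo [tuple 'X_(h t) | t < D2] =
  G \mPo [tuple 'X_(h (g t)) | t < D1].
Proof.
elim/mpolyind_var: G => [|i p IH|c p q IHp IHq]; first by rewrite !rmorph1.
  by rewrite !rmorphM /= IH !comp_mpolyXU -!tnth_nth !tnth_mktuple comp_mpolyXU -tnth_nth tnth_mktuple.
by rewrite !linearP /= IHp IHq.
Qed.

Definition push_mul m k (f : 'I_m -> 'I_k) (a : 'I_m -> A) : 'I_k -> A :=
  fun i => \prod_(j | f j == i) a j.

Lemma ptensor_push m k (f : 'I_m -> 'I_k) (a : 'I_m -> A) :
  ptensor (push_mul f a) = ptensor a \mPo [tuple 'X_(slot_map f t) | t < m * d].
Proof.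
rewrite /ptensor rmorph_prod [RHS](partition_big f xpredT) //=.
apply: eq_bigr => i _; rewrite /slotp rmorph_prod; apply: eq_bigr => j /eqP fj /=.
rewrite comp_var_comp; congr (_ \mPo _); apply: eq_from_tnth => s.
by rewrite !tnth_mktuple slot_mapE fj.
Qed.

Lemma pairing_push m k (f : 'I_m -> 'I_k) (a : 'I_m -> A) P :
  pairing P (ptensor (push_mul f a)) = pairing (P \mPo slot_adj K d f) (ptensor a).
Proof. by rewrite ptensor_push pairing_comp_var. Qed.

Lemma pairing_ptensor_deriv k (r : seq 'I_k) (s : 'I_k -> 'I_d) (a : 'I_k -> A) P :
  uniq r ->
  pairing ((\prod_(i <- r) symvar K i (s i)) * P) (ptensor a) =
  pairing P (ptensor (fun i => if i \in r then (a i)^`M(s i) else a i)).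
Proof.
elim: r a P => [|i r IH] a P /=; first by rewrite big_nil mul1r.
case/andP=> ir ur; rewrite big_cons -mulrA pairing_symvar ptensor_deriv (IH _ _ ur).
congr (pairing P _); apply: eq_ptensor => j; rewrite inE.
case: (eqVneq j i) => [->|ji] /=; first by rewrite (negbTE ir) fupd_at.
by rewrite fupd_other.
Qed.

Variable J : 'M[K]_d.

Definition palpha k (i j : 'I_k) (G : {mpoly K[k * d]}) : {mpoly K[k * d]} :=
  \sum_s \sum_t J s t *: (G^`M(mxvec_index j t))^`M(mxvec_index i s).

Lemma palpha_is_linear k (i j : 'I_k) : linear (palpha i j).
Proof.
move=> c p q; rewrite /palpha scaler_sumr -big_split; apply: eq_bigr => s _ /=.
rewrite scaler_sumr -big_split; apply: eq_bigr => t _ /=.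
by rewrite !(mderivD, mderivZ) scalerDr !scalerA mulrC.
Qed.

HB.instance Definition _ k (i j : 'I_k) :=
  GRing.isLinear.Build K {mpoly K[k * d]} {mpoly K[k * d]} _ (palpha i j) (palpha_is_linear i j).

Local Notation om i j := (bil (symJ J _) (symvar K i) (symvar K j)).

Lemma pairing_palpha k (i j : 'I_k) P G :
  pairing (om i j * P) G = pairing P (palpha i j G).
Proof.
rewrite /bil /palpha mulr_suml pairing_suml pairing_sumr; apply: eq_bigr => s _.
rewrite mulr_suml pairing_suml pairing_sumr; apply: eq_bigr => t _.
by rewrite mxE mul_mpolyC -scalerAl pairingZl pairingZr pairing_symvar2.
Qed.

Lemma pairing_palpha_iter k (i j : 'I_k) m P G :
  pairing (om i j ^+ m * P) G = pairing P (iter m (palpha i j) G).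
Proof.
elim: m P => [|m IH] P; first by rewrite expr0 mul1r.
by rewrite exprSr -mulrA IH pairing_palpha.
Qed.

Lemma pairing_palpha_prod k (I : Type) (r : seq I) (e : I -> 'I_k * 'I_k) (m : I -> nat) P G :
  pairing (\prod_(x <- r) om (e x).1 (e x).2 ^+ m x * P) G =
  pairing P ((\big[comp/id]_(x <- r) iter (m x) (palpha (e x).1 (e x).2)) G).
Proof.
elim: r P => [|x r IH] P; first by rewrite !big_nil mul1r.
by rewrite !big_cons [X in X * P]mulrC -mulrA IH pairing_palpha_iter.
Qed.

Lemma palpha_iter_eq0 k (i j : 'I_k) m G : (msize G <= m)%N -> iter m (palpha i j) G = 0.
Proof.
pose small c (G : {mpoly K[k * d]}) := forall m, (c <= mdeg m)%N -> G@_m = 0.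
have smallD c H t : small c H -> small c.-1 H^`M(t).
  by move=> sH m' ge; rewrite mcoeff_deriv sH ?mul0rn // mdegD mdeg1; lia.
have smallA c H : small c H -> small c.-1 (palpha i j H).
  move=> sH m' ge; rewrite /palpha raddf_sum big1 // => s _; rewrite raddf_sum big1 // => t _ /=.
  rewrite mcoeffZ (smallD c.-1) ?mulr0 //; first exact: smallD.
  by apply: leq_trans ge; exact: leq_pred.
have smallI c H : small c H -> small (c - m)%N (iter m (palpha i j) H).
  by elim: m {G} => [|l IH] sH; rewrite ?subn0 // subnS; apply/smallA/IH.
move=> leG; apply/mpolyP => m'; rewrite mcoeff0; apply: (smallI (msize G)).
  by move=> l ge; apply/memN_msupp_eq0/msize_mdeg_ge.
by move: leG; rewrite -subn_eq0 => /eqP ->.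
Qed.

Lemma palpha_ptensor k (i j : 'I_k) (a : 'I_k -> A) :
  palpha i j (ptensor a) = \sum_s \sum_t J s t *:
    ptensor (fupd (fupd a j (a j)^`M(t)) i (fupd a j (a j)^`M(t) i)^`M(s)).
Proof.
by apply: eq_bigr => s _; apply: eq_bigr => t _; rewrite !ptensor_deriv.
Qed.

Definition ptmul k (G : {mpoly K[k * d]}) : A :=
  G \mPo [tuple mxvec (\matrix_(i < k, s < d) 'X_s) 0 t | t < k * d].

Lemma ptmul_is_linear k : linear (@ptmul k).
Proof. by move=> c p q; rewrite /ptmul linearP. Qed.

HB.instance Definition _ k :=
  GRing.isLinear.Build K {mpoly K[k * d]} A _ (@ptmul k) (@ptmul_is_linear k).

Lemma ptmul_ptensor k (a : 'I_k -> A) : ptmul (ptensor a) = \prod_i a i.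
Proof.
rewrite /ptmul rmorph_prod; apply: eq_bigr => i _ /=.
elim/mpolyind_var: (a i) => [|s p IH|c p q IHp IHq]; first by rewrite /slotp !rmorph1.
  rewrite /slotp in IH *; rewrite !rmorphM /= IH comp_mpolyXU -tnth_nth tnth_mktuple.
  by rewrite comp_mpolyXU -tnth_nth tnth_mktuple mxvecE mxE.
by rewrite /slotp in IHp IHq *; rewrite !linearP /= IHp IHq.
Qed.

Definition pair_fun (T : Type) (f g : T) : 'I_2 -> T := fun i => if i == ord0 then f else g.

Definition star_coef l (f g : A) : A :=
  ptmul (iter l (@palpha 2 ord0 ord_max) (ptensor (pair_fun f g))).

Lemma star_coef0 f g : star_coef 0 f g = f * g.
Proof. by rewrite /star_coef /= ptmul_ptensor !big_ord_recl big_ord0 mulr1. Qed.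

(** Peels off the operator that is applied first, so that what remains is again applied to pure
    tensors. *)
Lemma star_coefS l f g : star_coef l.+1 f g =
  \sum_s \sum_t J s t *: star_coef l f^`M(s) g^`M(t).
Proof.
have iter_linear c p q : iter l (@palpha 2 ord0 ord_max) (c *: p + q) =
    c *: iter l (@palpha 2 ord0 ord_max) p + iter l (@palpha 2 ord0 ord_max) q.
  by elim: l => //= l ->; rewrite linearP.
pose h p := ptmul (iter l (@palpha 2 ord0 ord_max) p).
have hl : linear h by move=> c p q; rewrite /h iter_linear linearP.
pose h' : {linear {mpoly K[2 * d]} -> A} := HB.pack h (GRing.isLinear.Build _ _ _ _ h hl).
rewrite /star_coef iterSr -[ptmul _]/(h' _) palpha_ptensor linear_sum.
apply: eq_bigr => s _; rewrite linear_sum; apply: eq_bigr => t _; rewrite linearZ.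
congr (_ *: ptmul (iter l _ _)); apply: eq_ptensor => i.
by case: (unliftP ord0 i) => [j ->|->]; rewrite /fupd /pair_fun //= ; case: j => [[|j] ltj].
Qed.

(** By induction on l: each factor om differentiates [a i0] and [a i1] while they are still
    separate, which is the recursion [star_coefS]. For l = 0 it is [pairing_push]. *)
Lemma pairing_star m k (f : 'I_m -> 'I_k) (a : 'I_m -> A) (i0 i1 : 'I_m) (u : 'I_k) P l :
    i0 != i1 -> (forall j, (f j == u) = (j == i0) || (j == i1)) ->
  pairing P (ptensor (fupd (push_mul f a) u (star_coef l (a i0) (a i1)))) =
  pairing (om i0 i1 ^+ l * (P \mPo slot_adj K d f)) (ptensor a).
Proof.
move=> i01 fu; elim: l a => [|l IH] a.
  rewrite expr0 mul1r -pairing_push; congr (pairing P _); apply: eq_ptensor => j.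
  rewrite /fupd; case: eqP => // ->; rewrite star_coef0 /push_mul (bigD1 i0) /= ?fu ?eqxx //.
  congr (_ * _); rewrite (big_pred1 i1) // => j' /=; rewrite fu.
  by case: (eqVneq j' i0) => [->|_] /=; rewrite ?(negbTE i01) ?andbT.
rewrite exprS -mulrA pairing_palpha palpha_ptensor star_coefS.
rewrite ptensor_sum2 !pairing_sumr; apply: eq_bigr => s _.
rewrite !pairing_sumr; apply: eq_bigr => t _; rewrite !pairingZr; congr (_ * _).
rewrite (fupd_other _ _ i01).
set b := fupd (fupd a i1 (a i1)^`M(t)) i0 (a i0)^`M(s).
have b0 : b i0 = (a i0)^`M(s) by rewrite /b fupd_at.
have b1 : b i1 = (a i1)^`M(t) by rewrite /b fupd_other ?fupd_at // eq_sym.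
rewrite -IH b0 b1; congr (pairing P _); apply: eq_ptensor => j.
rewrite /fupd; case: (eqVneq j u) => // ju; apply: eq_bigr => j' /eqP fj'.
have : ~~ ((j' == i0) || (j' == i1)) by rewrite -fu fj'.
by rewrite negb_or /b => /andP[j0 j1]; rewrite !fupd_other.
Qed.

End Tensors.

(** * The cocycle as a series of symbols *)

(** Cauchy product of two series, both cut at B, when the terms of total degree at least B
    vanish. *)
Lemma triangular_sum (V : nmodType) B (g : nat -> nat -> V) :
  (forall e l, (B <= e + l)%N -> g e l = 0) ->
  \sum_(e < B) \sum_(l < B) g e l = \sum_(t < B) \sum_(e < t.+1) g e (t - e)%N.
Proof.
move=> g0; transitivity (\sum_(e < B) \sum_(t < B | (e <= t)%N) g e (t - e)%N).
  apply: eq_bigr => e _; have le_eB : (e <= B)%N by exact: ltnW.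
  rewrite -(big_mkord xpredT (g e)) (big_cat_nat (n := (B - e)%N)) ?leq_subr //=.
  rewrite [X in _ + X]big_nat_cond [X in _ + X]big1 ?addr0; last first.
    by move=> l /andP[/andP[le _] _]; apply: g0; rewrite -leq_subLR.
  rewrite -(big_mkord (fun t => (e <= t)%N) (fun t => g e (t - e)%N)).
  rewrite [RHS](big_cat_nat (n := e)) //= [X in _ = X + _]big_nat_cond.
  rewrite [X in _ = X + _]big1 ?add0r; last by move=> l; rewrite andbC leqNgt; case: ltnP.
  rewrite -[X in _ = \sum_(X <= _ < _ | _) _]add0n big_addn [RHS]big_mkcond /=.
  by apply: eq_bigr => l _; rewrite leq_addl addnK.
rewrite (exchange_big_dep xpredT) //=; apply: eq_bigr => t _.
by rewrite (big_ord_widen_cond B xpredT (fun e => g e (t - e)%N)) //.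
Qed.

Section SimplexDividedPowers.
Variables (F : numFieldType) (S : comNzRingType) (rho : {rmorphism F -> S}) (k : nat).

Definition rhoP : F -> {mpoly S[k]} := @mpolyC k S \o rho.
HB.instance Definition _ := GRing.RMorphism.on rhoP.

Lemma simplexIMC (p : {mpoly S[k]}) c : simplexI rho (p * c%:MP) = simplexI rho p * c.
Proof. by rewrite mulrC mul_mpolyC linearZ mulrC. Qed.

Lemma simplexI_dpow (p : {mpoly S[k]}) e :
  simplexI rho (dpow rhoP p e) = simplexI rho (p ^+ e) * rho e`!%:R^-1.
Proof. by rewrite /dpow /rhoP /= simplexIMC. Qed.

Lemma simplexI_dpowD (p : {mpoly S[k]}) c t :
  simplexI rho ((p + c%:MP) ^+ t) * rho t`!%:R^-1 =
  \sum_(e < t.+1) simplexI rho (p ^+ e) * rho e`!%:R^-1 *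
     (c ^+ (t - e) * rho (t - e)`!%:R^-1).
Proof.
rewrite -simplexI_dpow dpowD raddf_sum; apply: eq_bigr => e _ /=.
rewrite {2}/dpow /rhoP /= -rmorphXn /= -rmorphM simplexIMC -/(rhoP) -/(dpow rhoP _ _).
by rewrite simplexI_dpow.
Qed.

End SimplexDividedPowers.

Section Series.
Variables (F : numFieldType) (K : comNzRingType) (rho : {rmorphism F -> K}).
Variables (d : nat) (J : 'M[K]_d) (eps : K).
Hypothesis Jdiag : forall s, J s s = 0.
Hypothesis Jskew : forall s t, J t s = - J s t.
Local Notation A := {mpoly K[d]}.
Local Notation sJ := (symJ J _).
Local Notation rC := (rhoC rho _).
Local Notation om i j := (bil sJ (symvar K i) (symvar K j)).

Lemma symJ_diag D s : symJ J D s s = 0.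
Proof. by rewrite mxE Jdiag mpolyC0. Qed.

Lemma symJ_skew D s t : symJ J D t s = - symJ J D s t.
Proof. by rewrite !mxE Jskew mpolyCN. Qed.

Definition tser B (a : 'I_d.+1 -> A) : K :=
  \sum_(e < B) eps ^+ e * pairing (tau_symbol rho J e) (ptensor a).

(* tau and star are defined by exponential series cut at the degree of their
   argument; bnd and bnds are bounds past which the cut has no effect. *)
Variables (tau : ('I_d.+1 -> A) -> K) (bnd : ('I_d.+1 -> A) -> nat).
Hypothesis tauE : forall a B, (bnd a <= B)%N -> tau a = tser B a.
Variables (star : A -> A -> A) (bnds : A -> A -> nat).
Hypothesis starE : forall f g B, (bnds f g <= B)%N ->
  star f g = \sum_(l < B) (rho l`!%:R^-1 * eps ^+ l) *: star_coef J l f g.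

Lemma eq_tau a b : a =1 b -> tau a = tau b.
Proof.
move=> E; rewrite (tauE (leq_maxl (bnd a) (bnd b))) (tauE (leq_maxr (bnd a) (bnd b))).
by apply: eq_bigr => e _; rewrite (eq_ptensor E).
Qed.

(** The three values may be cut at different degrees; past a common bound B all of them are given by
    [tser] with the same B, which is linear. *)
Lemma tau_linear a i c u v :
  tau (fupd a i (c *: u + v)) = c * tau (fupd a i u) + tau (fupd a i v).
Proof.
set a1 := fupd a i (c *: u + v); set a2 := fupd a i u; set a3 := fupd a i v.
pose B := maxn (bnd a1) (maxn (bnd a2) (bnd a3)).
rewrite !(@tauE _ B) ?leq_max ?leqnn ?orbT // /tser mulr_sumr -big_split /=.
apply: eq_bigr => e _; rewrite /a1 ptensor_linear pairingDr pairingZr mulrDr.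
by rewrite mulrCA.
Qed.

Lemma star_coef_linearl l c u v g :
  star_coef J l (c *: u + v) g = c *: star_coef J l u g + star_coef J l v g.
Proof.
elim: l u v g => [|l IH] u v g; first by rewrite !star_coef0 mulrDl -scalerAl.
rewrite !star_coefS scaler_sumr -big_split; apply: eq_bigr => s _ /=.
rewrite scaler_sumr -big_split; apply: eq_bigr => t _ /=.
by rewrite mderivD mderivZ IH scalerDr !scalerA mulrC.
Qed.

Lemma star_coef_linearr l c u v g :
  star_coef J l g (c *: u + v) = c *: star_coef J l g u + star_coef J l g v.
Proof.
elim: l u v g => [|l IH] u v g; first by rewrite !star_coef0 mulrDr -scalerAr.
rewrite !star_coefS scaler_sumr -big_split; apply: eq_bigr => s _ /=.
rewrite scaler_sumr -big_split; apply: eq_bigr => t _ /=.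
by rewrite mderivD mderivZ IH scalerDr !scalerA mulrC.
Qed.

Lemma star_bilinearl c u v g : star (c *: u + v) g = c *: star u g + star v g.
Proof.
pose B := maxn (bnds (c *: u + v) g) (maxn (bnds u g) (bnds v g)).
rewrite !(@starE _ _ B) ?leq_max ?leqnn ?orbT // scaler_sumr -big_split /=.
apply: eq_bigr => l _; move: (rho _ * _) => x; rewrite [c *: (_ *: _)]scalerA [c * _]mulrC -scalerA -scalerDr.
congr (_ *: _).
exact: star_coef_linearl.
Qed.

Lemma star_bilinearr c u v g : star g (c *: u + v) = c *: star g u + star g v.
Proof.
pose B := maxn (bnds g (c *: u + v)) (maxn (bnds g u) (bnds g v)).
rewrite !(@starE _ _ B) ?leq_max ?leqnn ?orbT // scaler_sumr -big_split /=.
apply: eq_bigr => l _; move: (rho _ * _) => x; rewrite [c *: (_ *: _)]scalerA [c * _]mulrC -scalerA -scalerDr.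
congr (_ *: _).
exact: star_coef_linearr.
Qed.

(** Symbols commute, so the exponential of the product and that of [tau] multiply to the exponential
    of the sum of the exponents. Terms with e + l >= B have too high an order to act on the
    tensor. *)
Lemma tau_face m (f : 'I_m -> 'I_d.+1) (a : 'I_m -> A) (i0 i1 : 'I_m) (u : 'I_d.+1) B :
    i0 != i1 -> (forall j, (f j == u) = (j == i0) || (j == i1)) ->
    (bnd (fupd (push_mul f a) u (star (a i0) (a i1))) <= B)%N ->
    (bnds (a i0) (a i1) <= B)%N -> (msize (ptensor a) <= B)%N ->
  tau (fupd (push_mul f a) u (star (a i0) (a i1))) =
  \sum_(t < B) eps ^+ t * pairing
     (rowdet (fun r => push f (@symvar K d m) (lift ord0 r)) *
      (simplexI rC ((phase sJ (push f (@symvar K d m)) + (om i0 i1)%:MP) ^+ t) * rC t`!%:R^-1))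
     (ptensor a).
Proof.
move=> i01 fu B1 B2 B3; rewrite (tauE B1) (starE B2) /tser.
pose g e l := eps ^+ (e + l) * (rho l`!%:R^-1 *
  pairing (om i0 i1 ^+ l * (tau_symbol rho J e \mPo slot_adj K d f)) (ptensor a)).
transitivity (\sum_(e < B) \sum_(l < B) g e l).
  apply: eq_bigr => e _; rewrite ptensor_sum pairing_sumr mulr_sumr.
  apply: eq_bigr => l _; rewrite pairingZr pairing_star // /g exprD.
  by ring.
rewrite triangular_sum => [|e l leB]; last first.
  rewrite /g (@pairing_order _ _ (l + e)) ?mulr0 //; last by rewrite addnC (leq_trans B3).
  apply: order_geM.
    have o1 : order_ge 1 (om i0 i1) by apply: order_ge_bil => s; exact: order_ge_var.
    by have := @order_geX _ _ _ _ l o1; rewrite muln1.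
  rewrite tau_symbol_slot; apply: order_ge_tau_symbol => b s; exact: order_ge_push_symvar.
apply: eq_bigr => t _; under eq_bigr => e _.
  rewrite /g (subnKC (_ : (e <= t)%N)); last by rewrite -ltnS.
  over.
rewrite -mulr_sumr; congr (_ * _).
rewrite simplexI_dpowD mulr_sumr pairing_suml.
apply: eq_bigr => e _; rewrite -pairingZl -mul_mpolyC; congr (pairing _ _).
by rewrite tau_symbol_slot; ring.
Qed.

Lemma merge_ord_fiber (j : 'I_d.+1) (b : 'I_d.+2) :
  (merge_ord j b == j) = (b == widen_ord (leqnSn _) j) || (b == lift ord0 j).
Proof.
have jd : (j <= d)%N by rewrite -ltnS.
by rewrite -!val_eqE /= merge_ordE // /unbump /bump; case: b => b /=; lia.
Qed.

Lemma wrap_ord_fiber (b : 'I_d.+2) :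
  (@wrap_ord d b == ord0) = (b == ord_max) || (b == ord0).
Proof.
rewrite /wrap_ord; case: (eqVneq b ord_max) => [->|bm] //=.
have ltb : (b < d.+1)%N by move: bm (ltn_ord b); rewrite -val_eqE /=; lia.
by rewrite -!val_eqE /= inordK.
Qed.

Theorem tau_hochschild (a : 'I_d.+2 -> A) :
  \sum_(j < d.+1) (-1) ^+ j *
    tau (fupd (push_mul (merge_ord j) a) j (star (a (widen_ord (leqnSn _) j)) (a (lift ord0 j))))
  + (-1) ^+ d.+1 *
    tau (fupd (push_mul (@wrap_ord d) a) ord0 (star (a ord_max) (a ord0))) = 0.
Proof.
(* One bound past all the cuts: those of [tau] on every face, those of the products, and the degree
   of the tensor. *)
pose B := (\max_(j < d.+1) maxn (bnd (fupd (push_mul (merge_ord j) a) j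
       (star (a (widen_ord (leqnSn _) j)) (a (lift ord0 j)))))
     (bnds (a (widen_ord (leqnSn _) j)) (a (lift ord0 j)))
   + (bnd (fupd (push_mul (@wrap_ord d) a) ord0 (star (a ord_max) (a ord0))) +
      bnds (a ord_max) (a ord0) + msize (ptensor a)))%N.
pose X t := \sum_(j < d.+1) (-1) ^+ j *
     (rowdet (fun r => push (merge_ord j) (@symvar K d d.+2) (lift ord0 r)) *
      simplexI rC ((phase sJ (push (merge_ord j) (@symvar K d d.+2)) +
         (om (widen_ord (leqnSn _) j) (lift ord0 j))%:MP) ^+ t))
  + (-1) ^+ d.+1 *
     (rowdet (fun r => push (@wrap_ord d) (@symvar K d d.+2) (lift ord0 r)) *
      simplexI rC ((phase sJ (push (@wrap_ord d) (@symvar K d d.+2)) +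
         (om ord_max ord0)%:MP) ^+ t)).
have Em (j : 'I_d.+1) := @tau_face _ (merge_ord j) a (widen_ord (leqnSn _) j) (lift ord0 j) j B.
have Ew := @tau_face _ (@wrap_ord d) a ord_max ord0 ord0 B.
transitivity (\sum_(t < B) eps ^+ t * pairing (X t * rC t`!%:R^-1) (ptensor a)); last first.
  rewrite big1 // => t _; rewrite /X (hochschild_identity _ (@symJ_diag _) (@symJ_skew _)).
  by rewrite mul0r pairing0l mulr0.
rewrite Ew //; first last.
- by rewrite /B; lia.
- by rewrite /B; lia.
- by rewrite /B; lia.
- exact: wrap_ord_fiber.
under eq_bigr => j _.
  rewrite Em; first last.
  - by rewrite /B; lia.
  - rewrite (leq_trans (leq_maxr (bnd (fupd (push_mul (merge_ord j) a) j
       (star (a (widen_ord (leqnSn _) j)) (a (lift ord0 j))))) _)) // /B.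
    by apply: leq_trans (leq_addr _ _); exact: (leq_bigmax j).
  - rewrite (leq_trans (leq_maxl _ (bnds (a (widen_ord (leqnSn _) j)) (a (lift ord0 j))))) // /B.
    by apply: leq_trans (leq_addr _ _); exact: (leq_bigmax j).
  - exact: merge_ord_fiber.
  - by rewrite -val_eqE /= /bump; lia.
  rewrite mulr_sumr.
  over.
rewrite exchange_big mulr_sumr -big_split; apply: eq_bigr => t _ /=.
rewrite /X; apply: pairing_alt_sum => [j|]; exact: mulrA.
Qed.

Lemma tau_push m (f : 'I_m -> 'I_d.+1) (a : 'I_m -> A) B : (bnd (push_mul f a) <= B)%N ->
  tau (push_mul f a) = \sum_(e < B) eps ^+ e * pairing
     (rowdet (fun r => push f (@symvar K d m) (lift ord0 r)) *
      (simplexI rC (phase sJ (push f (@symvar K d m)) ^+ e) * rC e`!%:R^-1))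
     (ptensor a).
Proof.
move=> le_B; rewrite (tauE le_B); apply: eq_bigr => e _.
by rewrite pairing_push tau_symbol_slot.
Qed.

End Series.

(** * Insertion of a quadratic polynomial into the cocycle *)

Section InsertionCoefficient.
Variables (F : numFieldType) (S : comNzRingType) (rho : {rmorphism F -> S}) (k : nat).
Variables (J : 'M[S]_k.+1) (x : 'I_k.+1 -> 'I_k.+1 -> S).

Definition insertion_coef (s : 'I_k.+1) e : S :=
  (-1) ^+ s * rowdet (fun r t => x (lift ord0 r) (lift s t)) *
    \sum_j simplexI rho ((phase J x \mPo degeneracy S j) ^+ e).

Lemma phase_degeneracy j : phase J x \mPo degeneracy S j = (quad J x)%:MP +
  \sum_(a < k.+1) (2 * bil J (x a) (vtotal x)) *: vertex S k.+1 (lift (lift ord0 j) a).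
Proof.
rewrite /phase comp_mpolyD comp_mpolyC comp_mpoly_sum; congr (_ + _).
by apply: eq_bigr => a _; rewrite comp_mpolyZ vertex_degeneracy.
Qed.

End InsertionCoefficient.

Lemma eq_insertion_coef (F : numFieldType) (S : comNzRingType) (rho : {rmorphism F -> S}) k
    (J : 'M[S]_k.+1) (x x' : 'I_k.+1 -> 'I_k.+1 -> S) s e :
  (forall a, x a =1 x' a) -> insertion_coef rho J x s e = insertion_coef rho J x' s e.
Proof.
move=> E; rewrite /insertion_coef (eq_phase J E); congr (_ * _ * _).
by apply: eq_rowdet => r t; rewrite E.
Qed.

Lemma rmorph_insertion_coef (F : numFieldType) (S S' : comNzRingType)
    (rho : {rmorphism F -> S}) (rho' : {rmorphism F -> S'}) (phi : {rmorphism S -> S'}) k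
    (J : 'M[S]_k.+1) (x : 'I_k.+1 -> 'I_k.+1 -> S) s e :
  (forall c, phi (rho c) = rho' c) ->
  phi (insertion_coef rho J x s e) =
  insertion_coef rho' (map_mx phi J) (fun a => phi \o x a) s e.
Proof.
move=> phi_rho; rewrite /insertion_coef !rmorphM rmorphXn rmorphN1 rmorph_rowdet; congr (_ * _).
rewrite rmorph_sum; apply: eq_bigr => j _.
rewrite (rmorph_simplexI phi_rho) rmorphXn; congr (simplexI _ (_ ^+ _)).
rewrite !phase_degeneracy.
have EC c : map_mpoly phi c%:MP_[k.+1] = (phi c)%:MP by exact: map_mpolyC.
rewrite rmorphD /= EC rmorph_quad (rmorph_sum (map_mpoly phi)); congr (_ + _).
apply: eq_bigr => a _ /=.
by rewrite map_mpolyZ map_mpoly_vertex rmorphM rmorph_nat rmorph_bil_vtotal.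
Qed.

Section FreeSlot.
Variables (K : comNzRingType) (d k : nat).

(** An operator that does not differentiate the factor 0 leaves it to be evaluated at 0. This is how
    first derivatives of a quadratic at 0 appear. *)
Lemma pairing_free_slot (P : {mpoly K[k * d]}) (b : 'I_k.+1 -> {mpoly K[d]}) :
  pairing (P \mPo [tuple 'X_(slot_map (lift ord0) t) | t < k * d]) (ptensor b) =
  (b ord0).@[fun=> 0] * pairing P (ptensor (fun i => b (lift ord0 i))).
Proof.
elim/mpolyind_var: P b => [|t p IH|c p q IHp IHq] b.
- rewrite rmorph1 !pairing1 /ptensor big_ord_recl rmorphM /=; congr (_ * _).
    rewrite /slotp comp_mpoly_meval; apply: meval_eq => s.
    by rewrite tnth_mktuple mevalXU.
  rewrite !rmorph_prod; apply: eq_bigr => i _ /=; rewrite /slotp !comp_mpoly_meval.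
  by apply: meval_eq => s; rewrite !tnth_mktuple !mevalXU.
- rewrite rmorphM /= comp_mpolyXU -tnth_nth tnth_mktuple.
  case/mxvec_indexP: t => i s; rewrite slot_mapE !pairing_symvar !ptensor_deriv IH.
  rewrite fupd_other ?neq_lift //; congr (_ * pairing _ _).
- by rewrite linearP !pairingDl !pairingZl IHp IHq mulrDr mulrCA.
Qed.

Lemma ptensor_zero m (b : 'I_m -> {mpoly K[d]}) i : b i = 0 -> ptensor b = 0.
Proof. by move=> b0; rewrite -(eq_ptensor (fupd_id b i)) ptensor_upd b0 /slotp comp_mpoly0 mul0r. Qed.

Lemma pairing0r D (P : {mpoly K[D]}) : pairing P 0 = 0.
Proof. by rewrite -(scale0r 0) pairingZr mul0r. Qed.

Lemma pairing_slot_cubic m (b : 'I_m -> {mpoly K[d]}) i s t u P :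
  (forall s t u, (((b i)^`M(s))^`M(t))^`M(u) = 0) ->
  pairing (symvar K i s * symvar K i t * symvar K i u * P) (ptensor b) = 0.
Proof.
move=> b3; rewrite -!mulrA !pairing_symvar !ptensor_deriv (@ptensor_zero _ _ i) ?pairing0r //.
by rewrite !fupd_at.
Qed.

End FreeSlot.

Lemma insertion_coef_free (F : numFieldType) (K : comNzRingType) (rho : {rmorphism F -> K}) k
    (J : 'M[K]_k.+1) s e :
  insertion_coef (rhoC rho _) (symJ J _) (fun i => symvar K (lift ord0 i : 'I_k.+2)) s e =
  insertion_coef (rhoC rho _) (symJ J _) (@symvar K k.+1 k.+1) s e
    \mPo [tuple 'X_(slot_map (lift ord0 : 'I_k.+1 -> 'I_k.+2) t) | t < k.+1 * k.+1].
Proof.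
set lq := [tuple _ | _ < _].
pose phi : {rmorphism _ -> _} := comp_mpoly lq.
have phi_rho x : phi (rhoC rho _ x) = rhoC rho _ x by exact: comp_mpolyC.
have symJE : map_mx phi (symJ J _) = symJ J _.
  by apply/matrixP => a b; rewrite !mxE; exact: comp_mpolyC.
transitivity (phi (insertion_coef (rhoC rho _) (symJ J _) (@symvar K k.+1 k.+1) s e)); last by [].
rewrite (rmorph_insertion_coef _ _ _ _ phi_rho) symJE; apply: eq_insertion_coef => i t.
have symE : symvar K i t \mPo lq = symvar K (lift ord0 i) t.
  by rewrite comp_mpolyXU -tnth_nth tnth_mktuple slot_mapE.
exact: esym symE.
Qed.

Section InsertQuadratic.
Variables (F : numFieldType) (K : comNzRingType) (rho : {rmorphism F -> K}).
Variable k : nat.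
Local Notation d := k.+1.
Variables (J : 'M[K]_d) (eps : K).
Hypothesis Jdiag : forall s, J s s = 0.
Hypothesis Jskew : forall s t, J t s = - J s t.
Local Notation A := {mpoly K[d]}.
Local Notation sJ := (symJ J _).
Local Notation rC := (rhoC rho _).
Variables (tau : ('I_d.+1 -> A) -> K) (bnd : ('I_d.+1 -> A) -> nat).
Hypothesis tauE : forall a B, (bnd a <= B)%N -> tau a = tser rho J eps B a.

(* Moves the tensor factor 0 to the position p. *)
Definition unrotate (p : 'I_d.+1) : 'I_d.+1 -> 'I_d.+1 :=
  fun j => if unlift ord0 j is Some c then lift p c else p.

Lemma unrotate_eq p i j :
  (unrotate p j == i) = (j == if unlift p i is Some c then lift ord0 c else ord0).
Proof.
rewrite /unrotate; case: (unliftP ord0 j) => [c ->|->]; case: (unliftP p i) => [c' ->|->].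
- by rewrite !(inj_eq (@lift_inj _ _)).
- by rewrite eq_sym (negbTE (neq_lift _ _)) eq_sym (negbTE (neq_lift _ _)).
- by rewrite (negbTE (neq_lift _ _)) (negbTE (neq_lift _ _)).
- by rewrite !eqxx.
Qed.

Lemma push_mul_unrotate p (b : 'I_d.+1 -> A) :
  push_mul (unrotate p) b =1 insert p (b ord0) (fun i => b (lift ord0 i)).
Proof.
move=> i; rewrite /push_mul (eq_bigl _ _ (unrotate_eq p i)) big_pred1_eq /insert.
by case: unlift.
Qed.

Lemma push_unrotate p D (xi : 'I_d.+1 -> 'I_d -> {mpoly K[D]}) i :
  push (unrotate p) xi i =1 insert p (xi ord0) (fun i => xi (lift ord0 i)) i.
Proof.
move=> s; rewrite /push (eq_bigl _ _ (unrotate_eq p i)) big_pred1_eq /insert.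
by case: unlift.
Qed.

(** The terms have q in different slots. [unrotate] brings all of them to the one tensor with q in
    front, and the alternating sum becomes a sum of symbols. *)
Theorem tau_insert_quadratic (q : A) (x : 'I_d -> A) :
    (forall s, (q^`M(s)).@[fun=> 0] = 0) ->
    (forall s t u, ((q^`M(s))^`M(t))^`M(u) = 0) ->
  \sum_(j < d) (-1) ^+ j * tau (insert (lift ord0 j) q x) = 0.
Proof.
move=> q1 q3; pose b := insert ord0 q x.
have b0 : b ord0 = q by rewrite /b insert_at.
pose B := (\max_(j < d) bnd (push_mul (unrotate (lift ord0 j)) b))%N.
have E (j : 'I_d) : tau (insert (lift ord0 j) q x) = \sum_(e < B) eps ^+ e * pairing
     (rowdet (fun r => insert (lift ord0 j) (symvar K ord0) (fun i => symvar K (lift ord0 i)) (lift ord0 r)) *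
      (simplexI rC (phase sJ (insert (lift ord0 j) (symvar K ord0) (fun i => symvar K (lift ord0 i))) ^+ e)
        * rC e`!%:R^-1)) (ptensor b).
  have bE : insert (lift ord0 j) q x =1 push_mul (unrotate (lift ord0 j)) b.
    move=> i; rewrite push_mul_unrotate b0 /insert; case: unlift => // c.
    by rewrite /b insert_lift.
  have leB : (bnd (push_mul (unrotate (lift ord0 j)) b) <= B)%N by exact: (leq_bigmax j).
  rewrite (eq_tau tauE bE) (tau_push tauE leB).
  apply: eq_bigr => e _.
  apply: (f_equal (fun z => eps ^+ e * pairing z (ptensor b))).
  exact: (eq_symbol rC sJ e _ (push_unrotate (lift ord0 j) (@symvar K d d.+1))).
under eq_bigr => j _ do rewrite E mulr_sumr.
rewrite exchange_big big1 // => e _ /=.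
have [r rE] := insertion_identity rC (@symJ_diag _ _ _ Jdiag _) (@symJ_skew _ _ _ Jskew _)
   (fun i => symvar K (lift ord0 i)) (symvar K (ord0 : 'I_d.+1)) e.
apply: (pairing_alt_sum0 _ _ rE) => [j|]; first exact: mulrA.
rewrite mulrC mul_mpolyC pairingZl pairingDl !pairing_suml.
(* The part of degree 1 in the symbol of q evaluates a first derivative of q at 0; the remaining
   part contains three derivatives of q. *)
rewrite [X in _ * (X + _)]big1 => [|s _]; last first.
  rewrite -/(insertion_coef rC sJ (fun i => symvar K (lift ord0 i)) s e).
  rewrite insertion_coef_free pairing_symvar ptensor_deriv pairing_free_slot.
  by rewrite fupd_at b0 q1 mul0r.
rewrite add0r big1 ?mulr0 // => s _; rewrite pairing_suml big1 // => t _.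
rewrite pairing_suml big1 // => u _; apply: pairing_slot_cubic.
by rewrite b0.
Qed.

End InsertQuadratic.

(** * Antisymmetrization of Hochschild cocycles *)

Section PermutationSums.
Variable V : nmodType.

Lemma lift_perm_bij m (i : 'I_m.+1) :
  bijective (fun p : 'I_m.+1 * 'S_m => lift_perm i p.1 p.2).
Proof.
apply: inj_card_bij => [[j t] [j' t'] /= E|].
  have jj' : j = j' by rewrite -(lift_perm_id i j t) E lift_perm_id.
  rewrite -jj' in E *; congr (_, _); apply/permP => u; apply: (@lift_inj _ j).
  by rewrite -(lift_perm_lift i) E lift_perm_lift.
by rewrite card_prod card_ord !card_Sn factS.
Qed.

Lemma sum_lift_perm m (i : 'I_m.+1) (f : 'S_m.+1 -> V) :
  \sum_s f s = \sum_j \sum_t f (lift_perm i j t).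
Proof.
by rewrite (reindex _ (onW_bij _ (lift_perm_bij i))) /= -(pair_big xpredT xpredT (fun j t => f (lift_perm i j t))).
Qed.

(** Permutations sorted by the preimage of j, whereas [sum_lift_perm] sorts them by the image of
    i. *)
Lemma sum_lift_perm_pos m (j : 'I_m.+1) (f : 'S_m.+1 -> V) :
  \sum_s f s = \sum_i \sum_t f (lift_perm i j t).
Proof.
rewrite (reindex_inj invg_inj) (sum_lift_perm j); apply: eq_bigr => i _.
rewrite (reindex_inj invg_inj); apply: eq_bigr => t _.
by rewrite lift_permV invgK.
Qed.

End PermutationSums.

Lemma sign_lift_perm (S : pzRingType) m i j (t : 'S_m) :
  (-1) ^+ (lift_perm i j t) = (-1) ^+ (i + j) * (-1) ^+ t :> S.
Proof. by rewrite odd_lift_perm !signr_addb !signr_odd exprD. Qed.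

Section Contraction.
Variables (T : Type) (mul : T -> T -> T) (k : nat).

Definition contr (j : 'I_k.+1) (x : 'I_k.+2 -> T) : 'I_k.+1 -> T :=
  fupd (fun u => x (lift (lift ord0 j) u)) j (mul (x (widen_ord (leqnSn _) j)) (x (lift ord0 j))).

Definition wrap_contr (x : 'I_k.+2 -> T) : 'I_k.+1 -> T :=
  fupd (fun u => x (widen_ord (leqnSn _) u)) ord0 (mul (x ord_max) (x ord0)).

End Contraction.

Section Antisymmetrization.
Variables (K : comNzRingType) (g : lmodType K) (gm : g -> g -> g) (lam : K).
Variables (k' : nat).
Local Notation k := k'.+1.
Variable phi : ('I_k.+1 -> g) -> K.
Hypothesis phi_linear : forall x i c u v,
  phi (fupd x i (c *: u + v)) = c * phi (fupd x i u) + phi (fupd x i v).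
Hypothesis phi_hochschild : forall x : 'I_k.+2 -> g,
  \sum_(j < k.+1) (-1) ^+ j * phi (contr gm j x) + (-1) ^+ k.+1 * phi (wrap_contr gm x) = 0.

Definition lie_br (x y : g) : g := lam *: (gm x y - gm y x).

Definition antisym (x : 'I_k -> g) (y : g) : K :=
  \sum_(s : 'S_k) (-1) ^+ s * phi (insert ord0 y (x \o s)).

Lemma insert_fupd (T : Type) m (p : 'I_m.+1) (v w : T) x : fupd (insert p v x) p w = insert p w x.
Proof.
apply/funext => i; rewrite /fupd /insert.
by case: (unliftP p i) => [j ->|->]; rewrite ?eqxx // eq_sym (negbTE (neq_lift _ _)).
Qed.

Lemma phi_insert_linear p x c u v :
  phi (insert p (c *: u + v) x) = c * phi (insert p u x) + phi (insert p v x).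
Proof. by have := phi_linear (insert p u x) p c u v; rewrite !insert_fupd. Qed.

Lemma antisym_linear x c y z : antisym x (c *: y + z) = c * antisym x y + antisym x z.
Proof.
rewrite /antisym mulr_sumr -big_split; apply: eq_bigr => s _ /=.
by rewrite phi_insert_linear mulrDr mulrCA.
Qed.

Lemma fupd_perm (T : Type) m (x : 'I_m -> T) i v (s : 'S_m) :
  fupd x i v \o s = fupd (x \o s) ((s^-1)%g i) v.
Proof.
by apply/funext => j; rewrite /fupd /= (can2_eq (permK s) (permKV s)).
Qed.

Lemma insert_fupd_lift (T : Type) m (p : 'I_m.+1) (v w : T) x i :
  insert p v (fupd x i w) = fupd (insert p v x) (lift p i) w.
Proof.
apply/funext => j; rewrite /fupd /insert.
case: (unliftP p j) => [u ->|->]; first by rewrite (inj_eq (@lift_inj _ p)).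
by rewrite (negbTE (neq_lift _ _)).
Qed.

Lemma antisym_arg_linear x i c u v y :
  antisym (fupd x i (c *: u + v)) y = c * antisym (fupd x i u) y + antisym (fupd x i v) y.
Proof.
rewrite /antisym mulr_sumr -big_split; apply: eq_bigr => s _ /=.
by rewrite !fupd_perm !insert_fupd_lift phi_linear mulrDr mulrCA.
Qed.

Lemma antisym_perm x y (s : 'S_k) : antisym (x \o s) y = (-1) ^+ s * antisym x y.
Proof.
rewrite /antisym mulr_sumr [RHS](reindex_inj (mulIg s)); apply: eq_bigr => t _ /=.
rewrite mulrA -signr_addb odd_permM addbCA addbb addbF.
by congr (_ * phi (insert _ _ _)); apply/funext => i; rewrite /= permM.
Qed.

(** [antisym_perm] for a transposition gives only that twice the value is 0, and 2 may be a zero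
    divisor in K: the permutations are paired off by the transposition instead. *)
Lemma antisym_alternating x y i j : i != j -> x i = x j -> antisym x y = 0.
Proof.
move=> ij xij; pose t := tperm i j.
have oddMt (s : 'S_k) : (s * t)%g = ~~ s :> bool by rewrite odd_permM odd_tperm ij addbT.
rewrite /antisym (bigID (@odd_perm _)) /=; apply: canLR (subrK _) _; rewrite add0r -sumrN.
rewrite (reindex_inj (mulIg t)); apply: eq_big => //= s; rewrite oddMt => /negPf ->.
rewrite mulN1r mul1r; congr (- phi (insert _ _ _)); apply/funext => u /=.
by rewrite permM /t; case: tpermP => // ->.
Qed.

Lemma insert_lift_perm (T : Type) m (i j : 'I_m.+1) (v : T) x (t : 'S_m) :
  insert j v x \o lift_perm i j t = insert i v (x \o t).
Proof.
apply/funext => u; rewrite /insert /=.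
by case: (unliftP i u) => [w ->|->]; rewrite ?lift_perm_lift ?liftK ?lift_perm_id ?unlift_none.
Qed.

Lemma insert_liftE (T : Type) m (p : 'I_m.+1) (x : 'I_m.+1 -> T) :
  insert p (x p) (fun i => x (lift p i)) = x.
Proof. by apply/funext => j; rewrite /insert; case: unliftP => [i ->|->]. Qed.

Lemma antisym_insert (j : 'I_k) v w y :
  antisym (insert j v w) y = (-1) ^+ j * antisym (insert ord0 v w) y.
Proof.
have -> : insert j v w = insert ord0 v w \o lift_perm j ord0 1.
  by rewrite insert_lift_perm; congr insert; apply/funext => i; rewrite /= perm1.
by rewrite antisym_perm sign_lift_perm odd_perm1 addn0 mulr1.
Qed.

Lemma antisymE j v w y : antisym (insert j v w) y =
  \sum_(i < k) \sum_(t : 'S_k') (-1) ^+ (i + j) * (-1) ^+ t *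
     phi (insert ord0 y (insert i v (w \o t))).
Proof.
rewrite /antisym (sum_lift_perm_pos j); apply: eq_bigr => i _; apply: eq_bigr => t _.
by rewrite sign_lift_perm insert_lift_perm.
Qed.

(** Permutations are grouped by the position that v receives, for a fixed order of the other
    arguments; each group is an alternating insertion sum. *)
Lemma antisym_insert0 j v w y :
  (forall w', \sum_(i < k) (-1) ^+ i * phi (insert ord0 y (insert i v w')) = 0) ->
  antisym (insert j v w) y = 0.
Proof.
move=> v0; rewrite antisymE exchange_big big1 // => t _ /=.
transitivity ((-1) ^+ j * (-1) ^+ t *
   \sum_(i < k) (-1) ^+ i * phi (insert ord0 y (insert i v (w \o t)))).
  rewrite mulr_sumr; apply: eq_bigr => i _; rewrite exprD.
  by move: ((-1) ^+ i) ((-1) ^+ j) ((-1) ^+ t) (phi _) => a b c z; ring.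
by rewrite v0 mulr0.
Qed.

Lemma contr0 y (w : 'I_k.+1 -> g) :
  contr gm ord0 (insert ord0 y w) = insert ord0 (gm y (w ord0)) (fun i => w (lift ord0 i)).
Proof.
apply/funext => u; case: (unliftP ord0 u) => [v ->|->].
  rewrite insert_lift /contr fupd_other 1?eq_sym ?neq_lift //.
  have -> : lift (lift ord0 ord0) (lift ord0 v) = lift ord0 (lift ord0 v) :> 'I_k.+2.
    by apply: val_inj; rewrite /= /bump; lia.
  by rewrite insert_lift.
rewrite insert_at /contr fupd_at insert_lift; congr gm.
have -> : widen_ord (leqnSn k.+1) ord0 = ord0 by exact: val_inj.
by rewrite insert_at.
Qed.

Lemma contrS y (w : 'I_k.+1 -> g) (j : 'I_k) :
  contr gm (lift ord0 j) (insert ord0 y w) = insert ord0 y (contr gm j w).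
Proof.
apply/funext => u; case: (unliftP ord0 u) => [v ->|->]; rewrite ?insert_lift ?insert_at.
  have [->|vj] := eqVneq v j.
    rewrite /contr !fupd_at insert_lift.
    have -> : widen_ord (leqnSn k.+1) (lift ord0 j) = lift ord0 (widen_ord (leqnSn _) j).
      by apply: val_inj; rewrite /= /bump; lia.
    by rewrite insert_lift.
  rewrite /contr !fupd_other ?(inj_eq (@lift_inj _ _)) //.
  have -> : lift (lift ord0 (lift ord0 j)) (lift ord0 v) = lift ord0 (lift (lift ord0 j) v).
    by apply: val_inj; rewrite /= /bump; lia.
  by rewrite insert_lift.
rewrite /contr fupd_other ?neq_lift //.
by have -> : lift (lift ord0 (lift ord0 j)) ord0 = ord0; [exact: val_inj | rewrite insert_at].
Qed.

Lemma wrap_insert y (w : 'I_k.+1 -> g) :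
  wrap_contr gm (insert ord0 y w) =
  insert ord0 (gm (w ord_max) y) (fun i => w (lift ord_max i)).
Proof.
apply/funext => u; case: (unliftP ord0 u) => [v ->|->].
  rewrite insert_lift /wrap_contr fupd_other 1?eq_sym ?neq_lift //.
  have -> : widen_ord (leqnSn k.+1) (lift ord0 v) = lift ord0 (lift ord_max v).
    by apply: val_inj; rewrite /= /bump; case: v => v /=; lia.
  by rewrite insert_lift.
rewrite insert_at /wrap_contr fupd_at insert_at; congr gm.
have -> : ord_max = lift ord0 ord_max :> 'I_k.+2 by exact: val_inj.
by rewrite insert_lift.
Qed.

Lemma contr_lift_perm (x : 'I_k.+1 -> g) (j : 'I_k) (a : 'I_k.+1) (b : 'I_k) (t : 'S_k') :
  contr gm j (x \o lift_perm (widen_ord (leqnSn _) j) a (lift_perm j b t)) =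
  insert j (gm (x a) (x (lift a b))) (x \o lift a \o lift b \o t).
Proof.
set s := lift_perm _ _ _.
have s1 : s (lift ord0 j) = lift a b.
  have -> : lift ord0 j = lift (widen_ord (leqnSn _) j) j.
    by apply: val_inj; rewrite /= /bump; lia.
  by rewrite lift_perm_lift lift_perm_id.
rewrite /contr /= lift_perm_id s1; apply/funext => u; rewrite /insert.
case: (unliftP j u) => [v ->|->]; last by rewrite fupd_at.
rewrite fupd_other 1?eq_sym ?neq_lift //.
have -> : lift (lift ord0 j) (lift j v) = lift (widen_ord (leqnSn _) j) (lift j v).
  by apply: val_inj; rewrite /= /bump; lia.
by rewrite !lift_perm_lift.
Qed.

(** Up to conversion, [CEd] in positive degree for the commutator bracket. *)
Definition CEform (c : ('I_k -> g) -> g -> K) (x : 'I_k.+1 -> g) (y : g) : K :=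
  \sum_(i < k.+1) (-1) ^+ i * (- c (x \o lift i) (lie_br (x i) y))
  + \sum_(i < k.+1) \sum_(j < k | (i <= j)%N)
      (-1) ^+ (i + j.+1) *
      c (insert ord0 (lie_br (x i) (x (lift i j))) (x \o lift i \o lift j)) y.

(** The Hochschild identity on (y, x_0, ..., x_k), antisymmetrized in the x: contraction 0 gives the
    products y x_i, the wrapped term the products x_i y, and the other contractions the products of
    two x, over ordered pairs of distinct indices. *)
Lemma sum_hochschild_perm (x : 'I_k.+1 -> g) y :
  \sum_(i < k.+1) (-1) ^+ i * antisym (x \o lift i) (gm y (x i))
  - \sum_(i < k.+1) (-1) ^+ i * antisym (x \o lift i) (gm (x i) y)
  + \sum_(a < k.+1) \sum_(b < k) (-1) ^+ (a + b.+1) *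
      antisym (insert ord0 (gm (x a) (x (lift a b))) (x \o lift a \o lift b)) y = 0.
Proof.
have : \sum_(s : 'S_k.+1) (-1) ^+ s * (
   \sum_(j < k.+1) (-1) ^+ j * phi (contr gm j (insert ord0 y (x \o s)))
   + (-1) ^+ k.+1 * phi (wrap_contr gm (insert ord0 y (x \o s)))) = 0.
  by rewrite big1 // => s _; rewrite phi_hochschild mulr0.
under eq_bigr do rewrite mulrDr big_ord_recl mulrDr.
rewrite !big_split /= => H; rewrite -[RHS]H {H} [RHS]addrAC; congr (_ + _ + _).
- rewrite (sum_lift_perm ord0); apply: eq_bigr => i _.
  rewrite /antisym mulr_sumr; apply: eq_bigr => t _.
  rewrite contr0 expr0 mul1r sign_lift_perm add0n -mulrA; congr (_ * (_ * phi (insert _ _ _))).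
    by rewrite /= lift_perm_id.
  by apply/funext => u; rewrite /= lift_perm_lift.
- rewrite (sum_lift_perm ord_max) -sumrN; apply: eq_bigr => i _.
  rewrite /antisym mulr_sumr -sumrN; apply: eq_bigr => t _.
  rewrite wrap_insert sign_lift_perm /= lift_perm_id.
  have -> : x \o lift i \o t = (fun u => x (lift_perm ord_max i t (lift ord_max u))).
    by apply/funext => u; rewrite /= lift_perm_lift.
  have -> : (-1) ^+ k.+1 = - (-1) ^+ k :> K by rewrite exprS mulN1r.
  have -> : (-1) ^+ (k + i) = (-1) ^+ k * (-1) ^+ i :> K by exact: exprD.
  have ee : (-1) ^+ k * (-1) ^+ k = 1 :> K by rewrite -expr2 sqrr_sign.
  move: (phi _) ((-1) ^+ k) ((-1) ^+ i) ((-1) ^+ t) ee => z e e1 e2 ee.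
  transitivity (- (e * e * (e1 * (e2 * z)))); [by rewrite ee mul1r | by ring].
under [RHS]eq_bigr do rewrite mulr_sumr.
rewrite [RHS]exchange_big /=.
under [RHS]eq_bigr => j _.
  rewrite (sum_lift_perm (widen_ord (leqnSn _) j)).
  under eq_bigr => a _.
    rewrite (sum_lift_perm j).
    over.
  over.
rewrite [RHS]exchange_big; apply: eq_bigr => a _ /=.
rewrite [RHS]exchange_big; apply: eq_bigr => b _ /=.
rewrite antisymE mulr_sumr; apply: eq_bigr => j _.
rewrite mulr_sumr; apply: eq_bigr => t _.
rewrite contrS contr_lift_perm !sign_lift_perm.
have -> : (-1) ^+ (j + (ord0 : 'I_k)) = (-1) ^+ j :> K by congr (_ ^+ _); exact: addn0.
have -> : (-1) ^+ (a + b.+1) = - ((-1) ^+ a * (-1) ^+ b) :> K.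
  by rewrite addnS exprS exprD mulN1r.
have -> : (-1) ^+ (widen_ord (leqnSn k) j + a) = (-1) ^+ j * (-1) ^+ a :> K by exact: exprD.
have -> : (-1) ^+ (j + b) = (-1) ^+ j * (-1) ^+ b :> K by exact: exprD.
have -> : (-1) ^+ bump 0 j = - (-1) ^+ j :> K by rewrite /bump add1n exprS mulN1r.
have ee : (-1) ^+ j * (-1) ^+ j = 1 :> K by rewrite -expr2 sqrr_sign.
move: (phi _) ((-1) ^+ j) ((-1) ^+ a) ((-1) ^+ b) ((-1) ^+ t) ee => z e e1 e2 e3 ee.
transitivity (- (e1 * e2) * (e * e * (e * e3 * z))); [by rewrite ee; ring | by ring].
Qed.

Lemma sum_ordered_pairs (V : nmodType) (f : nat -> nat -> V) :
  \sum_(a < k.+1) \sum_(b < k | (b < a)%N) f a b =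
  \sum_(a < k.+1) \sum_(b < k | (a <= b)%N) f b.+1 a.
Proof.
transitivity (\sum_(b < k) \sum_(a < k | (b <= a)%N) f a.+1 b).
  rewrite (exchange_big_dep xpredT) //=; apply: eq_bigr => b _.
  rewrite big_mkcond big_ord_recl /= add0r -big_mkcond /=.
  by apply: eq_bigl => a; rewrite /bump add1n ltnS.
rewrite [RHS]big_ord_recr /= [X in _ = _ + X]big1 ?addr0 // => b.
by rewrite leqNgt ltn_ord.
Qed.

Lemma CEform_antisym (x : 'I_k.+1 -> g) y : CEform antisym x y = 0.
Proof.
(* Indices are plain numbers here, so that the two orders of removing a pair of arguments can be
   compared: bump b.+1 (bump a u) = bump a (bump b u) for a <= b. The opposite signs of the two
   orders produce the commutator. *)
pose c a b v := (-1) ^+ (a + b.+1) * antisym (insert ord0 v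
  (fun u : 'I_k' => x (inord (bump a (bump b u))))) y : K.
pose xn a := x (inord a).
have xE (a : 'I_k.+1) : x a = xn a by rewrite /xn inord_val.
have rE (a : 'I_k.+1) (b : 'I_k) :
    x \o lift a \o lift b = (fun u : 'I_k' => x (inord (bump a (bump b u)))).
  by apply/funext => u; exact: (xE (lift a (lift b u))).
have cD a b u v : c a b (lam *: (u - v)) = lam * (c a b u - c a b v).
  have antiS r w c' u' : antisym (insert ord0 (c' *: u' + w) r) y =
      c' * antisym (insert ord0 u' r) y + antisym (insert ord0 w r) y.
    by have := antisym_arg_linear (insert ord0 u' r) ord0 c' u' w y; rewrite !insert_fupd.
  have anti0 r : antisym (insert ord0 0 r) y = 0.
    by have := antiS r 0 1 0; rewrite scaler0 addr0 mul1r => /esym/eqP; rewrite -subr_eq0 addrK => /eqP.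
  rewrite /c -[lam *: (u - v)]addr0 antiS anti0 addr0 -scaleN1r [u + _]addrC antiS mulN1r.
  by ring.
have H := sum_hochschild_perm x y.
have {}H : \sum_(i < k.+1) (-1) ^+ i * (antisym (x \o lift i) (gm y (x i)) - antisym (x \o lift i) (gm (x i) y))
  + \sum_(a < k.+1) \sum_(b < k | (a <= b)%N)
     (c a b (gm (xn a) (xn b.+1)) - c a b (gm (xn b.+1) (xn a))) = 0.
  rewrite -[RHS]H; congr (_ + _).
    by rewrite -sumrB; apply: eq_bigr => i _; rewrite mulrBr.
  transitivity (\sum_(a < k.+1) \sum_(b < k) c a b (gm (xn a) (xn (bump a b)))); last first.
    by apply: eq_bigr => a _; apply: eq_bigr => b _; rewrite rE xE (xE (lift a b)).
  transitivity (\sum_(a < k.+1) \sum_(b < k | (a <= b)%N) c a b (gm (xn a) (xn (bump a b)))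
     + \sum_(a < k.+1) \sum_(b < k | (b < a)%N) c a b (gm (xn a) (xn (bump a b)))); last first.
    rewrite -big_split; apply: eq_bigr => a _; rewrite [RHS](bigID (fun b : 'I_k => (a <= b)%N)) /=.
    by congr (_ + _); apply: eq_bigl => b; rewrite ltnNge.
  rewrite (sum_ordered_pairs (fun a b => c a b (gm (xn a) (xn (bump a b))))) -big_split.
  apply: eq_bigr => a _; rewrite -big_split; apply: eq_bigr => b ab /=.
  have -> : bump a b = b.+1 by rewrite /bump ab.
  have -> : bump b.+1 a = a by rewrite /bump ltnNge ab.
  congr (_ + _); rewrite /c.
  have -> : (fun u : 'I_k' => x (inord (bump b.+1 (bump a u)))) =
            (fun u : 'I_k' => x (inord (bump a (bump b u)))).
    by apply/funext => u; congr (x (inord _)); rewrite /bump; lia.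
  rewrite -mulNr; congr (_ * _); rewrite [in RHS]addSn [in RHS]exprS mulN1r.
  by congr (- (_ ^+ _)); lia.
rewrite -[RHS](mulr0 lam) -[in RHS]H mulrDr !mulr_sumr; congr (_ + _).
  apply: eq_bigr => i _; rewrite /lie_br -[X in antisym _ X]addr0 antisym_linear.
  have anti0 z : antisym z 0 = 0.
    by have := antisym_linear z 1 0 0; rewrite scaler0 addr0 mul1r => /esym/eqP; rewrite -subr_eq0 addrK => /eqP.
  rewrite anti0 addr0 -scaleN1r [_ + _ *: _]addrC antisym_linear mulN1r.
  by move: (antisym _ _) (antisym _ _) ((-1) ^+ i) => u v w; ring.
apply: eq_bigr => a _; rewrite mulr_sumr; apply: eq_bigr => b ab.
rewrite rE -cD /lie_br xE (xE (lift a b)).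
by have -> : (lift a b : nat) = b.+1 by rewrite /= /bump ab.
Qed.

(** Evaluate [CEform_antisym] at (z, x): the terms that still have z among their arguments vanish,
    and what is left is the coadjoint term and the brackets of z with each x j. *)
Lemma antisym_cartan (h : g -> Prop) z x y :
    (forall (w : 'I_k -> g) i u, h (w i) -> antisym w u = 0) -> h z ->
  - antisym x (lie_br z y) = \sum_(i < k) antisym (fupd x i (lie_br z (x i))) y.
Proof.
move=> h0 hz; have := CEform_antisym (insert ord0 z x) y.
rewrite /CEform big_ord_recl expr0 mul1r insert_at.
have -> : insert ord0 z x \o lift ord0 = x by apply/funext => i; rewrite /= insert_lift.
rewrite [X in _ + X + _]big1 ?addr0; last first.
  move=> i _; rewrite (h0 _ ord0) ?oppr0 ?mulr0 //= .
  by have -> : lift (lift ord0 i) ord0 = ord0; [exact: val_inj | rewrite insert_at].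
rewrite big_ord_recl [X in _ + (_ + X)]big1 ?addr0; last first.
  move=> i _; rewrite big1 // => j /=; rewrite /bump add1n => ij.
  have k0 : (0 < k')%N by have := ltn_ord j; lia.
  (* Position 0 holds the bracket, so z, which is not removed, has moved to position 1. *)
  rewrite (h0 _ (inord 1)) ?mulr0 //.
  have -> : (inord 1 : 'I_k) = lift ord0 (Ordinal k0).
    by apply: val_inj; rewrite /= inordK.
  rewrite insert_lift /=.
  have -> : lift (lift ord0 i) (lift j (Ordinal k0)) = ord0 :> 'I_k.+1.
    by apply: val_inj; rewrite /= /bump; lia.
  by rewrite insert_at.
move/eqP; rewrite addr_eq0 => /eqP ->; rewrite -sumrN; apply: eq_bigr => j _.
rewrite insert_at insert_lift add0n.
have -> : (insert ord0 z x \o lift ord0) \o lift j = x \o lift j.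
  by apply/funext => i; rewrite /= insert_lift.
have -> : fupd x j (lie_br z (x j)) = insert j (lie_br z (x j)) (x \o lift j).
  by rewrite -{1}(insert_liftE j x) insert_fupd.
by rewrite antisym_insert exprS mulN1r mulNr opprK.
Qed.

End Antisymmetrization.

(** * Matrices with entries in the algebra *)

Section OrderedProducts.
Variable T : pzRingType.

Lemma prod_insert1 m (p : 'I_m.+1) (x : 'I_m -> T) :
  \prod_i insert p 1 x i = \prod_i x i.
Proof.
elim: m p x => [|m IH] p x.
  by rewrite !big_ord_recl !big_ord0 (ord1 p) insert_at mulr1.
rewrite big_ord_recl; case: (unliftP ord0 p) => [p' ->|->].
  have -> : insert (lift ord0 p') 1 x ord0 = x ord0.
    have E : ord0 = lift (lift ord0 p') ord0 :> 'I_m.+2 by exact: val_inj.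
    by rewrite [X in insert _ _ _ X]E insert_lift.
  rewrite [RHS]big_ord_recl; congr (_ * _); rewrite -(IH p' (fun i => x (lift ord0 i))).
  apply: eq_bigr => i _; rewrite /insert; case: (unliftP p' i) => [j ->|->].
    have -> : lift ord0 (lift p' j) = lift (lift ord0 p') (lift ord0 j).
      by apply: val_inj; rewrite /= /bump; lia.
    by rewrite liftK.
  by rewrite unlift_none.
by rewrite insert_at mul1r; apply: eq_bigr => i _; rewrite insert_lift.
Qed.

Lemma prod_contr k (j : 'I_k.+1) (x : 'I_k.+2 -> T) :
  \prod_i contr *%R j x i = \prod_i x i.
Proof.
elim: k j x => [|k IH] j x.
  rewrite !big_ord_recl !big_ord0 !mulr1 (ord1 j) /contr fupd_at; congr (x _ * x _).
  exact: val_inj.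
rewrite big_ord_recl [RHS]big_ord_recl; case: (unliftP ord0 j) => [j' ->|->].
  congr (_ * _).
    rewrite /contr fupd_other ?neq_lift //; congr x; exact: val_inj.
  rewrite -(IH j' (fun i => x (lift ord0 i))); apply: eq_bigr => i _.
  rewrite /contr /fupd (inj_eq (@lift_inj _ _)); case: eqP => _; last first.
    by congr x; apply: val_inj; rewrite /= /bump; lia.
  by congr (x _ * x _); apply: val_inj; rewrite /= /bump; lia.
rewrite [X in _ = _ * X]big_ord_recl mulrA; congr (_ * _).
  by rewrite /contr fupd_at; congr (x _ * x _); exact: val_inj.
apply: eq_bigr => i _; rewrite /contr fupd_other 1?eq_sym ?neq_lift //.
by congr x; apply: val_inj; rewrite /= /bump; lia.
Qed.

Lemma prod_wrap k (x : 'I_k.+2 -> T) :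
  \prod_i wrap_contr *%R x i = x ord_max * \prod_(i < k.+1) x (widen_ord (leqnSn _) i).
Proof.
rewrite [LHS]big_ord_recl [X in _ = _ * X]big_ord_recl mulrA; congr (_ * _).
  by rewrite /wrap_contr fupd_at; congr (_ * x _); exact: val_inj.
Qed.

End OrderedProducts.

Section MatrixCochain.
Variables (K : comNzRingType) (A : lmodType K) (N k : nat).
Variable tau : ('I_k.+1 -> A) -> K.
Hypothesis tau_linear : forall a i c u v,
  tau (fupd a i (c *: u + v)) = c * tau (fupd a i u) + tau (fupd a i v).

Lemma tau_scale_slot a i c u : tau (fupd a i (c *: u)) = c * tau (fupd a i u).
Proof.
have t0 : tau (fupd a i 0) = 0.
  by have := tau_linear a i 1 0 0; rewrite scaler0 addr0 mul1r => /esym/eqP; rewrite -subr_eq0 addrK => /eqP.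
by rewrite -[c *: u]addr0 tau_linear t0 addr0.
Qed.

Lemma tau_scale (c : 'I_k.+1 -> K) (a : 'I_k.+1 -> A) :
  tau (fun j => c j *: a j) = (\prod_j c j) * tau a.
Proof.
have H (r : seq 'I_k.+1) : uniq r ->
    tau (fun j => if j \in r then c j *: a j else a j) = (\prod_(j <- r) c j) * tau a.
  elim: r => [|i r IH] /=; first by rewrite big_nil mul1r.
  case/andP=> ir /IH {}IH; rewrite big_cons -mulrA -IH.
  have -> : (fun j => if j \in i :: r then c j *: a j else a j) =
     fupd (fun j => if j \in r then c j *: a j else a j) i (c i *: a i).
    by apply/funext => j; rewrite /fupd inE; case: eqP => [->|].
  rewrite tau_scale_slot; congr (_ * tau _); apply/funext => j.
  by rewrite /fupd; case: eqP => [->|//]; rewrite (negbTE ir).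
have := H (enum 'I_k.+1) (enum_uniq _); rewrite big_enum /= => <-.
by congr tau; apply/funext => j; rewrite mem_enum.
Qed.

(** The multilinear form given by [tau] tensored with the trace; every argument is expanded in
    elementary matrices. *)
Definition mxphi (x : 'I_k.+1 -> 'M[A]_N) : K :=
  \sum_(e : {ffun 'I_k.+1 -> 'I_N * 'I_N})
    tau (fun j => x j (e j).1 (e j).2) *
    \tr (\prod_j (delta_mx (e j).1 (e j).2 : 'M[K]_N)).

Lemma entry_fupd (x : 'I_k.+1 -> 'M[A]_N) i w (e : 'I_k.+1 -> 'I_N * 'I_N) :
  (fun j => fupd x i w j (e j).1 (e j).2) =
  fupd (fun j => x j (e j).1 (e j).2) i (w (e i).1 (e i).2).
Proof. by apply/funext => j; rewrite /fupd; case: eqP => [->|]. Qed.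

Lemma mxphi_linear x i c (w u v : 'M[A]_N) :
  (forall a b, w a b = c *: u a b + v a b) ->
  mxphi (fupd x i w) = c * mxphi (fupd x i u) + mxphi (fupd x i v).
Proof.
move=> wE; rewrite /mxphi mulr_sumr -big_split; apply: eq_bigr => e _ /=.
by rewrite !entry_fupd wE tau_linear mulrDl mulrA.
Qed.

Definition mxpure (M : 'M[K]_N) (a : A) : 'M[A]_N := \matrix_(i, j) (M i j *: a).

Lemma prod_scalemx (I : Type) (r : seq I) (c : I -> K) (M : I -> 'M[K]_N) :
  \prod_(j <- r) (c j *: M j) = (\prod_(j <- r) c j) *: \prod_(j <- r) M j.
Proof.
elim: r => [|j r IH]; first by rewrite !big_nil scale1r.
by rewrite !big_cons IH -[LHS]/((c j *: M j) *m (_ *: _)) -scalemxAl -scalemxAr scalerA.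
Qed.

Lemma mxphi_pure (M : 'I_k.+1 -> 'M[K]_N) (a : 'I_k.+1 -> A) :
  mxphi (fun j => mxpure (M j) (a j)) = tau a * \tr (\prod_j M j).
Proof.
have -> : \prod_j M j =
    \sum_(e : {ffun 'I_k.+1 -> 'I_N * 'I_N}) (\prod_j M j (e j).1 (e j).2) *:
       \prod_j (delta_mx (e j).1 (e j).2 : 'M[K]_N).
  under [RHS]eq_bigr do rewrite -prod_scalemx.
  rewrite -(bigA_distr_bigA (fun j (p : 'I_N * 'I_N) => M j p.1 p.2 *: (delta_mx p.1 p.2 : 'M[K]_N))).
  apply: eq_bigr => j _; rewrite {1}(matrix_sum_delta (M j)) pair_bigA //.
rewrite raddf_sum mulr_sumr; apply: eq_bigr => e _ /=.
have -> : (fun j => mxpure (M j) (a j) (e j).1 (e j).2) = (fun j => M j (e j).1 (e j).2 *: a j).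
  by apply/funext => j; rewrite mxE.
by rewrite linearZ /= tau_scale mulrCA mulrA.
Qed.

(** Every matrix is a sum of pure ones, so the arguments can be made pure one after the other; c
    counts the initial arguments that are still arbitrary. *)
Lemma multiadditive_ext m (G : ('I_m -> 'M[A]_N) -> K) :
    (forall x i (I : finType) (v : I -> 'M[A]_N),
       G (fupd x i (\sum_l v l)) = \sum_l G (fupd x i (v l))) ->
    (forall M a, G (fun j => mxpure (M j) (a j)) = 0) ->
  forall x, G x = 0.
Proof.
move=> Gadd G0.
have H c : (c <= m)%N -> forall x,
    (forall i : 'I_m, (c <= i)%N -> exists M a, x i = mxpure M a) -> G x = 0.
  elim: c => [|c IH] cm x xP.
    have /choice [Ma MaE] : forall i, exists p : 'M[K]_N * A, x i = mxpure p.1 p.2.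
      by move=> i; have [M [a E]] := xP i (leq0n _); exists (M, a).
    by rewrite (_ : x = fun j => mxpure (Ma j).1 (Ma j).2) ?G0 //; apply/funext.
  pose i0 := Ordinal cm.
  have xE : x i0 = \sum_(p : 'I_N * 'I_N) mxpure (delta_mx p.1 p.2) (x i0 p.1 p.2).
    apply/matrixP => a b; rewrite summxE (bigD1 (a, b)) //= big1 ?addr0 => [|[a' b'] ne].
      by rewrite !mxE !eqxx scale1r.
    rewrite !mxE /=; case: eqP => [aa|_]; case: eqP => [bb|_]; rewrite ?scale0r //.
    by move: ne; rewrite xpair_eqE aa bb !eqxx.
  rewrite (_ : x = fupd x i0 (x i0)); last by (apply/funext => j; rewrite fupd_id).
  rewrite xE Gadd big1 // => p _; apply: IH => [|i ci]; first exact: ltnW.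
  have [->|ne] := eqVneq i i0; first by rewrite fupd_at; exists (delta_mx p.1 p.2), (x i0 p.1 p.2).
  rewrite fupd_other //; apply: xP; rewrite ltn_neqAle ci andbT.
  by apply: contra ne => /eqP E; apply/eqP/val_inj.
by move=> x; apply: (H m (leqnn _)) => i; rewrite leqNgt ltn_ord.
Qed.

Lemma mxphi_sum x i (I : finType) (v : I -> 'M[A]_N) :
  mxphi (fupd x i (\sum_l v l)) = \sum_l mxphi (fupd x i (v l)).
Proof.
have add u w : mxphi (fupd x i (u + w)) = mxphi (fupd x i u) + mxphi (fupd x i w).
  by rewrite (@mxphi_linear x i 1 (u + w) u w) ?mul1r // => a b; rewrite mxE scale1r.
apply: (big_morph (fun u => mxphi (fupd x i u)) add).
by have := add 0 0; rewrite addr0 => /esym/eqP; rewrite -subr_eq0 addrK => /eqP.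
Qed.

End MatrixCochain.

Section MatrixHochschild.
Variables (K : comNzRingType) (A : lmodType K) (N k : nat).
Variable tau : ('I_k.+1 -> A) -> K.
Hypothesis tau_linear : forall a i c u v,
  tau (fupd a i (c *: u + v)) = c * tau (fupd a i u) + tau (fupd a i v).
Variable mu : A -> A -> A.
Hypothesis mu_linearl : forall c u v w, mu (c *: u + v) w = c *: mu u w + mu v w.
Hypothesis mu_linearr : forall c u v w, mu w (c *: u + v) = c *: mu w u + mu w v.
Local Notation mxphi := (@mxphi K A N k tau).

Definition mxmul (x y : 'M[A]_N) : 'M[A]_N := \matrix_(i, j) \sum_l mu (x i l) (y l j).

Lemma mu0l w : mu 0 w = 0.
Proof. by have := mu_linearl 1 0 0 w; rewrite !scale1r addr0 => /esym/eqP; rewrite -subr_eq0 addrK => /eqP. Qed.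

Lemma mu0r w : mu w 0 = 0.
Proof. by have := mu_linearr 1 0 0 w; rewrite !scale1r addr0 => /esym/eqP; rewrite -subr_eq0 addrK => /eqP. Qed.

Lemma mxmul_pure M M' a a' :
  mxmul (mxpure M a) (mxpure M' a') = mxpure (M *m M') (mu a a').
Proof.
apply/matrixP => i j; rewrite !mxE scaler_suml; apply: eq_bigr => l _.
rewrite !mxE -[X in mu X _]addr0 mu_linearl mu0l addr0.
by rewrite -[X in mu _ X]addr0 mu_linearr mu0r addr0 scalerA.
Qed.

Lemma mxmul_suml (I : finType) (v : I -> 'M[A]_N) w :
  mxmul (\sum_l v l) w = \sum_l mxmul (v l) w.
Proof.
apply: (big_morph (mxmul^~ w)) => [u u'|].
  apply/matrixP => i j; rewrite !mxE -big_split; apply: eq_bigr => l _.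
  by rewrite mxE -[X in mu (X + _) _]scale1r mu_linearl scale1r.
by apply/matrixP => i j; rewrite !mxE big1 // => l _; rewrite mxE mu0l.
Qed.

Lemma mxmul_sumr (I : finType) (v : I -> 'M[A]_N) w :
  mxmul w (\sum_l v l) = \sum_l mxmul w (v l).
Proof.
apply: (big_morph (mxmul w)) => [u u'|].
  apply/matrixP => i j; rewrite !mxE -big_split; apply: eq_bigr => l _.
  by rewrite mxE -[X in mu _ (X + _)]scale1r mu_linearr scale1r.
by apply/matrixP => i j; rewrite !mxE big1 // => l _; rewrite mxE mu0r.
Qed.

Lemma mxphi_contr_sum j x i (I : finType) (v : I -> 'M[A]_N) :
  mxphi (contr mxmul j (fupd x i (\sum_l v l))) =
  \sum_l mxphi (contr mxmul j (fupd x i (v l))).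
Proof.
have wl : widen_ord (leqnSn k.+1) j != lift ord0 j.
  by rewrite -val_eqE /= /bump; lia.
have [->|i0] := eqVneq i (widen_ord (leqnSn _) j).
  have E w : contr mxmul j (fupd x (widen_ord (leqnSn _) j) w) =
     fupd (contr mxmul j x) j (mxmul w (x (lift ord0 j))).
    apply/funext => u; have [->|uj] := eqVneq u j.
      by rewrite /contr !fupd_at fupd_other // eq_sym.
    have lu : lift (lift ord0 j) u != widen_ord (leqnSn _) j.
      by move: uj; rewrite -!val_eqE /= /bump; lia.
    by rewrite /contr !fupd_other.
  by rewrite E mxmul_suml mxphi_sum //; apply: eq_bigr => l _; rewrite E.
have [->|i1] := eqVneq i (lift ord0 j).
  have E w : contr mxmul j (fupd x (lift ord0 j) w) =
     fupd (contr mxmul j x) j (mxmul (x (widen_ord (leqnSn _) j)) w).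
    apply/funext => u; have [->|uj] := eqVneq u j.
      by rewrite /contr !fupd_at fupd_other.
    by rewrite /contr !fupd_other // eq_sym neq_lift.
  by rewrite E mxmul_sumr mxphi_sum //; apply: eq_bigr => l _; rewrite E.
case: (unliftP (lift ord0 j) i) => [u iu|iu]; last by rewrite iu eqxx in i1.
have uj : u != j.
  by apply: contra i0 => /eqP E; rewrite iu E -val_eqE /= /bump; lia.
have E w : contr mxmul j (fupd x i w) = fupd (contr mxmul j x) u w.
  apply/funext => u'; have [->|u'j] := eqVneq u' j.
    rewrite /contr fupd_at [in RHS]fupd_other 1?eq_sym // [in RHS]fupd_at.
    by rewrite ![in LHS]fupd_other 1?eq_sym.
  rewrite /contr fupd_other // iu; have [->|uu] := eqVneq u' u.
    by rewrite !fupd_at.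
  by rewrite !fupd_other // (inj_eq (@lift_inj _ _)).
by rewrite E mxphi_sum //; apply: eq_bigr => l _; rewrite E.
Qed.

Lemma mxphi_wrap_sum x i (I : finType) (v : I -> 'M[A]_N) :
  mxphi (wrap_contr mxmul (fupd x i (\sum_l v l))) =
  \sum_l mxphi (wrap_contr mxmul (fupd x i (v l))).
Proof.
have m0 : ord_max != ord0 :> 'I_k.+2 by [].
have [->|i0] := eqVneq i ord_max.
  have E w : wrap_contr mxmul (fupd x ord_max w) = fupd (wrap_contr mxmul x) ord0 (mxmul w (x ord0)).
    apply/funext => u; have [->|u0] := eqVneq u ord0.
      by rewrite /wrap_contr !fupd_at fupd_other // eq_sym.
    by rewrite /wrap_contr !fupd_other // -val_eqE /= ltn_eqF.
  by rewrite E mxmul_suml mxphi_sum //; apply: eq_bigr => l _; rewrite E.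
have w0 : widen_ord (leqnSn _) ord0 = ord0 :> 'I_k.+2 by apply: val_inj.
have [->|i1] := eqVneq i ord0.
  have E w : wrap_contr mxmul (fupd x ord0 w) = fupd (wrap_contr mxmul x) ord0 (mxmul (x ord_max) w).
    apply/funext => u; have [->|u0] := eqVneq u ord0.
      by rewrite /wrap_contr !fupd_at fupd_other.
    by rewrite /wrap_contr !fupd_other.
  by rewrite E mxmul_sumr mxphi_sum //; apply: eq_bigr => l _; rewrite E.
have lti : (i < k.+1)%N by move: i0 (ltn_ord i); rewrite -val_eqE /=; lia.
have [r iu] : exists r, i = widen_ord (leqnSn k.+1) r by exists (Ordinal lti); exact: val_inj.
have r0 : ord0 != r by apply: contra i1 => /eqP r0; rewrite iu -r0.
have E w : wrap_contr mxmul (fupd x i w) = fupd (wrap_contr mxmul x) r w.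
  apply/funext => u; have [->|u0] := eqVneq u ord0.
    rewrite /wrap_contr fupd_at [RHS]fupd_other // fupd_at.
    by rewrite ![in LHS]fupd_other // eq_sym.
  rewrite /wrap_contr fupd_other // iu; have [->|uu] := eqVneq u r.
    by rewrite !fupd_at.
  by rewrite !fupd_other.
by rewrite E mxphi_sum //; apply: eq_bigr => l _; rewrite E.
Qed.

Hypothesis tau_hochschild : forall a : 'I_k.+2 -> A,
  \sum_(j < k.+1) (-1) ^+ j * tau (contr mu j a) + (-1) ^+ k.+1 * tau (wrap_contr mu a) = 0.

(** On pure matrices all terms carry the same trace: a contraction keeps the ordered product, and
    the wrapped term permutes it cyclically. *)
Theorem mxphi_hochschild (x : 'I_k.+2 -> 'M[A]_N) :
  \sum_(j < k.+1) (-1) ^+ j * mxphi (contr mxmul j x) +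
  (-1) ^+ k.+1 * mxphi (wrap_contr mxmul x) = 0.
Proof.
apply: (multiadditive_ext (G := fun x => \sum_(j < k.+1) (-1) ^+ j * mxphi (contr mxmul j x) +
  (-1) ^+ k.+1 * mxphi (wrap_contr mxmul x))) => [{}x i I v|M a].
  rewrite mxphi_wrap_sum big_split /= -mulr_sumr; congr (_ + _).
  rewrite exchange_big; apply: eq_bigr => j _ /=.
  by rewrite mxphi_contr_sum mulr_sumr.
have Ec j : contr mxmul j (fun i => mxpure (M i) (a i)) =
    (fun u => mxpure (contr *%R j M u) (contr mu j a u)).
  by apply/funext => u; rewrite /contr /fupd; case: eqP => // _; rewrite mxmul_pure.
have Ew : wrap_contr mxmul (fun i => mxpure (M i) (a i)) =
    (fun u => mxpure (wrap_contr *%R M u) (wrap_contr mu a u)).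
  by apply/funext => u; rewrite /wrap_contr /fupd; case: eqP => // _; rewrite mxmul_pure.
rewrite Ew mxphi_pure // prod_wrap.
have -> : \tr (M ord_max * \prod_(i < k.+1) M (widen_ord (leqnSn _) i)) = \tr (\prod_i M i).
  by rewrite [in RHS]big_ord_recr [LHS]mxtrace_mulC.
transitivity ((\sum_(j < k.+1) (-1) ^+ j * tau (contr mu j a) +
    (-1) ^+ k.+1 * tau (wrap_contr mu a)) * \tr (\prod_i M i)); last by rewrite tau_hochschild mul0r.
rewrite mulrDl mulr_suml mulrA; congr (_ + _).
by apply: eq_bigr => j _; rewrite Ec mxphi_pure // prod_contr mulrA.
Qed.

End MatrixHochschild.

Section MatrixInsertion.
Variables (K : comNzRingType) (A : lmodType K) (N k : nat).
Variable tau : ('I_k.+1 -> A) -> K.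
Hypothesis tau_linear : forall a i c u v,
  tau (fupd a i (c *: u + v)) = c * tau (fupd a i u) + tau (fupd a i v).

(** On pure matrices the trace is blind to an identity matrix, wherever it is inserted, and factors
    out of the sum. *)
Lemma mxphi_insert1 (q : A) (x : 'I_k -> 'M[A]_N) :
  (forall a : 'I_k -> A, \sum_(j < k) (-1) ^+ j * tau (insert (lift ord0 j) q a) = 0) ->
  \sum_(j < k) (-1) ^+ j * mxphi tau (insert (lift ord0 j) (mxpure 1%:M q) x) = 0.
Proof.
move=> tq; apply: (multiadditive_ext (G := fun x => \sum_(j < k) (-1) ^+ j *
   mxphi tau (insert (lift ord0 j) (mxpure 1%:M q) x))) => [{}x i I v|M a].
  rewrite exchange_big; apply: eq_bigr => j _ /=.
  rewrite -mulr_sumr; congr (_ * _); rewrite insert_fupd_lift mxphi_sum //.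
  by apply: eq_bigr => l _; rewrite insert_fupd_lift.
transitivity ((\sum_(j < k) (-1) ^+ j * tau (insert (lift ord0 j) q a)) * \tr (\prod_i M i));
  last by rewrite tq mul0r.
rewrite mulr_suml; apply: eq_bigr => j _; rewrite -mulrA; congr (_ * _).
have -> : insert (lift ord0 j) (mxpure 1%:M q) (fun i => mxpure (M i) (a i)) =
    (fun u => mxpure (insert (lift ord0 j) 1%:M M u) (insert (lift ord0 j) q a u)).
  by apply/funext => u; rewrite /insert; case: unlift.
by rewrite mxphi_pure // (prod_insert1 (lift ord0 j)).
Qed.

Lemma mxphi_entries0 (x : 'I_k.+1 -> 'M[A]_N) i :
  (forall a u v, tau (fupd a i (x i u v)) = 0) -> mxphi tau x = 0.
Proof.
move=> x0; rewrite /mxphi big1 // => e _.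
have -> : (fun j => x j (e j).1 (e j).2) =
    fupd (fun j => x j (e j).1 (e j).2) i (x i (e i).1 (e i).2).
  by apply/funext => j; rewrite fupd_id.
by rewrite x0 mul0r.
Qed.

Definition mxincl r (x : 'M[A]_N) : 'M[A]_(N + r) := block_mx x 0 0 0.

(** There is at least one factor, because the empty product is the full identity and not a padded
    block. *)
Lemma prod_block_mx r m (M : 'I_m.+1 -> 'M[K]_N) :
  \prod_i (block_mx (M i) 0 0 0 : 'M[K]_(N + r)) = block_mx (\prod_i M i) 0 0 0.
Proof.
elim: m M => [|m IH] M; first by rewrite !big_ord1.
rewrite big_ord_recl IH [in RHS]big_ord_recl.
by rewrite -[LHS]/(block_mx _ _ _ _ *m block_mx _ _ _ _) mulmx_block !mulmx0 !mul0mx !addr0.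
Qed.

End MatrixInsertion.

Lemma mxphi_incl (K : comNzRingType) (A : lmodType K) N k r (tau : ('I_k.+1 -> A) -> K)
    (x : 'I_k.+1 -> 'M[A]_N) :
  (forall a i c u v,
    tau (fupd a i (c *: u + v)) = c * tau (fupd a i u) + tau (fupd a i v)) ->
  mxphi tau (fun i => mxincl r (x i)) = mxphi tau x.
Proof.
move=> tau_linear; apply/eqP; rewrite -subr_eq0; apply/eqP.
apply: (multiadditive_ext (G := fun x => mxphi tau (fun i => mxincl r (x i)) - mxphi tau x))
  => [{}x i I v|M a].
  rewrite mxphi_sum // sumrB; congr (_ - _).
  have E w : (fun l => mxincl r (fupd x i w l)) = fupd (fun l => mxincl r (x l)) i (mxincl r w).
    by apply/funext => l; rewrite /fupd; case: eqP.
  rewrite E (_ : mxincl r _ = \sum_l mxincl r (v l)).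
    by rewrite mxphi_sum //; apply: eq_bigr => l _; rewrite E.
  apply: (big_morph (@mxincl _ _ _ r)) => [u w|]; rewrite /mxincl ?block_mx0 //.
  by rewrite add_block_mx !addr0.
have -> : (fun i => mxincl r (mxpure (M i) (a i))) =
    (fun i => mxpure (block_mx (M i) 0 0 0) (a i)).
  apply/funext => i; apply/matrixP => u v; rewrite [RHS]mxE /mxincl.
  by case: (split_ordP u) => u' ->; case: (split_ordP v) => v' ->;
    rewrite ?(block_mxEul, block_mxEur, block_mxEdl, block_mxEdr) !mxE ?scale0r.
rewrite !mxphi_pure //; apply/eqP; rewrite subr_eq0; apply/eqP; congr (_ * _).
by rewrite prod_block_mx mxtrace_block mxtrace0 addr0.
Qed.

(** * Expansion of the exponentials *)

Lemma rmorph_dpow (F : numFieldType) (A A' : comNzRingType) (rho : {rmorphism F -> A})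
    (rho' : {rmorphism F -> A'}) (phi : {rmorphism A -> A'}) :
  (forall x, phi (rho x) = rho' x) -> forall x e, phi (dpow rho x e) = dpow rho' (phi x) e.
Proof. by move=> E x e; rewrite /dpow rmorphM rmorphXn E. Qed.

Section OrderedPairs.
Variable k : nat.
Definition ordered_pair : finType := {e : 'I_k * 'I_k | (e.1 < e.2)%N}.

Lemma sum_ordered_pair (V : nmodType) (f : 'I_k -> 'I_k -> V) :
  \sum_(a < k) \sum_(b < k | (a < b)%N) f a b =
  \sum_(e : ordered_pair) f (val e).1 (val e).2.
Proof.
rewrite pair_big_dep /=.
exact: (big_sub [pred e : 'I_k * 'I_k | (e.1 < e.2)%N] (fun e => f e.1 e.2)).
Qed.

End OrderedPairs.

Section SymbolExpansion.
Variables (F : numFieldType) (K : comNzRingType) (rho : {rmorphism F -> K}).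
Variable d : nat.
Hypothesis d_gt0 : (0 < d)%N.
Variable J : 'M[K]_d.
Hypothesis Jdiag : forall s, J s s = 0.
Hypothesis Jskew : forall s t, J t s = - J s t.
Local Notation D := (d.+1 * d)%N.
Local Notation rC := (rhoC rho D).
Local Notation E := (ordered_pair d.+1).
Local Notation om e := (bil (symJ J D) (symvar K (val e).1) (symvar K (val e).2)).

Definition linear_phase (e : E) : {mpoly F[d]} :=
  2 * vertex F d (val e).1 - 2 * vertex F d (val e).2 + 1.

Definition phase_coef (m : E -> nat) : F :=
  simplexI idfun (\prod_e (dpow (rhoP idfun d) (linear_phase e) (m e))).

Lemma map_linear_phase e : map_mpoly rC (linear_phase e) =
  2 * vertex _ d (val e).1 - 2 * vertex _ d (val e).2 + 1.
Proof.
rewrite /linear_phase rmorphD rmorphB !rmorphM !rmorph_nat rmorph1 /=.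
by rewrite !(map_mpoly_vertex (rhoC rho D)).
Qed.

Lemma map_rhoP x : map_mpoly rC (rhoP idfun d x) = rhoP rC d x.
Proof. exact: map_mpolyC. Qed.

(** After the multinomial expansion the symbols leave the integral. What stays is a product of
    powers of linear forms in u with coefficients in F, whose integral is an element of F. *)
Lemma simplexI_phase n B : (n < B)%N ->
  simplexI rC (phase (symJ J D) (@symvar K d d.+1) ^+ n) * rC n`!%:R^-1 =
  \sum_(m : {ffun E -> 'I_B} | (\sum_e m e == n)%N)
    (\prod_e om e ^+ m e) * rC (phase_coef (fun e => m e)).
Proof.
move=> ltn; rewrite -simplexIMC.
rewrite -[_ ^+ n * _]/(dpow (rhoP rC d) (phase (symJ J D) (@symvar K d d.+1)) n).
rewrite phaseE; [|exact: symJ_diag|exact: symJ_skew].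
rewrite sum_ordered_pair (dpow_sum _ _ ltn).
rewrite (raddf_sum (@simplexI _ _ rC d)); apply: eq_bigr => m _ /=.
transitivity (simplexI rC ((\prod_e om e ^+ m e) *:
   map_mpoly rC (\prod_e dpow (rhoP idfun d) (linear_phase e) (m e)))).
  congr (simplexI _ _); rewrite rmorph_prod -scaler_prod; apply: eq_bigr => e _ /=.
  rewrite /dpow exprZn -scalerAl; congr (_ *: _).
  by rewrite -[LHS]/(dpow _ _ _) -map_linear_phase -(rmorph_dpow map_rhoP).
rewrite linearZ /=; congr (_ * _).
by rewrite /phase_coef (@rmorph_simplexI _ _ _ idfun rC rC).
Qed.

Definition tau_tensor (a : 'I_d.+1 -> {mpoly K[d]}) : {mpoly K[D]} :=
  \sum_(sg : 'S_d) (-1) ^+ sg *: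
    ptensor (insert ord0 (a ord0) (fun i => (a (lift ord0 i))^`M(sg i))).

(** The Leibniz formula for the determinant is the antisymmetrized differentiation of [pi_tau]. *)
Lemma pairing_rowdet P a :
  pairing (rowdet (fun r => @symvar K d d.+1 (lift ord0 r)) * P) (ptensor a) =
  pairing P (tau_tensor a).
Proof.
rewrite /rowdet /determinant mulr_suml pairing_suml pairing_sumr.
apply: eq_bigr => sg _; rewrite -mulrA pairing_sign pairingZr; congr (_ * _).
pose r := [seq lift ord0 i | i <- enum 'I_d].
(* The value at the factor 0 is a dummy, since this factor does not occur in r. *)
pose s (i : 'I_d.+1) := if unlift ord0 i is Some j then sg j else Ordinal d_gt0.
transitivity (pairing ((\prod_(i <- r) symvar K i (s i)) * P) (ptensor a)).
  congr (pairing (_ * P) _); rewrite big_map big_enum /=; apply: eq_bigr => i _.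
  by rewrite mxE /s liftK.
rewrite pairing_ptensor_deriv; last by rewrite map_inj_uniq ?enum_uniq //; exact: lift_inj.
congr (pairing P _); apply: eq_ptensor => i; rewrite /insert /s.
case: unliftP => [j ->|->]; first by rewrite map_f ?mem_enum.
by rewrite ifN //; apply/mapP => -[j _ /eqP]; rewrite (negbTE (neq_lift _ _)).
Qed.

Lemma pairing_rhoC D' (c : F) (G : {mpoly K[D']}) :
  pairing (rhoC rho D' c) G = rho c * G.@[fun=> 0].
Proof. by rewrite -pairing1 -pairingZl -mul_mpolyC mulr1. Qed.

Definition tau_sum (eps : K) (G : {mpoly K[D]}) : K :=
  \sum_(m : {ffun E -> 'I_(msize G)})
    rho (phase_coef (fun e => m e)) * eps ^+ (\sum_e m e)%N *
    ((\big[comp/id]_(e : E) iter (m e) (palpha J (val e).1 (val e).2)) G).@[fun=> 0].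

Lemma pairing_phase_coef (m : E -> nat) (G : {mpoly K[D]}) :
  pairing ((\prod_e om e ^+ m e) * rC (phase_coef m)) G =
  rho (phase_coef m) *
  ((\big[comp/id]_(e : E) iter (m e) (palpha J (val e).1 (val e).2)) G).@[fun=> 0].
Proof. by rewrite (pairing_palpha_prod _ _ (fun e : E => val e)) pairing_rhoC. Qed.

(** [tau_sum] cuts every exponent m e separately, [tser] cuts their total. The two differ by symbols
    of order at least the [msize] of the tensor, which annihilate it. *)
Lemma tau_sumE eps (a : 'I_d.+1 -> {mpoly K[d]}) B : (msize (tau_tensor a) <= B)%N ->
  tau_sum eps (tau_tensor a) = tser rho J eps B a.
Proof.
set G := tau_tensor a => leB.
have ov i s : order_ge 1 (@symvar K d d.+1 i s) by exact: order_ge_var.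
pose Q n := simplexI rC (phase (symJ J D) (@symvar K d d.+1) ^+ n) * rC n`!%:R^-1.
have small n : (msize G <= n)%N -> pairing (Q n) G = 0.
  by apply: pairing_order; rewrite -[Q n]mul1r; exact: order_ge_tau_symbol.
transitivity (\sum_(n < msize G) eps ^+ n * pairing (Q n) G); last first.
  transitivity (\sum_(n < B | (n < msize G)%N) eps ^+ n * pairing (Q n) G).
    by rewrite (big_ord_widen_cond B xpredT (fun n => eps ^+ n * pairing (Q n) G)).
  rewrite /tser big_mkcond; apply: eq_bigr => n _; rewrite pairing_rowdet -/(Q n).
  by case: ltnP => // le; rewrite small // mulr0.
pose T (m : {ffun E -> 'I_(msize G)}) :=
  pairing ((\prod_e om e ^+ m e) * rC (phase_coef (fun e => m e))) G.
transitivity (\sum_(n < msize G) \sum_(m : {ffun E -> 'I_(msize G)} | (\sum_e m e == n)%N)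
    eps ^+ n * T m); last first.
  apply: eq_bigr => n _; rewrite /Q (simplexI_phase (ltn_ord n)) pairing_suml mulr_sumr.
  by [].
rewrite (exchange_big_dep xpredT) //=; apply: eq_bigr => m _.
rewrite mulrAC -pairing_phase_coef -/(T m) mulrC.
have [lt|ge] := ltnP (\sum_e m e) (msize G).
  rewrite (big_pred1 (Ordinal lt)) // => n /=.
  by rewrite -val_eqE /= eq_sym.
rewrite [RHS]big1 => [|n /eqP mn]; last by have := ltn_ord n; rewrite -mn ltnNge ge.
rewrite /T (@pairing_order _ _ (\sum_e m e)) ?mulr0 // -[(\sum_e m e)%N]addn0.
apply: order_geM; last exact: order_ge0.
apply: order_ge_prod => e.
by have := @order_geX _ _ 1 (om e) (m e); rewrite muln1; apply; exact: order_ge_bil.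
Qed.

End SymbolExpansion.

(** * Values of the cocycle *)

(** The volume of the simplex, source of the 1/(2n)! that compensates the number of permutations in
    the normalisation. *)
Lemma simplexI1 (F : numFieldType) (S : comNzRingType) (rho : {rmorphism F -> S}) k :
  simplexI rho (1 : {mpoly S[k]}) = rho k`!%:R^-1.
Proof.
rewrite -mpolyX0 simplexIX /simplex_weight; congr (rho _).
elim: k => [|k IH]; first by rewrite big_ord0 fact0 invr1.
rewrite big_ord_recr psum0 factS natrM invfM mulrC -IH; congr (_ * _).
by apply: eq_bigr => s _; rewrite !psum0.
Qed.

Section TauValues.
Variables (F : numFieldType) (K : comNzRingType) (rho : {rmorphism F -> K}).
Variable d : nat.
Hypothesis d_gt0 : (0 < d)%N.
Variables (J : 'M[K]_d) (eps : K).
Hypothesis Jdiag : forall s, J s s = 0.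
Hypothesis Jskew : forall s t, J t s = - J s t.
Local Notation A := {mpoly K[d]}.
Variables (tau : ('I_d.+1 -> A) -> K) (bnd : ('I_d.+1 -> A) -> nat).
Hypothesis tauE : forall a B, (bnd a <= B)%N -> tau a = tser rho J eps B a.
Variables (star : A -> A -> A) (bnds : A -> A -> nat).
Hypothesis starE : forall f g B, (bnds f g <= B)%N ->
  star f g = \sum_(l < B) (rho l`!%:R^-1 * eps ^+ l) *: star_coef J l f g.

Lemma push_mul_merge (a : 'I_d.+2 -> A) (j : 'I_d.+1) v :
  fupd (push_mul (merge_ord j) a) j v = fupd (fun u => a (lift (lift ord0 j) u)) j v.
Proof.
apply/funext => u; rewrite /fupd; case: (eqVneq u j) => // uj.
rewrite /push_mul (big_pred1 (lift (lift ord0 j) u)) // => i /=.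
have jd : (j <= d)%N by rewrite -ltnS.
move: uj; rewrite -!val_eqE /= merge_ordE // /unbump /bump.
by case: i => i /= _; lia.
Qed.

Lemma push_mul_wrap (a : 'I_d.+2 -> A) v :
  fupd (push_mul (@wrap_ord d) a) ord0 v = fupd (fun u => a (widen_ord (leqnSn _) u)) ord0 v.
Proof.
apply/funext => u; rewrite /fupd; case: (eqVneq u ord0) => // u0.
rewrite /push_mul (big_pred1 (widen_ord (leqnSn _) u)) // => i /=.
rewrite /wrap_ord; case: (eqVneq i ord_max) => [->|im].
  by rewrite eq_sym (negbTE u0) -val_eqE /= gtn_eqF.
have lti : (i < d.+1)%N by move: im (ltn_ord i); rewrite -val_eqE /=; lia.
by rewrite -!val_eqE /= inordK.
Qed.

Lemma tau_contr (a : 'I_d.+2 -> A) :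
  \sum_(j < d.+1) (-1) ^+ j * tau (contr star j a) + (-1) ^+ d.+1 * tau (wrap_contr star a) = 0.
Proof.
rewrite -[RHS](tau_hochschild Jdiag Jskew tauE starE a) /wrap_contr -push_mul_wrap.
by congr (_ + _); apply: eq_bigr => j _; rewrite /contr -push_mul_merge.
Qed.

Lemma tau_tensorE (a : 'I_d.+1 -> A) B : (bnd a <= B)%N ->
  tau a = \sum_(e < B) eps ^+ e * pairing
    (simplexI (rhoC rho _) (phase (symJ J _) (@symvar K d d.+1) ^+ e) * rhoC rho _ e`!%:R^-1)
    (tau_tensor a).
Proof.
by move=> le_B; rewrite (tauE le_B); apply: eq_bigr => e _; rewrite pairing_rowdet.
Qed.

Lemma tau_slot1 (a : 'I_d.+1 -> A) (i : 'I_d) c : tau (fupd a (lift ord0 i) (c *: 1)) = 0.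
Proof.
rewrite (tau_tensorE (leqnn _)) big1 // => e _.
rewrite (_ : tau_tensor _ = 0) ?pairing0r ?mulr0 // /tau_tensor big1 // => sg _.
rewrite (@ptensor_zero _ _ _ _ (lift ord0 i)) ?scaler0 // insert_lift fupd_at.
by rewrite mderivZ -mpolyC1 mderivC scaler0.
Qed.

(** Only the permutation s gives a nonzero tensor; this tensor is constant, so only the term of
    degree 0 of the exponential acts on it. *)
Lemma tau_vars (s : 'S_d) :
  tau (insert ord0 1 (fun i => 'X_(s i))) = (-1) ^+ s * rho d`!%:R^-1.
Proof.
set a := insert _ _ _.
have aE : tau_tensor a = (-1) ^+ s *: 1.
  rewrite /tau_tensor (bigD1 s) //= big1 ?addr0 => [|t ts].
    congr (_ *: _); rewrite /ptensor big1 // => i _; rewrite /slotp.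
    case: (unliftP ord0 i) => [j ->|->]; rewrite ?insert_lift ?insert_at /a ?rmorph1 //.
      rewrite insert_lift mderivX mnm1E eqxx scale1r.
      by rewrite (_ : (U_(s j) - U_(s j))%MM = 0%MM) ?mpolyX0 ?rmorph1 // -[X in (X - _)%MM]addm0 addmC addmK.
    by rewrite insert_at rmorph1.
  have [j tj] : exists j, t j != s j.
    by apply/existsP; apply: contraR ts; rewrite negb_exists => /forallP ts; apply/eqP/permP => j; apply/eqP; rewrite -[_ == _]negbK ts.
  rewrite (@ptensor_zero _ _ _ _ (lift ord0 j)) ?scaler0 // insert_lift /a insert_lift.
  by rewrite mderivX mnm1E eq_sym (negbTE tj) scale0r.
rewrite (tau_tensorE (leqnSn _)) aE big_ord_recl big1 ?addr0 => [|e _].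
  rewrite expr0 mul1r pairingZr expr0 simplexI1 /= fact0 invr1 rmorph1 mulr1 pairing_rhoC.
  by rewrite rmorph1 mulr1.
rewrite pairingZr (@pairing_order _ _ (lift ord0 e)) ?mulr0 //; last by rewrite msize1.
rewrite -[simplexI _ _ * _]mul1r; apply: order_ge_tau_symbol => i j; exact: order_ge_var.
Qed.

Lemma star_coef0l l g : star_coef J l 0 g = 0.
Proof.
by have := star_coef_linearl J l 1 0 0 g; rewrite !scale1r addr0 => /esym/eqP; rewrite -subr_eq0 addrK => /eqP.
Qed.

Lemma star_coef0r l g : star_coef J l g 0 = 0.
Proof.
by have := star_coef_linearr J l 1 0 0 g; rewrite !scale1r addr0 => /esym/eqP; rewrite -subr_eq0 addrK => /eqP.
Qed.

Lemma deriv1 s : (1 : A)^`M(s) = 0.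
Proof. by rewrite -mpolyC1 mderivC. Qed.

Lemma star1r f : star f 1 = f.
Proof.
rewrite (starE (leqnSn _)) big_ord_recl big1 ?addr0 => [|l _].
  by rewrite star_coef0 mulr1 fact0 invr1 rmorph1 expr0 mulr1 scale1r.
rewrite star_coefS big1 ?scaler0 // => s _; rewrite big1 // => t _.
by rewrite deriv1 star_coef0r scaler0.
Qed.

Lemma star1l f : star 1 f = f.
Proof.
rewrite (starE (leqnSn _)) big_ord_recl big1 ?addr0 => [|l _].
  by rewrite star_coef0 mul1r fact0 invr1 rmorph1 expr0 mulr1 scale1r.
rewrite star_coefS big1 ?scaler0 // => s _; rewrite big1 // => t _.
by rewrite deriv1 star_coef0l scaler0.
Qed.

Lemma deriv_var (s t : 'I_d) : ('X_s : A)^`M(t) = (s == t)%:R *: 1.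
Proof.
rewrite mderivX mnm1E; case: eqP => [->|_]; last by rewrite !scale0r.
by rewrite (_ : (U_(t) - U_(t))%MM = 0%MM) ?mpolyX0 // -[X in (X - _)%MM]addm0 addmC addmK.
Qed.

Lemma star_commutator_vars (s t : 'I_d) : exists c, star 'X_s 'X_t - star 'X_t 'X_s = c *: 1.
Proof.
have starX (i j : 'I_d) : exists c, star 'X_i 'X_j = 'X_i * 'X_j + c *: 1.
  (* The bound is raised by 2 so that the terms l = 0 and l = 1 can be split off; from l = 2 on,
     second derivatives of variables occur. *)
  have le2 : (bnds 'X_i 'X_j <= (bnds 'X_i 'X_j).+2)%N by apply: leqW.
  rewrite (starE le2) !big_ord_recl big1 ?addr0 => [|l _].
    rewrite star_coef0 fact0 invr1 rmorph1 expr0 mulr1 scale1r.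
    rewrite (_ : star_coef J _ _ _ = (\sum_s \sum_t J s t * ((i == s)%:R * (j == t)%:R)) *: 1).
      by rewrite scalerA; eexists.
    rewrite star_coefS scaler_suml.
    apply: eq_bigr => s' _; rewrite scaler_suml; apply: eq_bigr => t' _.
    by rewrite star_coef0 !deriv_var -scalerAl -scalerAr mulr1 !scalerA mulrA.
  rewrite star_coefS big1 ?scaler0 // => s' _; rewrite big1 // => t' _.
  rewrite star_coefS big1 ?scaler0 // => u _; rewrite big1 // => v _.
  by rewrite !deriv_var !mderivZ !deriv1 !scaler0 star_coef0l scaler0.
have [c ->] := starX s t; have [c' ->] := starX t s; exists (c - c').
by rewrite [_ * 'X_s]mulrC opprD addrACA subrr add0r scalerBl.
Qed.

End TauValues.

(** What [tau_insert_quadratic] asks of q, in a form stable under linear combinations; unlike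
    homogeneity it allows a constant term. *)
Definition quadratic_like (K : comNzRingType) d (q : {mpoly K[d]}) : Prop :=
  (forall s, (q^`M(s)).@[fun=> 0] = 0) /\
  (forall s t u, ((q^`M(s))^`M(t))^`M(u) = 0).

Lemma quadratic_like_linear (K : comNzRingType) d c (p q : {mpoly K[d]}) :
  quadratic_like p -> quadratic_like q -> quadratic_like (c *: p + q).
Proof.
move=> [p1 p3] [q1 q3]; split=> [s|s t u].
  by rewrite mderivD mderivZ mevalD mevalZ p1 q1 mulr0 addr0.
by rewrite !(mderivD, mderivZ) p3 q3 scaler0 addr0.
Qed.

Lemma dhomog2_quadratic (K : comNzRingType) d (q : {mpoly K[d]}) :
  q \is 2.-homog -> quadratic_like q.
Proof.
move=> /dhomogP hq.
have q2 m : mdeg m <> 2%N -> q@_m = 0.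
  by move=> m2; case: (eqVneq q@_m 0) => // nz; case: m2; apply: hq; rewrite mcoeff_msupp.
split=> [s|s t u].
  rewrite mevalE big1 // => m _; have [->|m0] := eqVneq m 0%MM.
    by rewrite mcoeff_deriv q2 ?mul0rn ?mul0r // mdegD mdeg0 mdeg1.
  have [i mi] : exists i, m i != 0%N.
    by apply/existsP; rewrite -negb_forall; apply: contra m0 => /forallP mi; apply/eqP/mnmP => i; rewrite mnm0E (eqP (mi i)).
  by rewrite (bigD1 i) //= expr0n (negbTE mi) mul0r mulr0.
apply/mpolyP => m; rewrite !mcoeff_deriv mcoeff0 q2 ?mul0rn //.
by rewrite !mdegD !mdeg1; lia.
Qed.

(** * Relative cochains and the class of the cocycle *)

Section RelativeCochain.
Variables (K : comNzRingType) (A : lmodType K) (one : A) (quadr : A -> Prop) (k : nat).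
Local Notation d := k.+1.
Variable tau : ('I_d.+1 -> A) -> K.
Hypothesis tau_linear : forall a i c u v,
  tau (fupd a i (c *: u + v)) = c * tau (fupd a i u) + tau (fupd a i v).
Hypothesis tau1 : forall a (i : 'I_d) c, tau (fupd a (lift ord0 i) (c *: one)) = 0.
Hypothesis tau_quadratic : forall q (x : 'I_d -> A), quadr q ->
  \sum_(j < d) (-1) ^+ j * tau (insert (lift ord0 j) q x) = 0.
Variable star : A -> A -> A.
Hypothesis star_linearl : forall c u v w, star (c *: u + v) w = c *: star u w + star v w.
Hypothesis star_linearr : forall c u v w, star w (c *: u + v) = c *: star w u + star w v.
Hypothesis tau_contr : forall a : 'I_d.+2 -> A,
  \sum_(j < d.+1) (-1) ^+ j * tau (contr star j a) + (-1) ^+ d.+1 * tau (wrap_contr star a) = 0.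
Variables (N : nat) (g : lmodType K) (ent : g -> 'M[A]_N) (gm : g -> g -> g).
Hypothesis ent_linear : forall c u v a b, ent (c *: u + v) a b = c *: ent u a b + ent v a b.
Hypothesis ent_mul : forall x y, ent (gm x y) = mxmul star (ent x) (ent y).

Definition gl_phi m (x : 'I_m.+1 -> g) (t : ('I_m.+1 -> A) -> K) : K := mxphi t (ent \o x).
Local Notation phi x := (gl_phi x tau).

Lemma comp_fupd (x : 'I_d.+1 -> g) i w : ent \o fupd x i w = fupd (ent \o x) i (ent w).
Proof. by apply/funext => j; rewrite /fupd /=; case: eqP. Qed.

Lemma comp_insert m (p : 'I_m.+1) v (w : 'I_m -> g) :
  ent \o insert p v w = insert p (ent v) (ent \o w).
Proof. by apply/funext => j; rewrite /insert /=; case: unlift. Qed.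

Lemma phi_linear x i c u v :
  phi (fupd x i (c *: u + v)) = c * phi (fupd x i u) + phi (fupd x i v).
Proof. by rewrite /gl_phi !comp_fupd; apply: mxphi_linear => // a b; exact: ent_linear. Qed.

Lemma phi_hochschild (x : 'I_d.+2 -> g) :
  \sum_(j < d.+1) (-1) ^+ j * phi (contr gm j x) + (-1) ^+ d.+1 * phi (wrap_contr gm x) = 0.
Proof.
rewrite -[RHS](mxphi_hochschild tau_linear star_linearl star_linearr tau_contr (ent \o x)).
congr (_ + _); last by rewrite /gl_phi /wrap_contr comp_fupd ent_mul.
by apply: eq_bigr => j _; rewrite /gl_phi /contr comp_fupd ent_mul.
Qed.

(* The entries of the elements of gl_N + sp_2n. *)
Definition isotropic (z : g) : Prop := exists (c : 'M[K]_N) (q : A), quadr q /\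
  forall a b, ent z a b = c a b *: one + (1%:M : 'M[K]_N) a b *: q.

(** The part in gl_N puts a constant into a slot that [tau] differentiates. The part in sp_2n is an
    alternating insertion sum of a quadratic polynomial. *)
Lemma antisym_isotropic (w : 'I_d -> g) i y : isotropic (w i) -> antisym (fun x => phi x) w y = 0.
Proof.
case=> c [q [qq wE]]; rewrite -(insert_liftE i w); apply: antisym_insert0 => w'.
have E j : insert ord0 y (insert j (w i) w') = insert (lift ord0 j) (w i) (insert ord0 y w').
  apply/funext => u; case: (unliftP (lift ord0 j) u) => [v ->|->]; last first.
    by rewrite insert_at insert_lift insert_at.
  rewrite insert_lift; case: (unliftP ord0 v) => [v' ->|->].
    rewrite insert_lift (_ : lift (lift ord0 j) (lift ord0 v') = lift ord0 (lift j v')).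
      by rewrite !insert_lift.
    by apply: val_inj; rewrite /= /bump; lia.
  by rewrite insert_at (_ : lift _ _ = ord0) ?insert_at //; exact: val_inj.
rewrite -[RHS](mxphi_insert1 tau_linear (q := q) (ent \o insert ord0 y w')); last first.
  by move=> a; exact: tau_quadratic.
apply: eq_bigr => j _; congr (_ * _); rewrite E /gl_phi comp_insert.
rewrite -(insert_fupd _ 0) (@mxphi_linear _ _ _ _ _ tau_linear _ _ 1 _ (mxpure c one) (mxpure 1%:M q)).
  rewrite mul1r !insert_fupd (@mxphi_entries0 _ _ _ _ _ _ (lift ord0 j)) ?add0r // => a u v.
  by rewrite insert_at mxE tau1.
by move=> a b; rewrite wE scale1r !mxE.
Qed.

End RelativeCochain.

(** Moves the indices of the elementary matrices from the positions in the product to the arguments,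
    as in the definition of [Theta]. *)
Lemma sum_ffun_insert (V : nmodType) (P : finType) m (s : 'S_m)
    (h : P -> ('I_m -> P) -> V) :
  \sum_(e : {ffun 'I_m.+1 -> P}) h (e ord0) (fun i => e (lift ord0 i)) =
  \sum_(e : {ffun 'I_m -> P}) \sum_(e0 : P) h e0 (fun i => e (s i)).
Proof.
rewrite pair_big /=.
pose f (p : {ffun 'I_m -> P} * P) : {ffun 'I_m.+1 -> P} :=
  [ffun j => insert ord0 p.2 (p.1 \o s) j].
pose f' (e : {ffun 'I_m.+1 -> P}) : {ffun 'I_m -> P} * P :=
  ([ffun i => e (lift ord0 ((s^-1)%g i))], e ord0).
rewrite (reindex f) /=; last first.
  exists f' => [[e e0]|e] _; rewrite /f /f' /=.
    by congr (_, _); [apply/ffunP => i; rewrite !ffunE insert_lift /= permKV | rewrite ffunE insert_at].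
  apply/ffunP => j; rewrite ffunE; case: (unliftP ord0 j) => [i ->|->].
    by rewrite insert_lift /= ffunE permK.
  by rewrite insert_at.
apply: eq_bigr => -[e e0] _ /=; rewrite ffunE insert_at; congr (h _ _).
by apply/funext => i; rewrite ffunE insert_lift.
Qed.

Lemma antisym_mxphi (K : comNzRingType) (A : lmodType K) N m
    (tau : ('I_m.+1 -> A) -> K) (x : 'I_m -> 'M[A]_N) (x0 : 'M[A]_N) :
  \sum_(s : 'S_m) (-1) ^+ s * mxphi tau (insert ord0 x0 (x \o s)) =
  \sum_(e : {ffun 'I_m -> 'I_N * 'I_N}) \sum_(e0 : 'I_N * 'I_N) \sum_(s : 'S_m)
    (-1) ^+ s * tau (insert ord0 (x0 e0.1 e0.2) ((fun i => x i (e i).1 (e i).2) \o s)) *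
    \tr ((delta_mx e0.1 e0.2 : 'M[K]_N) *m
         \prod_(i < m) (delta_mx (e (s i)).1 (e (s i)).2 : 'M[K]_N)).
Proof.
under [RHS]eq_bigr do rewrite exchange_big /=.
rewrite [RHS]exchange_big; apply: eq_bigr => s _ /=.
rewrite -(sum_ffun_insert s (fun e0 e => (-1) ^+ s *
   tau (insert ord0 (x0 e0.1 e0.2) (fun i => x (s i) (e i).1 (e i).2)) *
   \tr ((delta_mx e0.1 e0.2 : 'M[K]_N) *m
         \prod_(i < m) (delta_mx (e i).1 (e i).2 : 'M[K]_N)))).
rewrite /mxphi mulr_sumr; apply: eq_bigr => e _; rewrite mulrA big_ord_recl.
have -> : (fun j => insert ord0 x0 (x \o s) j (e j).1 (e j).2) =
  insert ord0 (x0 (e ord0).1 (e ord0).2)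
    (fun i => x (s i) (e (lift ord0 i)).1 (e (lift ord0 i)).2); last by [].
by apply/funext => j; case: (unliftP ord0 j) => [i ->|->]; rewrite ?insert_lift ?insert_at.
Qed.

Lemma map_mx_prod (C K : nzRingType) (f : {rmorphism C -> K}) N (I : Type) (r : seq I)
    (M : I -> 'M[C]_N) :
  map_mx f (\prod_(i <- r) M i) = \prod_(i <- r) map_mx f (M i).
Proof.
elim: r => [|i r IH]; first by rewrite !big_nil -[LHS]/(map_mx f 1%:M) map_mx1.
by rewrite !big_cons -[LHS]/(map_mx f (M i *m _)) map_mxM IH.
Qed.

Lemma map_trace_prod (C K : nzRingType) (f : {rmorphism C -> K}) N m
    (M : 'I_m -> 'M[C]_N) (M0 : 'M[C]_N) :
  f (\tr (M0 *m \prod_(i < m) M i)) = \tr (map_mx f M0 *m \prod_(i < m) map_mx f (M i)).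
Proof. by rewrite -trace_map_mx map_mxM map_mx_prod. Qed.

Lemma antisym_mxpure (K : comNzRingType) (A : lmodType K) N m
    (tau : ('I_m.+1 -> A) -> K) (M : 'I_m -> 'M[K]_N) (M0 : 'M[K]_N) (a : 'I_m -> A) (a0 : A) :
  (forall a i c u v,
    tau (fupd a i (c *: u + v)) = c * tau (fupd a i u) + tau (fupd a i v)) ->
  \sum_(s : 'S_m) (-1) ^+ s *
     mxphi tau (insert ord0 (mxpure M0 a0) ((fun i => mxpure (M i) (a i)) \o s)) =
  \sum_(s : 'S_m) (-1) ^+ s * tau (insert ord0 a0 (a \o s)) *
    \tr (M0 *m \prod_(i < m) M (s i)).
Proof.
move=> tau_linear; apply: eq_bigr => s _.
have -> : insert ord0 (mxpure M0 a0) ((fun i => mxpure (M i) (a i)) \o s) =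
    (fun j => mxpure (insert ord0 M0 (M \o s) j) (insert ord0 a0 (a \o s) j)).
  by apply/funext => j; rewrite /insert; case: unlift.
rewrite mxphi_pure // mulrA big_ord_recl insert_at.
by congr (_ * \tr (_ *m _)); apply: eq_bigr => i _; rewrite insert_lift.
Qed.

Lemma sum_sign_sq (K : comNzRingType) m (x y : K) :
  \sum_(s : 'S_m) (-1) ^+ s * ((-1) ^+ s * x) * y = m`!%:R * (x * y).
Proof.
transitivity (\sum_(s : 'S_m) x * y).
  by apply: eq_bigr => s _; rewrite [_ * (_ * x)]mulrA -exprD addnn -signr_odd odd_double mul1r.
by rewrite sumr_const card_Sn mulr_natl.
Qed.

Lemma tau_quadratic_like (F : numFieldType) (K : comNzRingType) (rho : {rmorphism F -> K})
    d (J : 'M[K]_d) (eps : K) (tau : ('I_d.+1 -> {mpoly K[d]}) -> K)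
    (bnd : ('I_d.+1 -> {mpoly K[d]}) -> nat) :
    (0 < d)%N -> (forall s, J s s = 0) -> (forall s t, J t s = - J s t) ->
    (forall a B, (bnd a <= B)%N -> tau a = tser rho J eps B a) ->
  forall q (x : 'I_d -> {mpoly K[d]}), quadratic_like q ->
  \sum_(j < d) (-1) ^+ j * tau (insert (lift ord0 j) q x) = 0.
Proof.
case: d J tau bnd => [//|k] J tau bnd _ Jdiag Jskew tauE q x [q1 q3].
exact: (tau_insert_quadratic Jdiag Jskew tauE x q1 q3).
Qed.

Section RelativeCocycle.
Variables (K : comNzRingType) (A : lmodType K) (one : A) (quadr : A -> Prop) (d : nat).
Hypothesis d_gt0 : (0 < d)%N.
Variable tau : ('I_d.+1 -> A) -> K.
Hypothesis tau_linear : forall a i c u v,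
  tau (fupd a i (c *: u + v)) = c * tau (fupd a i u) + tau (fupd a i v).
Hypothesis tau1 : forall a (i : 'I_d) c, tau (fupd a (lift ord0 i) (c *: one)) = 0.
Hypothesis tau_quadratic : forall q (x : 'I_d -> A), quadr q ->
  \sum_(j < d) (-1) ^+ j * tau (insert (lift ord0 j) q x) = 0.
Variable star : A -> A -> A.
Hypothesis star_linearl : forall c u v w, star (c *: u + v) w = c *: star u w + star v w.
Hypothesis star_linearr : forall c u v w, star w (c *: u + v) = c *: star w u + star w v.
Hypothesis tau_contr : forall a : 'I_d.+2 -> A,
  \sum_(j < d.+1) (-1) ^+ j * tau (contr star j a) + (-1) ^+ d.+1 * tau (wrap_contr star a) = 0.
Variables (N : nat) (g : lmodType K) (ent : g -> 'M[A]_N) (gm : g -> g -> g) (lam : K).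
Hypothesis ent_linear : forall c u v a b, ent (c *: u + v) a b = c *: ent u a b + ent v a b.
Hypothesis ent_mul : forall x y, ent (gm x y) = mxmul star (ent x) (ent y).
Variable h : g -> Prop.
Hypothesis h_isotropic : forall z, h z -> isotropic one quadr ent z.
Variable theta : ('I_d -> g) -> g -> K.
Hypothesis thetaE : forall x x0, theta x x0 =
  \sum_(s : 'S_d) (-1) ^+ s * mxphi tau (insert ord0 (ent x0) ((ent \o x) \o s)).
Variable br : g -> g -> g.
Hypothesis brE : forall x y, br x y = lie_br gm lam x y.

Lemma theta_antisym : theta =
  fun x y => \sum_(s : 'S_d) (-1) ^+ s * gl_phi ent (insert ord0 y (x \o s)) tau.
Proof.
apply/funext => x; apply/funext => x0; rewrite thetaE; apply: eq_bigr => s _.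
by rewrite /gl_phi comp_insert.
Qed.

Lemma br_lie : br = lie_br gm lam.
Proof. by apply/funext => u; apply/funext => v. Qed.

Theorem theta_cocycle x y : CEd br theta x y = 0.
Proof.
rewrite theta_antisym br_lie.
move: d_gt0 tau tau_linear tau_contr x y; case: (d) => [//|k] _ t t_lin tc x y.
pose phi (x : 'I_k.+2 -> g) := gl_phi ent x t.
exact: (@CEform_antisym K g gm lam k phi (phi_linear t_lin ent_linear)
  (phi_hochschild t_lin star_linearl star_linearr tc ent_mul) x y).
Qed.

Theorem theta_relative : rel_cochain br h theta.
Proof.
rewrite theta_antisym br_lie.
move: d_gt0 tau tau_linear tau_contr tau1 tau_quadratic.
case: (d) => [//|k] _ t t_lin tc t1 tq.
pose phi (x : 'I_k.+2 -> g) := gl_phi ent x t.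
have pl : forall x i c u v, phi (fupd x i (c *: u + v)) = c * phi (fupd x i u) + phi (fupd x i v).
  exact: phi_linear.
have ph : forall x : 'I_k.+3 -> g, \sum_(j < k.+2) (-1) ^+ j * phi (contr gm j x)
    + (-1) ^+ k.+2 * phi (wrap_contr gm x) = 0.
  exact: phi_hochschild.
have h0 (w : 'I_k.+1 -> g) i u : h (w i) -> antisym phi w u = 0.
  by move=> /h_isotropic hw; exact: (antisym_isotropic t_lin t1 tq u hw).
split.
- split=> [x a y z|x i a u v y|x i j y ij xij].
  + exact: (@antisym_linear K g k phi pl x a y z).
  + exact: (@antisym_arg_linear K g k phi pl x i a u v y).
  + exact: (antisym_alternating phi y ij xij).
- by move=> x i y hx; exact: (h0 x i y hx).
- by move=> z x y hz; exact: (@antisym_cartan K g gm lam k phi pl ph h z x y h0 hz).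
Qed.

Theorem theta_nontrivial (v : 'I_d -> g) (u : g) :
    (forall i, br (v i) u = 0) -> (forall i j, h (br (v i) (v j))) -> theta v u != 0 ->
  nontrivial_class br h theta.
Proof.
move=> vu vv nz; split; first by split; [exact: theta_relative | exact: theta_cocycle].
move: d_gt0 theta v vu vv nz; case: (d) => [//|k] _ th v vu vv /eqP nz [b [[[blin _ _] bh _] thb]].
apply: nz; rewrite thb {thb}.
have b0 x : b x 0 = 0.
  by have := blin x 1 0 0; rewrite scale1r addr0 mul1r => /esym/eqP; rewrite -subr_eq0 addrK => /eqP.
(* [CEd] on cochains of degree 0 is a separate clause, without brackets. *)
move: b blin bh b0; case: (k) v vu vv => [|k'] v vu vv b blin bh b0 /=.
  by rewrite /coad vu b0 oppr0.
rewrite !big1 ?addr0 // => i _; last by rewrite /coad vu b0 oppr0 mulr0.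
by rewrite big1 // => j _; rewrite (bh _ ord0) ?mulr0 //= /fcons unlift_none.
Qed.

End RelativeCocycle.

(** * The series for the standard symplectic form *)

Section ConcreteSeries.
Variables (F : numFieldType) (K : comNzRingType) (rho : {rmorphism F -> K}).
Variables (n : nat) (half : K) (eps : K) (p q : 'I_n -> 'I_n.*2).

Definition poisson_matrix : 'M[K]_n.*2 :=
  \matrix_(s, t) (half * \sum_(r < n)
     ((s == p r)%:R * (t == q r)%:R - (s == q r)%:R * (t == p r)%:R)).

Lemma poisson_diag s : poisson_matrix s s = 0.
Proof. by rewrite mxE big1 ?mulr0 // => r _; rewrite mulrC subrr. Qed.

Lemma poisson_skew s t : poisson_matrix t s = - poisson_matrix s t.
Proof.
rewrite !mxE -mulrN -sumrN; congr (_ * _); apply: eq_bigr => r _.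
by rewrite opprB; congr (_ - _); rewrite mulrC.
Qed.

Definition alpha_op k (i j : 'I_k) (G : {mpoly K[k * n.*2]}) : {mpoly K[k * n.*2]} :=
  half *: \sum_(r < n)
    ((G^`M(mxvec_index j (q r)))^`M(mxvec_index i (p r))
     - (G^`M(mxvec_index j (p r)))^`M(mxvec_index i (q r))).

Lemma alpha_opE k (i j : 'I_k) G : alpha_op i j G = palpha poisson_matrix i j G.
Proof.
pose D s t := (G^`M(mxvec_index j t))^`M(mxvec_index i s).
have pick s0 t0 : \sum_s \sum_t ((s == s0)%:R * (t == t0)%:R : K) *: D s t = D s0 t0.
  rewrite (bigD1 s0) //= (bigD1 t0) //= !eqxx mulr1 scale1r !big1 ?addr0 // => [s|t] /negbTE ne.
    by rewrite big1 // => t _; rewrite ne mul0r scale0r.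
  by rewrite ne mulr0 scale0r.
transitivity (\sum_r \sum_s \sum_t (half * ((s == p r)%:R * (t == q r)%:R
    - (s == q r)%:R * (t == p r)%:R)) *: D s t).
  rewrite /alpha_op scaler_sumr; apply: eq_bigr => r _.
  rewrite -[X in _ *: (X - _)]/(D (p r) (q r)) -[X in _ *: (_ - X)]/(D (q r) (p r)) -!pick.
  rewrite -sumrB scaler_sumr; apply: eq_bigr => s _.
  rewrite -sumrB scaler_sumr; apply: eq_bigr => t _.
  by rewrite -[RHS]scalerA scalerBl.
rewrite exchange_big; apply: eq_bigr => s _; rewrite exchange_big; apply: eq_bigr => t _ /=.
by rewrite -scaler_suml -mulr_sumr mxE.
Qed.

Lemma alpha_op_iter k (i j : 'I_k) m G : iter m (alpha_op i j) G = iter m (palpha poisson_matrix i j) G.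
Proof. by elim: m => //= m ->; exact: alpha_opE. Qed.

Definition tau_op (cf : (ordered_pair n.*2.+1 -> nat) -> F)
    (G : {mpoly K[n.*2.+1 * n.*2]}) : K :=
  \sum_(m : {ffun ordered_pair n.*2.+1 -> 'I_(msize G)})
    rho (cf (fun e => m e)) * eps ^+ (\sum_e m e)%N *
    ((\big[comp/id]_(e : ordered_pair n.*2.+1)
        iter (m e) (alpha_op (val e).1 (val e).2)) G).@[fun=> 0].

Lemma tau_opE (cf : (ordered_pair n.*2.+1 -> nat) -> F) (a : 'I_n.*2.+1 -> {mpoly K[n.*2]}) B :
    (0 < n)%N -> (forall m, cf m = @phase_coef F _ m) -> (msize (tau_tensor a) <= B)%N ->
  tau_op cf (tau_tensor a) = tser rho poisson_matrix eps B a.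
Proof.
move=> n0 cfE leB; rewrite -(tau_sumE rho _ poisson_diag poisson_skew) ?double_gt0 //.
apply: eq_bigr => m _; rewrite cfE; congr (_ * _ * _.@[_]).
suff -> : \big[comp/id]_(e : ordered_pair n.*2.+1) iter (m e) (alpha_op (val e).1 (val e).2) =
    \big[comp/id]_(e : ordered_pair n.*2.+1)
      iter (m e) (palpha poisson_matrix (val e).1 (val e).2) by [].
by apply: eq_bigr => e _; apply/funext => H; exact: alpha_op_iter.
Qed.

Definition star_op (f g : {mpoly K[n.*2]}) : {mpoly K[n.*2]} :=
  let G := ptensor (pair_fun f g) in
  ptmul (\sum_(m < msize G) (rho m`!%:R^-1 * eps ^+ m) *: iter m (@alpha_op 2 ord0 ord_max) G).

Lemma star_opE f g B : (msize (ptensor (pair_fun f g)) <= B)%N ->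
  star_op f g = \sum_(l < B) (rho l`!%:R^-1 * eps ^+ l) *: star_coef poisson_matrix l f g.
Proof.
move=> leB; rewrite /star_op /=; set G := ptensor _.
rewrite linear_sum (big_ord_widen_cond B xpredT (fun l => ptmul
   ((rho l`!%:R^-1 * eps ^+ l) *: iter l (@alpha_op 2 ord0 ord_max) G))) // big_mkcond.
apply: eq_bigr => l _; rewrite linearZ /= alpha_op_iter; case: ltnP => // le.
by rewrite /star_coef -/G palpha_iter_eq0 // linear0 scaler0.
Qed.

End ConcreteSeries.

(** * Integrals over the simplex *)

Section SimplexIntegral.
Variable R : realType.

Lemma Rintegral_horner (p : {poly R}) (t : R) : 0 <= t ->
  \int[lebesgue_measure]_(u in `[0, t]%classic) (p^`()).[u] = p.[t] - p.[0].
Proof.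
(* [continuous_FTC2] needs a nondegenerate interval, so t = 0 is treated apart. *)
rewrite le_eqVlt => /orP[/eqP <-|t0].
  by rewrite set_itv1 Rintegral_set1 subrr.
rewrite /Rintegral (@continuous_FTC2 _ (horner (p^`())) (horner p)) //=.
- apply: continuous_subspaceT => x; exact: continuous_horner.
- split=> [x _||].
  + exact: derivable_horner.
  + by apply: cvg_at_right_filter; exact: continuous_horner.
  + by apply: cvg_at_left_filter; exact: continuous_horner.
- by move=> x _; rewrite -derivE.
Qed.

Lemma Rintegral_monomials (I : Type) (r : seq I) (c : I -> R) (e : I -> nat) (t : R) :
  0 <= t ->
  \int[lebesgue_measure]_(u in `[0, t]%classic) (\sum_(a <- r) c a * u ^+ e a) =
  \sum_(a <- r) c a / (e a).+1%:R * t ^+ (e a).+1.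
Proof.
move=> t0; pose p : {poly R} := \sum_(a <- r) (c a / (e a).+1%:R) *: 'X^((e a).+1).
have -> : (fun u => \sum_(a <- r) c a * u ^+ e a) = (fun u => (p^`()).[u]).
  apply/funext => u; rewrite /p raddf_sum horner_sum; apply: eq_bigr => a _ /=.
  rewrite derivZ derivXn hornerZ hornerMn hornerXn -mulr_natr /=.
  by field; rewrite addrC natr1 pnatr_eq0.
rewrite Rintegral_horner // /p !horner_sum [X in _ - X]big1 ?subr0.
  by apply: eq_bigr => a _; rewrite hornerZ hornerXn.
by move=> a _; rewrite hornerZ hornerXn expr0n mulr0.
Qed.

(** For the inner integral the outer variable u is a constant and goes into the coefficients; hence
    the arbitrary families c and e. Exponents are indexed by all naturals so that their type does
    not change with k. *)
Lemma simplex_integral_monomials k (I : Type) (r : seq I) (c : I -> R)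
    (e : I -> nat -> nat) (f : seq R -> R) (t : R) :
  0 <= t ->
  (forall s, size s = k -> f s = \sum_(a <- r) c a * \prod_(i < k) nth 0 s i ^+ e a i) ->
  simplex_integral k f t =
  \sum_(a <- r) c a * \prod_(j < k) ((\sum_(i < j.+1) e a i + j.+1)%:R)^-1
    * t ^+ (\sum_(i < k) e a i + k).
Proof.
elim: k c f t => [|k IH] c f t t0 fE /=.
  rewrite fE //; apply: eq_bigr => a _.
  by rewrite !big_ord0 addn0 expr0 !mulr1.
pose d a := c a * \prod_(j < k) ((\sum_(i < j.+1) e a i + j.+1)%:R)^-1.
pose N a := (\sum_(i < k.+1) e a i + k)%N.
have inner (u : R) : 0 <= u ->
    simplex_integral k (fun s => f (rcons s u)) u = \sum_(a <- r) d a * u ^+ N a.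
  move=> u0; rewrite (IH (fun a => c a * u ^+ e a k)) // => [|s sk].
    apply: eq_bigr => a _; rewrite /d /N big_ord_recr /= !exprD.
    by ring.
  rewrite fE ?size_rcons ?sk //; apply: eq_bigr => a _.
  rewrite big_ord_recr /= nth_rcons sk ltnn eqxx mulrAC mulrA.
  congr (_ * _ * _); apply: eq_bigr => i _.
  by rewrite nth_rcons sk ltn_ord.
transitivity (\int[lebesgue_measure]_(u in `[0, t]%classic) (\sum_(a <- r) d a * u ^+ N a)).
  by apply: eq_Rintegral => u; rewrite inE /= in_itv /= => /andP[u0 _]; exact: inner.
rewrite Rintegral_monomials //; apply: eq_bigr => a _.
by rewrite /d /N [in RHS]big_ord_recr /= !mulrA addnS.
Qed.

(** The bridge between the iterated Lebesgue integral and the algebraic functional. *)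
Lemma simplex_integralE k (p : {mpoly R[k]}) (f : seq R -> R) :
  (forall s, size s = k -> f s = p.@[fun i => nth 0 s i]) ->
  simplex_integral k f 1 = simplexI idfun p.
Proof.
move=> fE; rewrite (@simplex_integral_monomials k _ (msupp p) (fun m => p@_m)
   (fun m i => if insub i is Some i' then m (i' : 'I_k) else 0%N)) //.
  rewrite /simplexI /mlin; apply: eq_bigr => m _.
  rewrite expr1n mulr1; congr (_ * _); apply: eq_bigr => s _ /=.
  congr (_ + _)%:R^-1.
  rewrite (big_ord_widen_cond k xpredT (fun i => if insub i is Some i' then m i' else 0%N)) ?ltn_ord //.
  by rewrite /psum; apply: eq_big => [i|i _]; rewrite ?ltnS // valK.
move=> s sk; rewrite fE // mevalE; apply: eq_bigr => m _.
by congr (_ * _); apply: eq_bigr => i _; rewrite valK.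
Qed.

End SimplexIntegral.

(** * The cocycle Theta *)

Section LaurentConstants.
Variable C : fieldType.

Lemma laurentC_is_zmod_morphism : zmod_morphism (@laurentC C).
Proof. by move=> x y; apply: val_inj; rewrite /= polyCB tofracB. Qed.

Lemma laurentC_is_monoid_morphism : monoid_morphism (@laurentC C).
Proof. by split=> [|x y]; apply: val_inj; rewrite /= ?polyC1 ?tofrac1 // polyCM tofracM. Qed.

HB.instance Definition _ :=
  GRing.isZmodMorphism.Build C (laurent C) (@laurentC C) laurentC_is_zmod_morphism.
HB.instance Definition _ :=
  GRing.isMonoidMorphism.Build C (laurent C) (@laurentC C) laurentC_is_monoid_morphism.

Lemma laurentC_eq0 (c : C) : (laurentC c == 0) = (c == 0).
Proof.
apply/eqP/eqP => [/(congr1 val) /= /eqP|->]; last exact: rmorph0.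
by rewrite tofrac_eq0 polyC_eq0 => /eqP.
Qed.

End LaurentConstants.

Section TauCoefficients.
Variables (R : realType) (n : nat).

Lemma tau_coefE (m : ordered_pair n.*2.+1 -> nat) : @tau_coef R n m = phase_coef R m.
Proof.
apply: simplex_integralE => s sk.
rewrite rmorph_prod; apply: eq_bigr => e _.
rewrite /dpow rmorphM rmorphXn /= mevalC. congr (_ ^+ _ * _).
have vE (i : 'I_n.*2.+1) : (vertex R n.*2 i).@[fun i => nth 0 s i] = nth 0 (0 :: s) i.
  case: i => -[|i] lti /=; first by rewrite meval0.
  by rewrite insubT mevalXU.
by rewrite /linear_phase mevalD mevalB !mevalM !vE rmorph1 rmorph_nat.
Qed.

End TauCoefficients.

Section WeylInterface.
Variables (R : realType) (n : nat).
Local Notation KR := (Defs.K R).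

(** The coefficients of [tau] are integrals of real functions, so the field F of the general part is
    R, embedded through the complex numbers. *)
Definition real_laurent : R -> KR := @laurentC R[i] \o @real_complex R.
HB.instance Definition _ := GRing.RMorphism.on real_laurent.

(** By conversion: the general definitions are shaped so as to unfold to the same terms as those of
    the statement. *)
Lemma tau_tau_op (a : 'I_n.*2.+1 -> weyl R n) :
  tau a = tau_op real_laurent (laurentC 2^-1) (eps R[i]) (@pvar n) (@qvar n)
            (@tau_coef R n) (tau_tensor a).
Proof. by []. Qed.

Lemma moyal_star_op (f g : weyl R n) :
  moyal f g = star_op real_laurent (laurentC 2^-1) (eps R[i]) (@pvar n) (@qvar n) f g.
Proof.
transitivity (@ptmul KR n.*2 2 (\sum_(m < msize (ptensor (pair_fun f g)))
  (laurentC m`!%:R^-1 * eps R[i] ^+ m) *: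
     iter m (alpha_op (laurentC 2^-1) (@pvar n) (@qvar n) (ord0 : 'I_2) ord_max) (ptensor (pair_fun f g)))).
  by [].
rewrite /star_op; apply: (f_equal (@ptmul KR n.*2 2)); apply: eq_bigr => m _.
apply: (f_equal (fun c => (laurentC c * _) *: _)).
by rewrite -(rmorph_nat (real_complex R)) -fmorphV.
Qed.

Local Notation J := (poisson_matrix (laurentC 2^-1 : KR) (@pvar n) (@qvar n)).
Hypothesis n_gt0 : (0 < n)%N.

Lemma d_gt0 : (0 < n.*2)%N. Proof. by rewrite double_gt0. Qed.

Lemma tau_series (a : 'I_n.*2.+1 -> weyl R n) B : (msize (tau_tensor a) <= B)%N ->
  tau a = tser real_laurent J (eps R[i]) B a.
Proof. by move=> leB; rewrite tau_tau_op; apply: tau_opE => // m; exact: tau_coefE. Qed.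

Lemma moyal_series (f g : weyl R n) B : (msize (ptensor (pair_fun f g)) <= B)%N ->
  moyal f g = \sum_(l < B) (real_laurent l`!%:R^-1 * eps R[i] ^+ l) *: star_coef J l f g.
Proof. by move=> leB; rewrite moyal_star_op; exact: star_opE. Qed.

Let Jd := poisson_diag (laurentC 2^-1 : KR) (@pvar n) (@qvar n).
Let Js := poisson_skew (laurentC 2^-1 : KR) (@pvar n) (@qvar n).

Lemma weyl_tau_linear (a : 'I_n.*2.+1 -> weyl R n) i c u v :
  tau (fupd a i (c *: u + v)) = c * tau (fupd a i u) + tau (fupd a i v).
Proof. exact: (tau_linear tau_series). Qed.

Lemma weyl_tau1 (a : 'I_n.*2.+1 -> weyl R n) (i : 'I_n.*2) c :
  tau (fupd a (lift ord0 i) (c *: 1)) = 0.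
Proof. exact: (tau_slot1 d_gt0 tau_series). Qed.

Lemma weyl_tau_quadratic q (x : 'I_n.*2 -> weyl R n) : quadratic_like q ->
  \sum_(j < n.*2) (-1) ^+ j * tau (insert (lift ord0 j) q x) = 0.
Proof. exact: (tau_quadratic_like d_gt0 Jd Js tau_series). Qed.

Lemma moyal_linearl c (u v w : weyl R n) :
  moyal (c *: u + v) w = c *: moyal u w + moyal v w.
Proof. exact: (star_bilinearl moyal_series). Qed.

Lemma moyal_linearr c (u v w : weyl R n) :
  moyal w (c *: u + v) = c *: moyal w u + moyal w v.
Proof. exact: (star_bilinearr moyal_series). Qed.

Lemma weyl_tau_contr (a : 'I_n.*2.+2 -> weyl R n) :
  \sum_(j < n.*2.+1) (-1) ^+ j * tau (contr (@moyal R n) j a) +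
  (-1) ^+ n.*2.+1 * tau (wrap_contr (@moyal R n) a) = 0.
Proof. exact: (tau_contr d_gt0 Jd Js tau_series moyal_series). Qed.

Lemma weyl_tau_vars (s : 'S_n.*2) :
  tau (insert ord0 (1 : weyl R n) (fun i => 'X_(s i))) =
  (-1) ^+ s * real_laurent (n.*2)`!%:R^-1.
Proof. exact: (tau_vars d_gt0 tau_series). Qed.

End WeylInterface.

Section GLInterface.
Variables (R : realType) (n N : nat).
Local Notation KR := (Defs.K R).
Local Notation A := {mpoly KR[n.*2]}.
Local Notation lC := (map_mx (@laurentC R[i])).
Hypothesis n_gt0 : (0 < n)%N.

(** The identity, marking the passage from the K-module [gl], with its own scaling, to plain
    matrices. *)
Definition gl_entries (x : gl R n N) : 'M[A]_N := x.

Lemma Theta_mxphi (x : 'I_n.*2 -> gl R n N) (x0 : gl R n N) :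
  Theta x x0 = \sum_(s : 'S_n.*2) (-1) ^+ s *
    mxphi (@tau R n) (insert ord0 (gl_entries x0) ((gl_entries \o x) \o s)).
Proof.
rewrite antisym_mxphi; apply: eq_bigr => e _; apply: eq_bigr => e0 _; apply: eq_bigr => s _.
rewrite map_trace_prod map_delta_mx.
under [in LHS]eq_bigr do rewrite map_delta_mx.
by [].
Qed.

Lemma pure_entries (M : 'M[R[i]]_N) (a : weyl R n) :
  gl_entries (pure M a) = mxpure (lC M) (a : A).
Proof. by apply/matrixP => i j; rewrite !mxE. Qed.

Lemma Theta_pureE (M : 'I_n.*2 -> 'M[R[i]]_N) (a : 'I_n.*2 -> weyl R n)
    (M0 : 'M[R[i]]_N) (a0 : weyl R n) :
  Theta (fun k => pure (M k) (a k)) (pure M0 a0) =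
  \sum_(sg : 'S_n.*2) (-1) ^+ sg * tau (fcons a0 (a \o sg)) *
          laurentC (\tr (M0 *m \prod_(i < n.*2) M (sg i))).
Proof.
rewrite Theta_mxphi pure_entries.
have -> : gl_entries \o (fun k => pure (M k) (a k)) = fun k => mxpure (lC (M k)) (a k : A).
  by apply/funext => k; rewrite -pure_entries.
rewrite antisym_mxpure; last exact: weyl_tau_linear.
apply: eq_bigr => s _; apply: (f_equal (fun z => _ * z)).
by rewrite map_trace_prod.
Qed.

Lemma laurentC_nat m : laurentC (m%:R : R[i]) = m%:R :> KR.
Proof. exact: rmorph_nat. Qed.

(** The sign of a permutation occurs twice, once from the antisymmetrization and once from
    [weyl_tau_vars]; each of the (2n)! permutations thus contributes N/(2n)!. *)
Lemma Theta_normalized : Theta (fun k => pure (1%:M : 'M[R[i]]_N) ('X_k : weyl R n))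
            (pure (1%:M : 'M[R[i]]_N) (1 : weyl R n)) = N%:R.
Proof.
rewrite Theta_pureE.
transitivity (\sum_(s : 'S_n.*2) (-1) ^+ s *
   ((-1) ^+ s * @real_laurent R (n.*2)`!%:R^-1) * (N%:R : KR)).
  apply: eq_bigr => s _; rewrite -weyl_tau_vars //; apply: (f_equal (fun z => _ * z)).
  by rewrite big1 // mulmx1 mxtrace1 laurentC_nat.
rewrite sum_sign_sq mulrA -(rmorph_nat (@real_laurent R)) -rmorphM mulfV ?rmorph1 ?mul1r //.
Qed.

Lemma Kspan_ind (K : comNzRingType) (V : lmodType K) (S : set V) (P : V -> Prop) :
    P 0 -> (forall c u v, S u -> P v -> P (c *: u + v)) ->
  forall v, Kspan S v -> P v.
Proof.
move=> P0 PS _ [m [a [s [Ss ->]]]].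
by elim/big_rec: _ => // i v _ Pv; exact: PS.
Qed.

Lemma gl_entries_linear c (u v : gl R n N) a b :
  gl_entries (c *: u + v) a b = c *: gl_entries u a b + gl_entries v a b.
Proof. by rewrite /gl_entries [LHS]mxE [X in X + _]mxE. Qed.

Lemma gl_const_entries y : @gl_const R n N y ->
  exists c : 'M[KR]_N, forall a b, gl_entries y a b = c a b *: (1 : A).
Proof.
move: y; apply: Kspan_ind => [|k _ v [M ->] [c vE]].
  by exists 0 => a b; rewrite !mxE scale0r.
exists (k *: lC M + c) => a b.
rewrite gl_entries_linear vE pure_entries !mxE scalerDl; apply: (f_equal (fun z => z + _)).
by rewrite scalerA.
Qed.

Lemma sp_entries y : @sp R n N y ->
  exists q : A, quadratic_like q /\
    forall a b, gl_entries y a b = (1%:M : 'M[KR]_N) a b *: q.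
Proof.
move: y; apply: Kspan_ind => [|k _ v [a ha ->] [q [qq vE]]].
  exists 0; split; last by move=> a b; rewrite mxE scaler0.
  by split=> *; rewrite ?mderiv0 ?meval0.
exists (k *: a + q); split.
  exact: (quadratic_like_linear k (dhomog2_quadratic ha) qq).
move=> i j; rewrite gl_entries_linear vE pure_entries map_mx1 [mxpure _ _ i j]mxE scalerDr.
by apply: (f_equal (fun z => z + _)); rewrite !scalerA mulrC.
Qed.

Lemma gl_sp_isotropic z : @gl_sp R n N z ->
  isotropic (1 : A) (@quadratic_like KR n.*2) gl_entries z.
Proof.
case=> y [w [/gl_const_entries [c yE] /sp_entries [q [qq wE]] ->]].
exists c, q; split=> // a b; rewrite -yE -wE.
by have := gl_entries_linear 1 y w a b; rewrite !scale1r.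
Qed.

Lemma gl_mul_entries x y : gl_entries (gl_mul x y) =
  mxmul (@moyal R n) (gl_entries x) (gl_entries y).
Proof. by []. Qed.

Lemma gl_mul_pure1 (a b : weyl R n) :
  gl_mul (pure (1%:M : 'M[R[i]]_N) a) (pure 1%:M b) = pure 1%:M (moyal a b).
Proof.
rewrite -[LHS]/(gl_entries _) -[RHS]/(gl_entries _) gl_mul_entries !pure_entries.
rewrite mxmul_pure; [|exact: moyal_linearl|exact: moyal_linearr].
by rewrite map_mx1 mulmx1.
Qed.

Lemma gl_br_var1 (i : 'I_n.*2) :
  gl_br (pure (1%:M : 'M[R[i]]_N) ('X_i : weyl R n)) (pure 1%:M 1) = 0.
Proof.
rewrite /gl_br !gl_mul_pure1.
rewrite (star1r (@moyal_series R n)) (star1l (@moyal_series R n)) subrr.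
exact: scaler0.
Qed.

Lemma gl_br_vars (i j : 'I_n.*2) :
  gl_sp (gl_br (pure (1%:M : 'M[R[i]]_N) ('X_i : weyl R n)) (pure 1%:M 'X_j)).
Proof.
have [c cE] := star_commutator_vars (@moyal_series R n) i j.
exists (gl_br (pure (1%:M : 'M[R[i]]_N) ('X_i : weyl R n)) (pure 1%:M 'X_j)), 0; split.
(* The commutator of two variables is c times 1, so the bracket is the multiple c / eps of the
   identity matrix, with zero component in sp_2n. *)
- exists 1%N, (fun=> epsV _ * c), (fun=> pure 1%:M 1); split; first by move=> _; exists 1%:M.
  rewrite big_ord1 /gl_br !gl_mul_pure1 -scalerA; apply: (f_equal (fun z => _ *: z)).
  apply/matrixP => a b; rewrite !mxE -scalerBr cE.
  by rewrite scalerA mulrC -scalerA.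
- by exists 0%N, (fun=> 0), (fun=> 0); split=> [[]|] //; rewrite big_ord0.
- by rewrite addr0.
Qed.

Lemma Theta_relative : rel_cochain (@gl_br R n N) (@gl_sp R n N) (@Theta R n N).
Proof.
apply: (@theta_relative KR A 1 (@quadratic_like KR n.*2) n.*2 _ (@tau R n) _ _ _ (@moyal R n) _ _ _
  N (gl R n N) gl_entries (@gl_mul R n N) (epsV _)) => //.
- by rewrite double_gt0.
- exact: weyl_tau_linear.
- exact: weyl_tau1.
- exact: weyl_tau_quadratic.
- exact: moyal_linearl.
- exact: moyal_linearr.
- exact: weyl_tau_contr.
- exact: gl_entries_linear.
- exact: gl_sp_isotropic.
- exact: Theta_mxphi.
Qed.

End GLInterface.

(** Once N' is written as N + r, padding by zeros is a block matrix, and the trace of a nonempty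
    product of such blocks does not depend on r. *)
Lemma Theta_incl (R : realType) (n N N' : nat) (x : 'I_n.*2 -> gl R n N) (x0 : gl R n N) :
  (0 < n)%N -> (N <= N')%N ->
  Theta (fun k => gl_incl N' (x k)) (gl_incl N' x0) = Theta x x0.
Proof.
move=> n_gt0 le_N; have [r ->] : exists r, N' = (N + r)%N by exists (N' - N)%N; rewrite subnKC.
have inclE (y : gl R n N) : gl_entries (gl_incl (N + r) y) = mxincl r (gl_entries y).
  apply/matrixP => i j; rewrite mxE /mxincl.
  case: (split_ordP i) => i' ->; case: (split_ordP j) => j' -> /=.
  - rewrite block_mxEul (insubT (fun m => m < N)%N (ltn_ord i')) (insubT (fun m => m < N)%N (ltn_ord j')).
    by congr (y _ _); exact: val_inj.
  - by rewrite block_mxEur mxE; case: insubP => // ? _ _; rewrite insubN // -leqNgt leq_addr.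
  - by rewrite block_mxEdl mxE insubN // -leqNgt leq_addr.
  - by rewrite block_mxEdr mxE insubN // -leqNgt leq_addr.
rewrite !Theta_mxphi; apply: eq_bigr => s _; apply: (f_equal (fun z => _ * z)).
rewrite -(mxphi_incl r (insert ord0 (gl_entries x0) ((@gl_entries R n N \o x) \o s)) (weyl_tau_linear n_gt0)).
apply: (f_equal (mxphi (@tau R n))).
apply/funext => u; case: (unliftP ord0 u) => [v ->|->]; rewrite ?insert_lift ?insert_at //=.
Qed.

Lemma Theta_nontrivial (R : realType) (n N : nat) : (0 < n)%N -> (0 < N)%N ->
  nontrivial_class (@gl_br R n N) (@gl_sp R n N) (@Theta R n N).
Proof.
move=> n_gt0 N_gt0.
apply: (@theta_nontrivial (Defs.K R) {mpoly (Defs.K R)[n.*2]} 1 (@quadratic_like _ n.*2) n.*2 _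
  (@tau R n) _ _ _ (@moyal R n) _ _ _
  N (gl R n N) (@gl_entries R n N) (@gl_mul R n N) (epsV _) _ _ _ _ _ _ _ _
  (fun k => pure 1%:M 'X_k) (pure 1%:M 1)) => //.
- by rewrite double_gt0.
- exact: weyl_tau_linear.
- exact: weyl_tau1.
- exact: weyl_tau_quadratic.
- exact: moyal_linearl.
- exact: moyal_linearr.
- exact: weyl_tau_contr.
- exact: gl_entries_linear.
- exact: gl_sp_isotropic.
- exact: Theta_mxphi.
- by move=> i; exact: gl_br_var1.
- by move=> i j; exact: gl_br_vars.
- rewrite Theta_normalized // -laurentC_nat laurentC_eq0 pnatr_eq0 -lt0n //.
Qed.

(** The first clause justifies defining [Theta] through elementary matrices: on all pure tensors it
    gives back the formula of the cocycle. *)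
Theorem corollary3p1 (R : realType) (n N : nat) (hn : (0 < n)%N) (hN : (0 < N)%N) :
  [/\ forall (M : 'I_n.*2 -> 'M[R[i]]_N) (a : 'I_n.*2 -> weyl R n)
             (M0 : 'M[R[i]]_N) (a0 : weyl R n),
        Theta (fun k => pure (M k) (a k)) (pure M0 a0) =
        \sum_(sg : 'S_n.*2) (-1) ^+ sg * tau (fcons a0 (a \o sg)) *
          laurentC (\tr (M0 *m \prod_(i < n.*2) M (sg i))),
      rel_cochain (@gl_br R n N) (@gl_sp R n N) (@Theta R n N),
      nontrivial_class (@gl_br R n N) (@gl_sp R n N) (@Theta R n N),
      forall (N' : nat) (x : 'I_n.*2 -> gl R n N) (x0 : gl R n N), (N < N')%N ->
        Theta (fun k => gl_incl N' (x k)) (gl_incl N' x0) = Theta x x0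
    & Theta (fun k => pure (1%:M : 'M[R[i]]_N) ('X_k : weyl R n))
            (pure (1%:M : 'M[R[i]]_N) (1 : weyl R n)) = N%:R].
Proof.
split.
- exact: Theta_pureE.
- exact: Theta_relative.
- exact: Theta_nontrivial.
- by move=> N' x x0 lt_N; apply: Theta_incl => //; exact: ltnW.
- exact: Theta_normalized.
Qed.
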